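(* Suppose that $M\subset\mathbb{C}^{n+1}$, $n\ge 2$, is (a sufficiently small representative of a germ at the origin of) a real-analytic Levi-flat CR singular submanifold of type C.1 or C.0, that is, $M$ is given in coordinates $(z,w)\in\mathbb{C}^n\times\mathbb{C}$ by $$w=\bar z_1z_2+\bar z_1^2+O(3)\qquad\text{or}\qquad w=\bar z_1z_2+O(3).$$ Then there exists a nonsingular real-analytic foliation defined on $M$ that extends the Levi-foliation on $M_{CR}$, and consequently there exists a CR real-analytic mapping $F\colon U\subset\mathbb{R}^2\times\mathbb{C}^{n-1}\to\mathbb{C}^{n+1}$ ($U$ open) such that $F$ is a diffeomorphism onto $F(U)=M\cap U'$, for some neighbourhood $U'$ of $0$.
   Context: For a real submanifold $M$ of complex Euclidean space with complex structure $J$, $T^c_pM=T_pM\cap J(T_pM)$. $M$ is CR at $p$ if $\dim T^c_qM$ is constant for $q\in M$ near $p$; $M_{CR}$ is the set of such points; $M$ is CR singular at $p$ if $p\notin M_{CR}$. A CR submanifold is Levi-flat if its Levi-map vanishes identically (equivalently, $T^cM$ is involutive); a CR singular $M$ is Levi-flat if $M_{CR}$ is. For a Levi-flat real codimension 2 submanifold $M\subset\mathbb{C}^{n+1}$ as here, $M_{CR}$ carries the Levi-foliation: the foliation by complex submanifolds of complex dimension $n-1$ tangent to $T^cM_{CR}$. A nonsingular real-analytic foliation on $M$ extends the Levi-foliation if the two have the same germs of leaves at each point of $M_{CR}$. The CR structure on $\mathbb{R}^2\times\mathbb{C}^{n-1}$ is the one induced from $\mathbb{C}^2\times\mathbb{C}^{n-1}$;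 thus a map from it to $\mathbb{C}^{n+1}$ is CR if its components are holomorphic in the $\mathbb{C}^{n-1}$ variables. $O(3)$ denotes real-analytic terms vanishing to order at least $3$ at the origin. *)

(* Defs.v *)
From mathcomp Require Import all_boot all_order all_algebra complex.
From mathcomp Require Import all_classical all_reals all_analysis.

Set Implicit Arguments.
Unset Strict Implicit.
Unset Printing Implicit Defensive.

Import Order.TTheory GRing.Theory Num.Theory.
Import numFieldNormedType.Exports.

Local Open Scope classical_set_scope.
Local Open Scope ring_scope.
Local Open Scope complex_scope.

Section Analytic.
Context {R : realType}.

Definition monomial m (h : 'rV[R]_m) (a : {ffun 'I_m -> nat}) : R :=
  \prod_(i < m) h 0 i ^+ a i.

(* Partial sum over the box of the multi-indices with all entries < N. *)
Definition pseries_sum m (c : {ffun 'I_m -> nat} -> R) (h : 'rV[R]_m) (N : nat)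
    : R :=
  \sum_(a : {ffun 'I_m -> 'I_N})
     c [ffun i => a i : nat] * monomial h [ffun i => a i : nat].

(* The Cauchy bounds on [c] say that the series converges absolutely on the
   polydisc of radius [r], so that the order of summation is irrelevant; [`|h|]
   is the sup norm. *)
Definition power_series_at m (f : 'rV[R]_m -> R) (p : 'rV[R]_m)
    (c : {ffun 'I_m -> nat} -> R) : Prop :=
  exists r K : R,
    [/\ 0 < r,
        forall a, `|c a| * r ^+ (\sum_(i < m) a i)%N <= K
      & forall h, `|h| < r -> pseries_sum c h N @[N --> \oo] --> f (p + h)].

Definition analytic_at m l (f : 'rV[R]_m -> 'rV[R]_l) (p : 'rV[R]_m) : Prop :=
  forall j, exists c, power_series_at (fun x => f x 0 j) p c.

Definition vanishing_analytic m (k : nat) (f : 'rV[R]_m -> R) : Prop :=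
  exists2 c, power_series_at f 0 c &
    forall a : {ffun 'I_m -> nat}, (\sum_(i < m) a i < k)%N -> c a = 0.

(* Analyticity of a map which is only meaningful on [S]: it is locally the
   restriction of an ambient analytic map. *)
Definition analytic_on_subset m l (S : set 'rV[R]_m)
    (f : 'rV[R]_m -> 'rV[R]_l) : Prop :=
  forall p, S p -> exists2 g : 'rV[R]_m -> 'rV[R]_l,
    analytic_at g p & \forall q \near p, S q -> f q = g q.

Definition analytic_diffeo m l (U : set 'rV[R]_m) (S : set 'rV[R]_l)
    (f : 'rV[R]_m -> 'rV[R]_l) : Prop :=
  [/\ set_bij U S f,
      (forall x, U x -> analytic_at f x)
    & exists2 g : 'rV[R]_l -> 'rV[R]_m,
        (forall x, U x -> g (f x) = x) & analytic_on_subset S g].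

Definition analytic_submanifold m (c : nat) (M : set 'rV[R]_m) : Prop :=
  forall p, M p -> exists g : 'rV[R]_m -> 'rV[R]_c,
    [/\ analytic_at g p,
        (forall u, exists v, 'd g p v = u)
      & \forall q \near p, M q <-> g q = 0].

Definition tangent m (M : set 'rV[R]_m) (p : 'rV[R]_m) : set 'rV[R]_m :=
  [set v | exists gamma : R -> 'rV[R]_m,
     [/\ gamma 0 = p, \forall t \near (0 : R), M (gamma t)
       & is_derive (0 : R) (1 : R) gamma v]].

Definition has_dim m (T : set 'rV[R]_m) (d : nat) : Prop :=
  exists2 B : 'M[R]_(d, m), row_free B & T = [set v | (v <= B)%MS].

Definition same_germ m (p : 'rV[R]_m) (A B : set 'rV[R]_m) : Prop :=
  \forall q \near p, A q <-> B q.

Definition plaque m c (M : set 'rV[R]_m)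
    (phi : set 'rV[R]_m * ('rV[R]_m -> 'rV[R]_c)) (p : 'rV[R]_m)
    : set 'rV[R]_m :=
  [set q | [/\ M q, phi.1 q & phi.2 q = phi.2 p]].

(* A nonsingular real-analytic foliation of codimension [c] of the submanifold
   [M], given by a distinguished atlas: a chart [(W, t)] is an analytic map [t]
   on the open set [W] whose restriction to [M] is a submersion to R^c, and
   whose level sets in [M] are the plaques; the plaques of two charts through a
   common point have the same germ there.  The germ at [p] of the leaf through
   [p] is the germ of the plaque through [p]. *)
Record foliation m (c : nat) (M : set 'rV[R]_m) := Foliation {
  charts : set (set 'rV[R]_m * ('rV[R]_m -> 'rV[R]_c));
  chart_open : forall phi, charts phi -> open phi.1;
  chart_cover : forall p, M p -> exists2 phi, charts phi & phi.1 p;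
  chart_analytic : forall phi p, charts phi -> phi.1 p -> analytic_at phi.2 p;
  chart_submersion : forall phi p, charts phi -> M p -> phi.1 p ->
    forall u, exists2 v, tangent M p v & 'd (phi.2) p v = u;
  chart_compatible : forall phi psi p, charts phi -> charts psi ->
    M p -> phi.1 p -> psi.1 p -> same_germ p (plaque M phi p) (plaque M psi p)
}.

End Analytic.

Section Complex.
Context {R : realType}.

(* C^k is the real space R^k x R^k of real and imaginary parts. *)
Definition Cn k := 'rV[R]_(k + k).

Definition coord k (z : 'rV[R]_(k + k)) (j : 'I_k) : R[i] :=
  z 0 (lshift k j) +i* z 0 (rshift k j).

Definition J k (v : 'rV[R]_(k + k)) : 'rV[R]_(k + k) :=
  row_mx (- rsubmx v) (lsubmx v).

Definition holomorphic k l (A : set 'rV[R]_(k + k))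
    (f : 'rV[R]_(k + k) -> 'rV[R]_(l + l)) : Prop :=
  forall x, A x ->
    differentiable f x /\ forall v, 'd f x (J v) = J ('d f x v).

(* CR maps from (an open subset of) R^d x C^k, a point of which is
   [row_mx t zeta]. *)
Definition CR_map d k l (U : set 'rV[R]_(d + (k + k)))
    (F : 'rV[R]_(d + (k + k)) -> 'rV[R]_(l + l)) : Prop :=
  forall t : 'rV[R]_d,
    holomorphic [set zeta | U (row_mx t zeta)] (fun zeta => F (row_mx t zeta)).

Section CRGeometry.
Context {k : nat}.
Implicit Types (M : set 'rV[R]_(k + k)) (p q : 'rV[R]_(k + k)).

Definition Tc M p : set 'rV[R]_(k + k) := tangent M p `&` (@J k @` tangent M p).

Definition CR_part M : set 'rV[R]_(k + k) :=
  [set p | M p /\ exists d, \forall q \near p, M q -> has_dim (Tc M q) d].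

Definition CR_singular_at M p : Prop := M p /\ ~ CR_part M p.

(* An element [(a, b)] of ['rV[R]_(k + k) * 'rV[R]_(k + k)] stands for the
   vector [a + i b] of the complexification of the tangent space of C^k. *)
Local Notation CV := ('rV[R]_(k + k) * 'rV[R]_(k + k))%type.

Definition conjCV (x : CV) : CV := (x.1, - x.2).

(* The vectors [x] of the complexification of [tangent M p] with [J x = i x]. *)
Definition T10 M p : set CV :=
  [set x | [/\ tangent M p x.1, tangent M p x.2, J x.1 = - x.2 & J x.2 = x.1]].

Definition T10_plus_T01 M p : set CV :=
  [set x | exists a b : CV, [/\ T10 M p a, T10 M p b & x = a + conjCV b]].

Definition lie_bracket (X Y : 'rV[R]_(k + k) -> 'rV[R]_(k + k)) p
    : 'rV[R]_(k + k) :=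
  'd Y p (X p) - 'd X p (Y p).

(* Complex-bilinear extension of [lie_bracket]. *)
Definition lie_bracketC (X Y : 'rV[R]_(k + k) -> CV) p : CV :=
  let X1 q := (X q).1 in let X2 q := (X q).2 in
  let Y1 q := (Y q).1 in let Y2 q := (Y q).2 in
  (lie_bracket X1 Y1 p - lie_bracket X2 Y2 p,
   lie_bracket X1 Y2 p + lie_bracket X2 Y1 p).

Definition T10_section M p (X : 'rV[R]_(k + k) -> CV) : Prop :=
  [/\ analytic_at (fun q => (X q).1) p, analytic_at (fun q => (X q).2) p
    & \forall q \near p, M q -> T10 M q (X q)].

(* The Levi-map at [p] sends [(X p, Y p)] to the class of [[X, conj Y] p]
   modulo T^{1,0} + T^{0,1}, for any local sections [X], [Y] of T^{1,0}. *)
Definition Levi_map_vanishes_at M p : Prop :=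
  forall X Y, T10_section M p X -> T10_section M p Y ->
    T10_plus_T01 M p (lie_bracketC X (fun q => conjCV (Y q)) p).

Definition Levi_flat M : Prop :=
  forall p, CR_part M p -> Levi_map_vanishes_at (CR_part M) p.

(* The leaves have tangent spaces T^c, which are stable under [J], so they are
   complex submanifolds; when [M] has real dimension 2n and [c = 2], their
   complex dimension is n - 1. *)
Definition is_Levi_foliation c M (L : foliation c (CR_part M)) : Prop :=
  forall phi p, charts L phi -> CR_part M p -> phi.1 p ->
    tangent (plaque (CR_part M) phi p) p = Tc M p.

Definition extends_foliation c M (F : foliation c M)
    (L : foliation c (CR_part M)) : Prop :=
  forall p, CR_part M p -> forall phi psi, charts F phi -> charts L psi ->
    phi.1 p -> psi.1 p ->
    same_germ p (plaque M phi p) (plaque (CR_part M) psi p).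

End CRGeometry.

Section Types.
Variables (n : nat) (hn : (2 <= n)%N).

(* C^{n+1} = C^n x C, with coordinates (z, w). *)
Definition zpart (p : 'rV[R]_(n.+1 + n.+1)) : 'rV[R]_(n + n) :=
  row_mx (\row_j p 0 (lshift n.+1 (widen_ord (leqnSn n) j)))
         (\row_j p 0 (rshift n.+1 (widen_ord (leqnSn n) j))).

Definition wcoord (p : 'rV[R]_(n.+1 + n.+1)) : R[i] := coord p ord_max.

Definition z1 (z : 'rV[R]_(n + n)) : R[i] := coord z (Ordinal (ltnW hn)).
Definition z2 (z : 'rV[R]_(n + n)) : R[i] := coord z (Ordinal hn).

Definition germ_O3 (Q : 'rV[R]_(n + n) -> R[i])
    (M : set 'rV[R]_(n.+1 + n.+1)) : Prop :=
  exists E : 'rV[R]_(n + n) -> R[i],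
    [/\ vanishing_analytic 3 (fun z => complex.Re (E z)),
        vanishing_analytic 3 (fun z => complex.Im (E z))
      & \forall p \near (0 : 'rV[R]_(n.+1 + n.+1)),
          M p <-> wcoord p = Q (zpart p) + E (zpart p)].

Definition type_C1 (M : set 'rV[R]_(n.+1 + n.+1)) : Prop :=
  germ_O3 (fun z => (z1 z)^* * z2 z + (z1 z)^* ^+ 2) M.

Definition type_C0 (M : set 'rV[R]_(n.+1 + n.+1)) : Prop :=
  germ_O3 (fun z => (z1 z)^* * z2 z) M.

End Types.
End Complex.
Arguments Cn : clear implicits.

(* Main.v *)
Require Import Defs.
From HB Require Import structures.
From mathcomp Require Import all_boot all_order all_algebra complex.
From mathcomp Require Import all_classical all_reals all_analysis.
From mathcomp Require Import ring lra.
Import Order.TTheory GRing.Theory Num.Theory.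
Import numFieldNormedType.Exports.
Import Defs.
Local Open Scope classical_set_scope.
Local Open Scope ring_scope.
Set Implicit Arguments.
Unset Strict Implicit.
Unset Printing Implicit Defensive.

(** Write [M] near the origin as a graph [w = f(z, conj z)], where
    [f(z, xi) = xi_1 z_2 + eps xi_1^2 + E(z, xi)] is holomorphic in the
    independent variables [z] and [xi], and [E] vanishes to third order.  The
    leaves of the Levi-foliation project to complex hypersurfaces of C^n on which
    [f(z, conj z)] is holomorphic.  Polarizing this on a leaf, [f(p, conj z)]
    does not depend on [z] when [p] and [z] run over the same leaf.  The leaf
    through [p] is therefore contained in the Segre variety
    [{z | f(p, conj z) = f(p, conj p)}].

    This is what extends the foliation.  Take [p = (s, delta, 0, ..., 0)] on the
    line through the base point [(0, delta, 0, ..., 0)], at a small distance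
    [delta] from the origin.  There [df/dxi_1] is close to [delta], and it
    dominates the other terms on a polydisc of size [delta] that contains the
    origin.  The equation of the Segre variety is thus solved for the first
    coordinate by a contraction ([segre_solution]), even near the CR singular
    points.  A second contraction finds the variety through a given point
    ([segre_inverse]).  Hence [s] is a function of the point, and (s, z_2, ...,
    z_n) are coordinates of [M] in which the Segre varieties are the slices of
    constant [s].  The map [Fp] goes from these coordinates to [M].

    It remains to show that these hypersurfaces are tangent to [T^c], that is,
    that [df/dxi] at a point of the Segre variety is proportional to [df/dxi] at
    ([p], conj z).  The [defect] of proportionality vanishes where the variety
    meets the line of base points.  Flatness says that the Levi form vanishes
    ([levi_real]), also off the real points by the identity theorem
    ([levi_complex]).  This makes the derivative of the defect along a variety
    a linear combination of defects with bounded coefficients.  Near the base point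
    the defect is therefore bounded by half of any bound for it, so it is zero
    ([gronwall_step], [defect_near0]).  The identity theorem carries this to a
    polydisc around the origin ([defect_zero], [segre_tangent]).

    Finally, let [A = df/dxi_1].  If [A] vanishes at a point of [M], then by the
    tangency of the varieties all [df/dxi_k] vanish there, and [T^c] has larger
    dimension than at nearby points; so [M] is CR exactly where [A <> 0]
    ([CR_A], [CR_part_A]).  At these points [T^c] is the tangent space of the
    slice ([plaque_tangent]).

    The theory of several complex variables needed here is developed from the
    notion [hol] of holomorphic function: a pointwise limit of polynomial
    expressions with bounded majorant norm on a polydisc.  For expressions, the
    Cauchy estimates are inequalities between majorant norms proved by induction
    ([dquot_norm], [quot0_norm]), and they pass to limits along ultrafilters. *)

(** * The modulus of complex numbers and componentwise limits *)

Section Modulus.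
Context {R : realType}.
Implicit Types x y : R[i].
Local Open Scope complex_scope.

(** The sum norm instead of the Euclidean one: it is submultiplicative and it
    splits into real and imaginary parts without square roots. *)
Definition cmod x : R := `|complex.Re x| + `|complex.Im x|.

Lemma cReD x y : complex.Re (x + y) = complex.Re x + complex.Re y.
Proof. by case: x y => [a b] [c d]. Qed.
Lemma cImD x y : complex.Im (x + y) = complex.Im x + complex.Im y.
Proof. by case: x y => [a b] [c d]. Qed.
Lemma cReN x : complex.Re (- x) = - complex.Re x.
Proof. by case: x. Qed.
Lemma cImN x : complex.Im (- x) = - complex.Im x.
Proof. by case: x. Qed.
Lemma cReM x y : complex.Re (x * y)
  = complex.Re x * complex.Re y - complex.Im x * complex.Im y.
Proof. by case: x y => [a b] [c d]. Qed.
Lemma cImM x y : complex.Im (x * y)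
  = complex.Re x * complex.Im y + complex.Im x * complex.Re y.
Proof. by case: x y => [a b] [c d]. Qed.

Definition cReImE := (cReD, cImD, cReN, cImN, cReM, cImM).

Lemma complex_ext x y :
  complex.Re x = complex.Re y -> complex.Im x = complex.Im y -> x = y.
Proof. by case: x y => [a b] [c d] /= -> ->. Qed.

Lemma cmod_ge0 x : 0 <= cmod x.
Proof. by rewrite addr_ge0. Qed.
Lemma cmod0 : cmod 0 = 0.
Proof. by rewrite /cmod /= normr0 addr0. Qed.
Lemma cmod_eq0 x : cmod x = 0 -> x = 0.
Proof.
move=> /eqP; rewrite paddr_eq0// !normr_eq0 => /andP[/eqP a /eqP b].
exact: complex_ext.
Qed.
Lemma cmodN x : cmod (- x) = cmod x.
Proof. by rewrite /cmod cReN cImN !normrN. Qed.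
Lemma cmodD x y : cmod (x + y) <= cmod x + cmod y.
Proof. by rewrite /cmod cReD cImD addrACA lerD// ler_normD. Qed.
Lemma cmodB x y : cmod (x - y) <= cmod x + cmod y.
Proof. by rewrite (le_trans (cmodD _ _))// cmodN. Qed.
Lemma cmodM x y : cmod (x * y) <= cmod x * cmod y.
Proof.
rewrite /cmod cReM cImM mulrDl !mulrDr.
rewrite (le_trans (lerD (ler_normB _ _) (ler_normD _ _)))// !normrM.
by rewrite le_eqVlt; apply/orP; left; apply/eqP; ring.
Qed.
Lemma cmod_conj x : cmod (conjc x) = cmod x.
Proof. by case: x => a b; rewrite /cmod /= normrN. Qed.
Lemma cmodR (a : R) : cmod a%:C = `|a|.
Proof. by rewrite /cmod /= normr0 addr0. Qed.
Lemma cmod1 : cmod 1 = 1.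
Proof. by rewrite cmodR normr1. Qed.
Lemma cmod_sum I (s : seq I) (P : pred I) (F : I -> R[i]) :
  cmod (\sum_(i <- s | P i) F i) <= \sum_(i <- s | P i) cmod (F i).
Proof.
elim/big_ind2: _ => [|a b c d ab cd|//]; first by rewrite cmod0.
by rewrite (le_trans (cmodD _ _))// lerD.
Qed.
Lemma cmod_distC x y : cmod (x - y) = cmod (y - x).
Proof. by rewrite -cmodN opprB. Qed.
Lemma cmodX x n : cmod (x ^+ n) <= cmod x ^+ n.
Proof.
elim: n => [|n IH]; first by rewrite !expr0 cmod1.
rewrite !exprS (le_trans (cmodM _ _))// ler_wpM2l//; exact: cmod_ge0.
Qed.
Lemma Re_le_cmod x : `|complex.Re x| <= cmod x.
Proof. by rewrite lerDl. Qed.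
Lemma Im_le_cmod x : `|complex.Im x| <= cmod x.
Proof. by rewrite lerDr. Qed.
Lemma cmod_eps0 x : (forall e : R, 0 < e -> cmod x <= e) -> x = 0.
Proof.
move=> h; apply: cmod_eq0; apply/eqP; rewrite eq_le cmod_ge0 andbT.
by apply/ler_addgt0Pr => e e0; rewrite add0r h.
Qed.
Lemma conjcK : involutive (@conjc R).
Proof. by case=> a b; rewrite /conjc opprK. Qed.
Lemma conjcD x y : conjc (x + y) = conjc x + conjc y.
Proof. by case: x y => [a b] [c d]; simpc; congr Complex; ring. Qed.
Lemma conjcM x y : conjc (x * y) = conjc x * conjc y.
Proof. by case: x y => [a b] [c d]; simpc; congr Complex; ring. Qed.
Lemma conjcN x : conjc (- x) = - conjc x.
Proof. by case: x. Qed.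

Lemma conjc0 : conjc 0 = 0 :> R[i].
Proof. by apply: complex_ext; rewrite /= ?oppr0. Qed.
Lemma conjc_sum (I : finType) (P : pred I) (f : I -> R[i]) :
  conjc (\sum_(k | P k) f k) = \sum_(k | P k) conjc (f k).
Proof. exact: (big_morph (@conjc R) conjcD conjc0). Qed.

Lemma le_frac (c e : R) : 0 <= c -> 0 <= e -> c * (e / (c + 1)) <= e.
Proof.
move=> c0 e0; rewrite mulrCA -[leRHS]mulr1 ler_wpM2l//.
by rewrite ler_pdivrMr ?mul1r ?lerDl ?ltr_pwDr.
Qed.

Lemma pow_small (q c e : R) : 0 <= q -> q < 1 -> 0 <= c -> 0 < e ->
  \forall k \near \oo, c * q ^+ k <= e.
Proof.
move=> q0 q1 c0 e0; have qn : `|q| < 1 by rewrite ger0_norm.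
have ec : 0 < e / (c + 1) by rewrite divr_gt0// ltr_pwDr.
have := cvg_expr qn; move/cvgrPdist_le => /(_ _ ec).
apply: filterS => k; rewrite sub0r normrN ger0_norm ?exprn_ge0// => h.
exact: le_trans (ler_wpM2l c0 h) (le_frac c0 (ltW e0)).
Qed.

Section Lim.
Context {T : Type} (F : set_system T) {FF : Filter F}.
Definition clim (f : T -> R[i]) (l : R[i]) : Prop :=
  ((fun t => complex.Re (f t)) @ F --> complex.Re l)
  /\ ((fun t => complex.Im (f t)) @ F --> complex.Im l).

Lemma clim_cst a : clim (fun=> a) a.
Proof. by split; apply: cvg_cst. Qed.
Lemma climD f g a b : clim f a -> clim g b -> clim (fun t => f t + g t) (a + b).
Proof.
by move=> [f1 f2] [g1 g2]; split; (under eq_fun do rewrite ?cReD ?cImD);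
  rewrite ?cReD ?cImD; apply: cvgD.
Qed.
Lemma climN f a : clim f a -> clim (fun t => - f t) (- a).
Proof.
by move=> [f1 f2]; split; (under eq_fun do rewrite ?cReN ?cImN);
  rewrite ?cReN ?cImN; apply: cvgN.
Qed.
Lemma climM f g a b : clim f a -> clim g b -> clim (fun t => f t * g t) (a * b).
Proof.
move=> [f1 f2] [g1 g2]; split; (under eq_fun do rewrite ?cReM ?cImM);
  rewrite ?cReM ?cImM.
- by apply: cvgB; apply: cvgM.
- by apply: cvgD; apply: cvgM.
Qed.
Lemma clim_sum I (s : seq I) (f : I -> T -> R[i]) a :
  (forall i, clim (f i) (a i)) ->
  clim (fun t => \sum_(i <- s) f i t) (\sum_(i <- s) a i).
Proof.
move=> h; elim: s => [|i s IH].
  by rewrite big_nil; under eq_fun do rewrite big_nil; apply: clim_cst.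
by rewrite big_cons; under eq_fun do rewrite big_cons; apply: climD.
Qed.

Lemma climP f a : clim f a <->
  forall e : R, 0 < e -> \forall t \near F, cmod (f t - a) <= e.
Proof.
split=> [[f1 f2] e e0|h].
- have e2 : 0 < e / 2 by rewrite divr_gt0.
  move/cvgr_dist_le : f1 => /(_ _ e2) f1.
  move/cvgr_dist_le : f2 => /(_ _ e2) f2.
  near=> t; rewrite /cmod !cReImE (splitr e) lerD//.
    by rewrite distrC; near: t; exact: f1.
  by rewrite distrC; near: t; exact: f2.
- split; apply/cvgrPdist_le => e e0; move: (h _ e0); apply: filterS => t.
    by move=> /(le_trans (Re_le_cmod _)); rewrite cReD cReN distrC.
  by move=> /(le_trans (Im_le_cmod _)); rewrite cImD cImN distrC.
Unshelve. all: by end_near. Qed.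

End Lim.

Lemma clim_unique T (F : set_system T) {FF : ProperFilter F} (f : T -> R[i]) a b :
  clim F f a -> clim F f b -> a = b.
Proof.
move=> [a1 a2] [b1 b2]; apply: complex_ext.
  exact: norm_cvg_unique a1 b1.
exact: norm_cvg_unique a2 b2.
Qed.

Lemma clim_le T (F : set_system T) {FF : ProperFilter F} (f : T -> R[i]) a K :
  clim F f a -> (\forall t \near F, cmod (f t) <= K) -> cmod a <= K.
Proof.
move=> /climP fa fK; apply/ler_addgt0Pr => e e0.
have [t [h1 h2]] : exists t, cmod (f t) <= K /\ cmod (f t - a) <= e.
  by apply/(@filter_ex _ F); near=> t; split; near: t; [exact: fK|exact: fa].
have -> : a = f t - (f t - a) by ring.
by rewrite (le_trans (cmodB _ _))// lerD.
Unshelve. all: by end_near. Qed.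

Lemma ultra_fmap T U (F : set_system T) {FF : UltraFilter F} (g : T -> U) :
  UltraFilter (g @ F).
Proof.
split; first exact: fmap_proper_filter.
move=> G PG FG; rewrite eqEsubset; split=> // A GA.
have [//|nA] := in_ultra_setVsetC (g @^-1` A) FF.
have /(filterI GA) : G (~` A) by exact: FG.
by rewrite setICr => /filter_ex[].
Qed.

(** Compactness of an interval. Limits along an ultrafilter replace the
    extraction of convergent subsequences, and they exist for all parameters at
    once. *)
Lemma ultra_lim T (F : set_system T) {FF : UltraFilter F} (f : T -> R[i]) K :
  (\forall t \near F, cmod (f t) <= K) -> exists a, clim F f a.
Proof.
move=> fK.
have aux (g : T -> R) : (\forall t \near F, `|g t| <= K) ->
    exists a : R, g @ F --> a.
  move=> gK; have := @segment_compact R (- K) K; rewrite compact_ultra.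
  have gA : (g @ F) `[- K, K]%classic.
    by apply: filterS gK => t h; rewrite /= in_itv/= -ler_norml.
  by move=> /(_ (g @ F) (ultra_fmap g) gA)[a [_ ga]]; exists a.
have [|a ha] := aux (fun t => complex.Re (f t)).
  by apply: filterS fK => t /(le_trans (Re_le_cmod _)).
have [|b hb] := aux (fun t => complex.Im (f t)).
  by apply: filterS fK => t /(le_trans (Im_le_cmod _)).
by exists (Complex a b); split.
Unshelve. all: by end_near. Qed.

End Modulus.

(** * Holomorphic functions on polydiscs as limits of polynomial expressions *)

Section PolynomialExpressions.
Context {R : realType}.
Local Notation C := R[i].

Inductive pexp (V : Type) : Type :=
  | Cst of R[i] | Var of V | Add of pexp V & pexp V | Mul of pexp V & pexp V.
Arguments Cst {V}.

Fixpoint peval V (x : V -> C) (p : pexp V) : C :=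
  match p with
  | Cst a => a
  | Var v => x v
  | Add p q => peval x p + peval x q
  | Mul p q => peval x p * peval x q
  end.

(** A majorant of the modulus on the polydisc of radius [r]. It is computed from
    the expression, not from the function that it defines, so it is exactly
    additive and multiplicative. *)
Fixpoint pnorm V (r : V -> R) (p : pexp V) : R :=
  match p with
  | Cst a => cmod a
  | Var v => r v
  | Add p q => pnorm r p + pnorm r q
  | Mul p q => pnorm r p * pnorm r q
  end.

Fixpoint psubst V W (s : V -> pexp W) (p : pexp V) : pexp W :=
  match p with
  | Cst a => Cst a
  | Var v => s v
  | Add p q => Add (psubst s p) (psubst s q)
  | Mul p q => Mul (psubst s p) (psubst s q)
  end.

Definition polydisc V (r : V -> R) (x : V -> C) := forall v, cmod (x v) <= r v.

Section OneRadius.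
Variables (V : Type) (r : V -> R).
Hypothesis r0 : forall v, 0 <= r v.

Lemma pnorm_ge0 p : 0 <= pnorm r p.
Proof.
elim: p => [a|v|p hp q hq|p hp q hq] //=; first exact: cmod_ge0.
- exact: addr_ge0.
- exact: mulr_ge0.
Qed.

Lemma pnorm_mono (r' : V -> R) p : (forall v, r v <= r' v) ->
  pnorm r p <= pnorm r' p.
Proof.
move=> rr'; elim: p => [a|v|p hp q hq|p hp q hq] //=; first exact: lerD.
by apply: ler_pM => //; exact: pnorm_ge0.
Qed.

Lemma peval_le x p : polydisc r x -> cmod (peval x p) <= pnorm r p.
Proof.
move=> hx; elim: p => [a|v|p hp q hq|p hp q hq] //=.
  by rewrite (le_trans (cmodD _ _))// lerD.
by rewrite (le_trans (cmodM _ _))// ler_pM// cmod_ge0.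
Qed.

End OneRadius.

Lemma peval_subst V W (s : V -> pexp W) y p :
  peval y (psubst s p) = peval (fun v => peval y (s v)) p.
Proof. by elim: p => [a|v|p hp q hq|p hp q hq] //=; rewrite hp hq. Qed.

Lemma pnorm_subst V W (s : V -> pexp W) r p :
  pnorm r (psubst s p) = pnorm (fun v => pnorm r (s v)) p.
Proof. by elim: p => [a|v|p hp q hq|p hp q hq] //=; rewrite hp hq. Qed.

Lemma peval_clim T (F : set_system T) {FF : Filter F} V (x : T -> V -> C) y p :
  (forall v, clim F (fun t => x t v) (y v)) ->
  clim F (fun t => peval (x t) p) (peval y p).
Proof.
move=> h; elim: p => [a|v|p hp q hq|p hp q hq] //=; first exact: clim_cst.
- exact: climD.
- exact: climM.
Qed.

(** Holomorphic functions on the polydisc of radius [r], bounded by [K]: the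
    closure, for pointwise convergence, of the expressions of majorant norm at
    most [K]. Basic neighbourhoods in that topology constrain finitely many
    points. *)
Definition hol V (r : V -> R) (K : R) (f : (V -> C) -> C) : Prop :=
  (forall v, 0 <= r v) /\
  forall (s : seq (V -> C)) (e : R), 0 < e ->
    (forall x, List.In x s -> polydisc r x) ->
    exists2 p, pnorm r p <= K &
      forall x, List.In x s -> cmod (peval x p - f x) <= e.

Lemma near_list T (F : set_system T) {FF : Filter F} U (s : seq U)
    (P : U -> T -> Prop) :
  (forall x, List.In x s -> \forall t \near F, P x t) ->
  \forall t \near F, forall x, List.In x s -> P x t.
Proof.
elim: s => [|x s IH] h; first by apply: nearW => t x [].
have h1 : \forall t \near F, P x t by apply: h; left.
have {}IH := IH (fun y ys => h y (or_intror ys)).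
near=> t => y [<-|ys]; first by near: t.
by move: y ys; near: t.
Unshelve. all: by end_near. Qed.

Section HolBasics.
Variables (V : Type) (r : V -> R).
Hypothesis r0 : forall v, 0 <= r v.

Lemma hol_cst a : hol r (cmod a) (fun=> a).
Proof. by split=> // s e e0 _; exists (Cst a) => //= x _; rewrite subrr cmod0 ltW. Qed.

Lemma hol_var v : hol r (r v) (fun x => x v).
Proof. by split=> // s e e0 _; exists (Var v) => //= x _; rewrite subrr cmod0 ltW. Qed.

Lemma hol_pexp p : hol r (pnorm r p) (fun x => peval x p).
Proof. by split=> // s e e0 _; exists p => //= x _; rewrite subrr cmod0 ltW. Qed.
End HolBasics.

Section HolOps.
Variables (V : Type).
Implicit Types (r : V -> R) (f g : (V -> C) -> C).

Lemma hol_r0 r K f : hol r K f -> forall v, 0 <= r v.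
Proof. by case. Qed.

Lemma hol_K0 r K f : hol r K f -> 0 <= K.
Proof.
move=> [r0 /(_ [::] 1 ltr01)[//|p pK _]]; exact: le_trans (pnorm_ge0 r0 p) pK.
Qed.

Lemma hol_ext r K f g : (forall x, polydisc r x -> f x = g x) ->
  hol r K f -> hol r K g.
Proof.
move=> fg [r0 hf]; split=> // s e e0 sr; have [p pK ps] := hf s e e0 sr.
by exists p => // x xs; rewrite -fg; [exact: ps|exact: sr].
Qed.

Lemma hol_le r r' K K' f : (forall v, 0 <= r' v) -> (forall v, r' v <= r v) ->
  K <= K' -> hol r K f -> hol r' K' f.
Proof.
move=> r'0 r'r KK' [r0 hf]; split=> // s e e0 sr.
have [|p pK ps] := hf s e e0.
  by move=> x xs v; exact: le_trans (sr x xs v) (r'r v).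
by exists p => //; apply: le_trans KK'; apply: le_trans pK; exact: pnorm_mono.
Qed.

Lemma hol_leK r K K' f : K <= K' -> hol r K f -> hol r K' f.
Proof. by move=> KK' hf; have r0 := hol_r0 hf; exact: hol_le hf. Qed.

Lemma hol_bound r K f x : hol r K f -> polydisc r x -> cmod (f x) <= K.
Proof.
move=> [r0 hf] hx; apply/ler_addgt0Pr => e e0.
have [|p pK /(_ x (or_introl erefl)) ps] := hf [:: x] e e0.
  by move=> y [<-|[]].
have -> : f x = peval x p - (peval x p - f x) by ring.
rewrite (le_trans (cmodB _ _))// lerD//.
exact: le_trans (peval_le p hx) pK.
Qed.

Lemma hol_lim T (F : set_system T) {FF : ProperFilter F} r K
    (f : T -> (V -> C) -> C) g :
  (forall v, 0 <= r v) ->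
  (\forall t \near F, hol r K (f t)) ->
  (forall x, polydisc r x -> clim F (fun t => f t x) (g x)) -> hol r K g.
Proof.
move=> r0 hf fg; split=> // s e e0 sr.
have e2 : 0 < e / 2 by rewrite divr_gt0.
have ns : \forall t \near F, forall x, List.In x s -> cmod (f t x - g x) <= e / 2.
  apply: near_list => x xs.
  by have /climP/(_ _ e2) := fg x (sr x xs).
have [t [[_ ht] hts]] : exists t, hol r K (f t) /\
    forall x, List.In x s -> cmod (f t x - g x) <= e / 2.
  by apply/(@filter_ex _ F); near=> t; split; near: t.
have [p pK ps] := ht s _ e2 sr.
exists p => // x xs.
have -> : peval x p - g x = (peval x p - f t x) + (f t x - g x) by ring.
by rewrite (splitr e) (le_trans (cmodD _ _))// lerD//; [exact: ps|exact: hts].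
Unshelve. all: by end_near. Qed.

(** The same closure, described by one ultrafilter of expressions that converges
    to [f] at all points: a construction on expressions with controlled
    majorants then has a limit, which is a construction on [f]. *)
Lemma hol_ultra r K f : hol r K f ->
  exists F : set_system (pexp V), [/\ UltraFilter F,
     \forall p \near F, pnorm r p <= K
   & forall x, polydisc r x -> clim F (peval x) (f x)].
Proof.
move=> [r0 hf].
pose D := [set se : seq (V -> C) * R | 0 < se.2 /\
  forall x, List.In x se.1 -> polydisc r x].
pose B (se : seq (V -> C) * R) := [set p : pexp V | pnorm r p <= K /\
  forall x, List.In x se.1 -> cmod (peval x p - f x) <= se.2].
have PB : ProperFilter (filter_from D B).
  apply: filter_from_proper.
    apply: filter_from_filter; first by exists ([::], 1); split.
    move=> [s d] [s' d'] [/= d0 hs] [/= d'0 hs'].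
    exists (s ++ s', Num.min d d').
      split=> /=; first by rewrite lt_min d0.
      by move=> x xs; case: (List.in_app_or _ _ _ xs) => [/hs|/hs'].
    move=> p [pK ps]; split; split=> //= x xs.
      have /= /le_trans := ps x (List.in_or_app _ _ _ (or_introl xs)); apply.
      by rewrite ge_min lexx.
    have /= /le_trans := ps x (List.in_or_app _ _ _ (or_intror xs)); apply.
    by rewrite ge_min lexx orbT.
  move=> [s e] [/= e0 sr]; have [p pK ps] := hf s e e0 sr.
  by exists p.
have [F [UF BF]] := ultraFilterLemma PB.
exists F; split=> //.
  by apply: BF; exists ([::], 1) => [|p []]; first by split.
move=> x hx; apply/climP => e e0; apply: BF; exists ([:: x], e).
  by split=> //= y [<-|[]].
by move=> p [_ /(_ x (or_introl erefl))].
Qed.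

Lemma holD r K K' f g : hol r K f -> hol r K' g ->
  hol r (K + K') (fun x => f x + g x).
Proof.
move=> [r0 hf] [_ hg]; split=> // s e e0 sr.
have e2 : 0 < e / 2 by rewrite divr_gt0.
have [p pK ps] := hf s _ e2 sr; have [q qK qs] := hg s _ e2 sr.
exists (Add p q); first exact: lerD.
move=> x xs /=.
have -> : peval x p + peval x q - (f x + g x)
  = (peval x p - f x) + (peval x q - g x) by ring.
by rewrite (splitr e) (le_trans (cmodD _ _))// lerD//; [exact: ps|exact: qs].
Qed.

End HolOps.

(** Substitute approximations of the [g v] into an approximation [p] of [f]. The
    majorant of the result is that of [p] for the radii [rV], and its values
    converge because evaluation of the fixed [p] is continuous. *)
Lemma hol_comp V W (rV : V -> R) (rW : W -> R) K (f : (V -> C) -> C)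
    (g : V -> (W -> C) -> C) : (forall w, 0 <= rW w) ->
  hol rV K f -> (forall v, hol rW (rV v) (g v)) ->
  hol rW K (fun y => f (fun v => g v y)).
Proof.
move=> rW0 [rV0 hf] hg; split=> // s e e0 sr.
have e2 : 0 < e / 2 by rewrite divr_gt0.
pose s' := List.map (fun y v => g v y) s.
have [|p pK ps] := hf s' _ e2.
  move=> x /List.in_map_iff[y [<- ys]] v.
  by apply: hol_bound (hg v) _; exact: sr.
have /choice[q hq] : forall n : nat, exists q : V -> pexp W,
   forall v, pnorm rW (q v) <= rV v /\
     forall y, List.In y s -> cmod (peval y (q v) - g v y) <= n.+1%:R^-1.
  move=> n; suff /choice[q hq] : forall v, exists qv : pexp W,
      pnorm rW qv <= rV v /\
      forall y, List.In y s -> cmod (peval y qv - g v y) <= n.+1%:R^-1.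
    by exists q.
  move=> v; have [_ /(_ s n.+1%:R^-1)[//|//|qv h1 h2]] := hg v.
  by exists qv.
have lim y : List.In y s -> clim \oo
    (fun n => peval (fun v => peval y (q n v)) p) (peval (fun v => g v y) p).
  move=> ys; apply: peval_clim => v; apply/climP => d d0.
  have := @cvg_harmonic R; move/cvgrPdist_le => /(_ _ d0).
  apply: filterS => n; rewrite sub0r normrN ger0_norm ?invr_ge0// => /= nd.
  by have [_ /(_ y ys)] := hq n v; move/le_trans; apply.
have : \forall n \near \oo, forall y, List.In y s ->
   cmod (peval (fun v => peval y (q n v)) p - peval (fun v => g v y) p) <= e / 2.
  by apply: near_list => y /lim/climP; apply.
move=> /filter_ex[n hn]; exists (psubst (q n) p).
  rewrite pnorm_subst; apply: le_trans pK; apply: pnorm_mono.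
    by move=> v; exact: pnorm_ge0.
  by move=> v; have [] := hq n v.
move=> y ys; rewrite peval_subst.
have -> : peval (fun v => peval y (q n v)) p - f (fun v => g v y) =
  (peval (fun v => peval y (q n v)) p - peval (fun v => g v y) p)
  + (peval (fun v => g v y) p - f (fun v => g v y)) by ring.
rewrite (splitr e) (le_trans (cmodD _ _))// lerD//; first exact: hn.
by apply: ps; exact: List.in_map.
Qed.

Lemma holM V (r : V -> R) K K' f g : hol r K f -> hol r K' g ->
  hol r (K * K') (fun x => f x * g x).
Proof.
move=> hf hg; pose rb b : R := if b then K else K'.
have rb0 b : 0 <= rb b by case: b; [exact: hol_K0 hf|exact: hol_K0 hg].
apply: (@hol_comp bool V rb r _ (fun x => x true * x false)
   (fun b => if b then f else g)).
- exact: hol_r0 hf.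
- exact: (@hol_pexp bool rb rb0 (Mul (Var true) (Var false))).
- by case.
Qed.

Lemma holN V (r : V -> R) K f : hol r K f -> hol r K (fun x => - f x).
Proof.
move=> hf; rewrite -[K]mul1r -(@cmod1 R) -cmodN.
apply: hol_ext (holM (hol_cst (hol_r0 hf) (-1)) hf) => x _.
by rewrite mulN1r.
Qed.

Lemma holB V (r : V -> R) K K' f g : hol r K f -> hol r K' g ->
  hol r (K + K') (fun x => f x - g x).
Proof. by move=> hf hg; apply: holD hf (holN hg). Qed.

Lemma holZ V (r : V -> R) K f a : hol r K f ->
  hol r (cmod a * K) (fun x => a * f x).
Proof. by move=> hf; exact: holM (hol_cst (hol_r0 hf) a) hf. Qed.

Lemma hol_sum V (r : V -> R) I (s : seq I) (P : pred I) (K : I -> R)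
    (f : I -> (V -> C) -> C) : (forall v, 0 <= r v) ->
  (forall i, hol r (K i) (f i)) ->
  hol r (\sum_(i <- s | P i) K i) (fun x => \sum_(i <- s | P i) f i x).
Proof.
move=> r0 hf; elim: s => [|i s IH].
  rewrite big_nil -(@cmod0 R); apply: hol_ext (hol_cst r0 0) => x _.
  by rewrite big_nil.
rewrite big_cons; case: ifPn => Pi; last first.
  by apply: hol_ext IH => x _; rewrite big_cons (negbTE Pi).
by apply: hol_ext (holD (hf i) IH) => x _; rewrite big_cons Pi.
Qed.

(** Conjugate the constants of the approximating expressions. *)
Lemma hol_conj V (r : V -> R) K f : hol r K f ->
  hol r K (fun x => conjc (f (fun v => conjc (x v)))).
Proof.
move=> [r0 hf]; split=> // s e e0 sr.
have [|p pK ps] := hf (List.map (fun x v => conjc (x v)) s) e e0.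
  by move=> x /List.in_map_iff[y [<- ys]] v; rewrite cmod_conj; exact: sr.
pose cj := fix cj (p : pexp V) := match p with
  | Cst a => Cst (conjc a) | Var v => Var v
  | Add p q => Add (cj p) (cj q) | Mul p q => Mul (cj p) (cj q) end.
have cjE x q : peval x (cj q) = conjc (peval (fun v => conjc (x v)) q).
  elim: q => [a|v|q1 h1 q2 h2|q1 h1 q2 h2] //=; first by rewrite conjcK.
    by rewrite h1 h2 conjcD.
  by rewrite h1 h2 conjcM.
have cjN q : pnorm r (cj q) = pnorm r q.
  by elim: q => [a|v|q1 h1 q2 h2|q1 h1 q2 h2] /=; rewrite ?cmod_conj ?h1 ?h2.
exists (cj p); first by rewrite cjN.
move=> x xs; rewrite cjE -conjcN -conjcD cmod_conj; apply: ps.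
exact: (List.in_map (fun (x : V -> C) v => conjc (x v))).
Qed.

End PolynomialExpressions.

Arguments Cst {R V}.
Arguments pexp R V : clear implicits.

(** * Difference quotients, Lipschitz bounds and gradients *)

Section Hadamard.
Context {R : realType}.
Local Notation C := R[i].

Definition pairpt V W T (x : V -> T) (y : W -> T) (s : V + W) : T :=
  match s with inl v => x v | inr w => y w end.

(** A divided difference in the variable [i]: the terms of Leibniz' rule, taken
    at [x'] before and at [x] after the factor that varies. The points [x] and
    [x'] are the two copies of the variables. *)
Fixpoint dquot (V : eqType) (i : V) (p : pexp R V) : pexp R (V + V) :=
  match p with
  | Cst a => Cst 0
  | Var v => Cst (v == i)%:R
  | Add p q => Add (dquot i p) (dquot i q)
  | Mul p q => Add (Mul (dquot i p) (psubst (fun v => Var (inl v)) q))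
                   (Mul (psubst (fun v => Var (inr v)) p) (dquot i q))
  end.

Lemma dquotE (V : finType) (x x' : V -> C) (p : pexp R V) :
  peval x p - peval x' p
  = \sum_i (x i - x' i) * peval (pairpt x x') (dquot i p).
Proof.
elim: p => [a|v|p hp q hq|p hp q hq] /=.
- by rewrite subrr big1// => i _; rewrite mulr0.
- rewrite (bigD1 v)//= eqxx mulr1 big1 ?addr0// => i /negbTE iv.
  by rewrite eq_sym iv mulr0.
- rewrite opprD addrACA hp hq -big_split; apply: eq_bigr => i _.
  by rewrite mulrDr.
- rewrite [LHS](_ : _ = (peval x p - peval x' p) * peval x q
    + peval x' p * (peval x q - peval x' q)); last by ring.
  rewrite hp hq big_distrl big_distrr -big_split; apply: eq_bigr => i _ /=.
  by rewrite !peval_subst /=; ring.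
Qed.

(** The Cauchy estimate for a difference quotient, in the form that the
    induction over products preserves. *)
Lemma dquot_norm (V : eqType) (i : V) (r : V -> R) (h : R) p :
  0 <= h -> (forall v, 0 <= r v) ->
  h * pnorm (pairpt r r) (dquot i p) + pnorm r p <= pnorm (fun v => r v + h) p.
Proof.
move=> h0 r0.
have rr0 v : 0 <= pairpt r r v by case: v.
have rh0 v : 0 <= r v + h by rewrite addr_ge0.
elim: p => [a|v|p hp q hq|p hp q hq] /=.
- by rewrite cmod0 mulr0 add0r.
- rewrite addrC lerD2l; case: eqP => _; first by rewrite cmod1 mulr1.
  by rewrite cmod0 mulr0.
- by rewrite mulrDr addrACA lerD.
- rewrite !pnorm_subst /=.
  set a := pnorm _ (dquot i p) in hp *; set b := pnorm _ (dquot i q) in hq *.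
  have P0 : 0 <= pnorm r p by exact: pnorm_ge0.
  have Q0 : 0 <= pnorm r q by exact: pnorm_ge0.
  have a0 : 0 <= a by exact: pnorm_ge0.
  have b0 : 0 <= b by exact: pnorm_ge0.
  have eta (t : pexp R V) : pnorm (fun v => r v) t = pnorm r t by [].
  have ha0 := addr_ge0 (mulr_ge0 h0 a0) P0.
  have hb0 := addr_ge0 (mulr_ge0 h0 b0) Q0.
  have := ler_pM ha0 hb0 hp hq; apply: le_trans.
  rewrite !eta.
  have : 0 <= h * a * (h * b) by rewrite !mulr_ge0.
  lra.
Qed.

(** The divided differences of the approximating expressions have bounded
    majorants on a smaller polydisc, so they converge along the ultrafilter. *)
Lemma hadamard (V : finType) (r : V -> R) (h : R) K f : 0 < h ->
  (forall v, 0 <= r v) -> hol (fun v => r v + h) K f ->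
  exists Q : V -> (V + V -> C) -> C,
    (forall i, hol (pairpt r r) (K / h) (Q i)) /\
    forall x x', polydisc r x -> polydisc r x' ->
      f x - f x' = \sum_i (x i - x' i) * Q i (pairpt x x').
Proof.
move=> h0 r0 hf; have [F [UF FK Ff]] := hol_ultra hf.
have rr0 v : 0 <= pairpt r r v by case: v.
have FQ i : \forall p \near F, pnorm (pairpt r r) (dquot i p) <= K / h.
  apply: filterS FK => p pK; rewrite ler_pdivlMr// mulrC.
  apply: le_trans pK; apply: le_trans (dquot_norm i p (ltW h0) r0).
  by rewrite lerDl; exact: pnorm_ge0.
have /choice[Q hQ] : forall iz : V * (V + V -> C), exists l,
    polydisc (pairpt r r) iz.2 -> clim F (fun p => peval iz.2 (dquot iz.1 p)) l.
  move=> [i z] /=; have [hz|nz] := pselect (polydisc (pairpt r r) z); last first.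
    by exists 0 => /nz.
  have [|l hl] := @ultra_lim _ _ F UF (fun p => peval z (dquot i p)) (K / h).
    by apply: filterS (FQ i) => p; apply: le_trans; exact: peval_le.
  by exists l.
exists (fun i z => Q (i, z)); split.
  move=> i; apply: (@hol_lim _ _ _ F _ _ _ (fun p z => peval z (dquot i p))) => //.
    by apply: filterS (FQ i) => p pK; exact: hol_leK pK (hol_pexp rr0 _).
  by move=> x hx; exact: (hQ (i, x)).
move=> x x' hx hx'.
have sub y : polydisc r y -> polydisc (fun v => r v + h) y.
  by move=> hy v; rewrite (le_trans (hy v))// lerDl ltW.
apply: (@clim_unique _ _ F _ (fun p => peval x p - peval x' p)).
  by apply: climD; [|apply: climN]; apply: Ff; exact: sub.
under [in X in clim _ X _]eq_fun do rewrite dquotE.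
apply: clim_sum => i; apply: climM; first exact: clim_cst.
by apply: (hQ (i, pairpt x x')); case.
Qed.

Lemma hol_lip (V : finType) (r : V -> R) (h : R) K f x x' : 0 < h ->
  (forall v, 0 <= r v) -> hol (fun v => r v + h) K f ->
  polydisc r x -> polydisc r x' ->
  cmod (f x - f x') <= K / h * \sum_v cmod (x v - x' v).
Proof.
move=> h0 r0 /(hadamard h0 r0)[Q [hQ fQ]] hx hx'.
rewrite fQ// (le_trans (cmod_sum _ _ _))// mulr_sumr ler_sum// => i _.
rewrite (le_trans (cmodM _ _))// mulrC ler_wpM2r//; first exact: cmod_ge0.
by apply: hol_bound (hQ i) _; case.
Qed.

Lemma near_polydisc T (F : set_system T) {FF : Filter F} (V : finType)
    (r : V -> R) (h : R) (g : T -> V -> C) a : 0 < h ->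
  (forall v, clim F (fun t => g t v) (a v)) -> polydisc r a ->
  \forall t \near F, polydisc (fun v => r v + h) (g t).
Proof.
move=> h0 ga ha; apply: filter_forall => v.
have /climP/(_ _ h0) := ga v; apply: filterS => t gt.
have -> : g t v = a v + (g t v - a v) by ring.
by rewrite (le_trans (cmodD _ _))// lerD.
Qed.

Lemma hol_clim T (F : set_system T) {FF : Filter F} (V : finType)
    (r : V -> R) (h : R) K f (g : T -> V -> C) a : 0 < h ->
  (forall v, 0 <= r v) -> hol (fun v => r v + h) K f ->
  (forall v, clim F (fun t => g t v) (a v)) -> polydisc r a ->
  clim F (fun t => f (g t)) (f a).
Proof.
move=> h0 r0 hf ga ha.
have h2 : 0 < h / 2 by rewrite divr_gt0.
have r20 v : 0 <= r v + h / 2 by rewrite addr_ge0// ltW.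
have hf' : hol (fun v => r v + h / 2 + h / 2) K f.
  by apply: hol_le hf => // v; rewrite ?addr_ge0 ?(ltW h2)// -addrA -splitr.
have L0 : 0 <= K / (h / 2) by rewrite divr_ge0// ?(hol_K0 hf)// ltW.
apply/climP => e e0.
pose e' := e / (K / (h / 2) + 1) / #|V|.+1%:R.
have e'0 : 0 < e' by rewrite !divr_gt0// ltr_pwDr.
have nv : \forall t \near F, forall v, cmod (g t v - a v) <= e'.
  by apply: filter_forall => v; have /climP/(_ _ e'0) := ga v.
have np := near_polydisc h2 ga ha.
near=> t.
have gt : polydisc (fun v => r v + h / 2) (g t) by near: t; exact: np.
have at' : polydisc (fun v => r v + h / 2) a.
  by move=> v; rewrite (le_trans (ha v))// lerDl ltW.
apply: le_trans (hol_lip h2 r20 hf' gt at') _.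
apply: (@le_trans _ _ (K / (h / 2) * \sum_(v : V) e')).
  have nvt : forall v, cmod (g t v - a v) <= e' by near: t; exact: nv.
  by rewrite ler_wpM2l// ler_sum.
rewrite sumr_const -[e' *+ _]mulr_natr /e' [_ * #|V|%:R]mulrAC.
apply: (@le_trans _ _ (K / (h / 2) * (e / (K / (h / 2) + 1)))).
  rewrite ler_wpM2l// -[leRHS]mulr1 -mulrA ler_wpM2l//.
    by rewrite divr_ge0 ?(ltW e0)// addr_ge0.
  by rewrite ler_pdivrMr// mul1r ler_nat.
exact: le_frac L0 (ltW e0).
Unshelve. all: by end_near. Qed.

(** Caratheodory's form of the derivative of a curve: the chain rule needs no
    division. *)
Definition cder (g : R -> C) (t0 : R) (d : C) : Prop :=
  exists2 q : R -> C, clim (nbhs t0) q d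
    & \forall t \near t0, g t - g t0 = (real_complex R (t - t0)) * q t.

Lemma cder_cst a t0 : cder (fun=> a) t0 0.
Proof.
exists (fun=> 0); first exact: clim_cst.
by near=> t; rewrite subrr mulr0.
Unshelve. all: by end_near. Qed.

Lemma cder_id t0 : cder (fun t => real_complex R t) t0 1.
Proof.
exists (fun=> 1); first exact: clim_cst.
by near=> t; rewrite mulr1 -rmorphB.
Unshelve. all: by end_near. Qed.

Lemma cderD f g t0 a b : cder f t0 a -> cder g t0 b ->
  cder (fun t => f t + g t) t0 (a + b).
Proof.
move=> [p pa hp] [q qb hq]; exists (fun t => p t + q t); first exact: climD.
near=> t; rewrite mulrDr opprD addrACA; congr (_ + _).
  by near: t; exact: hp.
by near: t; exact: hq.
Unshelve. all: by end_near. Qed.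

Lemma cderN f t0 a : cder f t0 a -> cder (fun t => - f t) t0 (- a).
Proof.
move=> [p pa hp]; exists (fun t => - p t); first exact: climN.
by apply: filterS hp => t; rewrite mulrN -opprD => <-.
Qed.

Lemma cder_clim f t0 a : cder f t0 a -> clim (nbhs t0) f (f t0).
Proof.
move=> [p pa hp].
have idc : clim (nbhs t0) (fun t => real_complex R (t - t0)) 0.
  split => /=; last exact: cvg_cst.
  by rewrite -(subrr t0); apply: cvgB; [exact: cvg_id|exact: cvg_cst].
have h : clim (nbhs t0) (fun t => f t0 + real_complex R (t - t0) * p t) (f t0).
  rewrite -[X in clim _ _ X]addr0 -(mul0r a).
  by apply: climD; [exact: clim_cst|exact: climM].
apply/climP => e e0.
move/climP : h => /(_ e e0); apply: filterS2 hp => t; rewrite addrAC subrr add0r.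
by move=> ->.
Qed.

Lemma cderM f g t0 a b : cder f t0 a -> cder g t0 b ->
  cder (fun t => f t * g t) t0 (a * g t0 + f t0 * b).
Proof.
move=> df dg; have cg := cder_clim dg; move: df dg => [p pa hp] [q qb hq].
exists (fun t => p t * g t + f t0 * q t).
  by apply: climD; apply: climM => //; exact: clim_cst.
near=> t.
have e1 : f t - f t0 = real_complex R (t - t0) * p t by near: t; exact: hp.
have e2 : g t - g t0 = real_complex R (t - t0) * q t by near: t; exact: hq.
rewrite [LHS](_ : _ = (f t - f t0) * g t + f t0 * (g t - g t0)); last by ring.
by rewrite e1 e2; ring.
Unshelve. all: by end_near. Qed.

Lemma cderZ k g t0 b : cder g t0 b -> cder (fun t => k * g t) t0 (k * b).
Proof. by move=> /(cderM (cder_cst k t0)); rewrite mul0r add0r. Qed.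

Lemma cder_ext f g t0 a : (\forall t \near t0, f t = g t) ->
  cder f t0 a -> cder g t0 a.
Proof.
move=> fg [p pa hp]; exists p => //.
have fg0 := nbhs_singleton fg.
by near=> t; rewrite -fg0 -(near fg t)//; near: t; exact: hp.
Unshelve. all: by end_near. Qed.

Lemma cder_unique f t0 a b : cder f t0 a -> cder f t0 b -> a = b.
Proof.
move=> [p pa hp] [q qb hq].
have : clim (t0^') p a.
  by move: pa => [h1 h2]; split; apply: cvg_within_filter.
have : clim (t0^') q b.
  by move: qb => [h1 h2]; split; apply: cvg_within_filter.
move=> {}qb {}pa; apply: (@clim_unique _ _ t0^' _ p) => //.
move/climP: qb => qb; apply/climP => e e0; have := qb e e0.
have hp' := @nbhs_dnbhs R t0 _ hp; have hq' := @nbhs_dnbhs R t0 _ hq.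
have ne := @nbhs_dnbhs_neq R t0.
move=> qe; near=> t; suff -> : p t = q t by near: t; exact: qe.
have tt0 : real_complex R (t - t0) != 0.
  rewrite eq_complex /= eqxx andbT subr_eq0.
  by near: t; exact: ne.
apply: (mulfI tt0).
have <- : f t - f t0 = real_complex R (t - t0) * p t by near: t; exact: hp'.
by near: t; exact: hq'.
Unshelve. all: by end_near. Qed.

Lemma cder_eq f g t0 a : (forall t, f t = g t) -> cder f t0 a -> cder g t0 a.
Proof. by move=> /funext ->. Qed.

Lemma rc_lin_cder (a b : C) t0 : cder (fun t => a + real_complex R t * b) t0 b.
Proof.
have h : cder (fun t => a + b * real_complex R t) t0 b.
  by have := cderD (cder_cst a t0) (cderZ b (cder_id t0)); rewrite add0r mulr1.
by apply: cder_eq h => t; rewrite mulrC.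
Qed.

(** The chain rule along real curves, which is all that is used of a gradient.
    *)
Definition isgrad (V : finType) (r : V -> R) (f : (V -> C) -> C)
    (D : V -> (V -> C) -> C) :=
  forall (g : V -> R -> C) t0 d, (forall v, cder (g v) t0 (d v)) ->
    polydisc r (fun v => g v t0) ->
    cder (fun t => f (fun v => g v t)) t0
      (\sum_v d v * D v (fun v => g v t0)).

(** The Hadamard quotients on the diagonal. The radius shrinks in three steps:
    one for the quotients, one for their continuity, and one for the curve to
    stay inside. *)
Lemma hol_grad (V : finType) (r : V -> R) (h : R) K f : 0 < h ->
  (forall v, 0 <= r v) -> hol (fun v => r v + h) K f ->
  exists2 D : V -> (V -> C) -> C, (forall v, hol r (K / (h / 3)) (D v))
    & isgrad r f D.
Proof.
move=> h0 r0 hf.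
have h3 : 0 < h / 3 by rewrite divr_gt0.
pose r1 v := r v + h / 3 ; pose r2 v := r1 v + h / 3.
have r10 v : 0 <= r1 v by rewrite addr_ge0// ltW.
have r20 v : 0 <= r2 v by rewrite addr_ge0// ltW.
have hf' : hol (fun v => r2 v + h / 3) K f.
  apply: hol_le hf => // v; first by rewrite addr_ge0// ltW.
  by rewrite /r2 /r1; lra.
have [Q [hQ fQ]] := hadamard h3 r20 hf'.
have rr1 v : r v <= r1 v by rewrite lerDl ltW.
have r12 v : r1 v <= r2 v by rewrite lerDl ltW.
exists (fun v x => Q v (pairpt x x)).
  move=> v; apply: (@hol_comp _ _ _ (pairpt r2 r2) r _ (Q v)
    (fun w x => pairpt x x w) r0 (hQ v)).
  by move=> [w|w]; apply: hol_leK (hol_var r0 w); exact: le_trans (rr1 _) (r12 _).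
move=> g t0 d gd hx.
have /choice[q hq] : forall v, exists q : R -> C, clim (nbhs t0) q (d v) /\
    \forall t \near t0, g v t - g v t0 = real_complex R (t - t0) * q t.
  by move=> v; have [q] := gd v; exists q.
have gc v := cder_clim (gd v).
exists (fun t => \sum_v q v t * Q v (pairpt (g^~ t) (g^~ t0))).
  apply: clim_sum => v; apply: climM; first by have [] := hq v.
  have r110 w : 0 <= pairpt r1 r1 w by case: w.
  apply: (@hol_clim _ _ _ _ (pairpt r1 r1) (h / 3) _ (Q v)) => //.
  - apply: hol_le (hQ v) => // w; last by case: w.
    by rewrite addr_ge0// ltW.
  - by move=> [w|w] /=; [exact: gc|exact: clim_cst].
  - by move=> [w|w] /=; exact: le_trans (hx w) (rr1 w).
have hq2 : \forall t \near t0, forall v, g v t - g v t0 = real_complex R (t - t0) * q v t.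
  by apply: (@filter_forall _ _ _ (nbhs t0)) => v; have [] := hq v.
have hr2 : \forall t \near t0, polydisc r1 (g^~ t).
  exact: (@near_polydisc _ (nbhs t0) _ V r (h / 3) (fun t v => g v t) _ h3 gc hx).
near=> t.
rewrite (fQ (g^~ t) (g^~ t0)).
- rewrite mulr_sumr; apply: eq_bigr => v _; rewrite mulrA; congr (_ * _).
  by move: v; near: t; exact: hq2.
- have : polydisc r1 (g^~ t) by near: t; exact: hr2.
  by move=> ht v; exact: le_trans (ht v) (r12 v).
- by move=> v; apply: le_trans (hx v) _; exact: le_trans (rr1 v) (r12 v).
Unshelve. all: by end_near. Qed.

End Hadamard.

(** * The identity theorem along complex lines *)

Section Identity.
Context {R : realType}.
Local Notation C := R[i].

(** The quotient of [p - p(0)] by the variable. *)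
Fixpoint quot0 (p : pexp R unit) : pexp R unit :=
  match p with
  | Cst a => Cst 0
  | Var v => Cst 1
  | Add p q => Add (quot0 p) (quot0 q)
  | Mul p q => Add (Mul (quot0 p) q) (Mul (Cst (peval (fun=> 0) p)) (quot0 q))
  end.

Lemma quot0E (x : unit -> C) p :
  peval x p = peval (fun=> 0) p + x tt * peval x (quot0 p).
Proof.
elim: p => [a|[]|p hp q hq|p hp q hq] /=.
- by rewrite mulr0 addr0.
- by rewrite mulr1 add0r.
- by rewrite [in LHS]hp [in LHS]hq; ring.
- rewrite mulrDr addrCA.
  rewrite [X in _ = _ + X](_ : _ = peval (fun=> 0) p
    * (peval (fun=> 0) q + x tt * peval x (quot0 q))); last by ring.
  by rewrite -hq [in LHS]hp; ring.
Qed.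

(** Dividing by the variable divides the majorant by [rho] on the same polydisc,
    so the division can be iterated. *)
Lemma quot0_norm (rho : R) p : 0 <= rho ->
  rho * pnorm (fun=> rho) (quot0 p) + cmod (peval (fun=> 0) p)
  <= pnorm (fun=> rho) p.
Proof.
move=> r0; elim: p => [a|[]|p hp q hq|p hp q hq] /=.
- by rewrite cmod0 mulr0 add0r.
- by rewrite cmod1 mulr1 cmod0 addr0.
- have := cmodD (peval (fun=> 0) p) (peval (fun=> 0) q); lra.
- have := cmodM (peval (fun=> 0) p) (peval (fun=> 0) q).
  have := cmod_ge0 (peval (fun=> 0) p).
  have := @pnorm_ge0 _ _ (fun=> rho) (fun=> r0) q.
  move: hp hq; set A := pnorm _ p; set B := pnorm _ q.
  set a := pnorm _ _; set b := pnorm _ _.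
  set m := cmod (peval _ p); set n := cmod (peval _ q) => hp hq B0 m0 h.
  have h1 : (rho * a + m) * B <= A * B by rewrite ler_wpM2r.
  have h2 : m * (rho * b + n) <= m * B by rewrite ler_wpM2l.
  lra.
Qed.

Lemma hol_quot0 (rho : R) K f : 0 < rho -> hol (fun _ : unit => rho) K f ->
  f (fun=> 0) = 0 -> exists2 g, hol (fun _ : unit => rho) (K / rho) g &
    forall x, polydisc (fun _ : unit => rho) x -> f x = x tt * g x.
Proof.
move=> r0 hf f0; have [F [UF FK Ff]] := hol_ultra hf.
have rr0 (v : unit) := ltW r0.
have FQ : \forall p \near F, pnorm (fun=> rho) (quot0 p) <= K / rho.
  apply: filterS FK => p pK; rewrite ler_pdivlMr// mulrC.
  apply: le_trans pK; apply: le_trans (quot0_norm p (ltW r0)).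
  by rewrite lerDl cmod_ge0.
have /choice[Q hQ] : forall z : unit -> C, exists l,
    polydisc (fun=> rho) z -> clim F (fun p => peval z (quot0 p)) l.
  move=> z; have [hz|nz] := pselect (polydisc (fun=> rho) z); last first.
    by exists 0 => /nz.
  have [|l hl] := @ultra_lim _ _ F UF (fun p => peval z (quot0 p)) (K / rho).
    by apply: filterS FQ => p; apply: le_trans; exact: peval_le.
  by exists l.
exists Q.
  apply: (@hol_lim _ _ _ F _ _ _ (fun p z => peval z (quot0 p))) => //.
  by apply: filterS FQ => p pK; exact: hol_leK pK (hol_pexp rr0 _).
move=> x hx; apply: (@clim_unique _ _ F _ (fun p => peval x p)).
  exact: Ff.
under [in X in clim _ X _]eq_fun do rewrite quot0E.
have -> : x tt * Q x = f (fun=> 0) + x tt * Q x by rewrite f0 add0r.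
apply: climD.
  by apply: Ff => v; rewrite cmod0 ltW.
by apply: climM; [exact: clim_cst|exact: hQ].
Qed.

(** [f] vanishes to infinite order at 0, hence [f = x^k g_k] with [g_k] bounded
    by [K / rho^k] on the same disc. So [f c] is at most [K (cmod c / rho)^k]
    for all [k]. *)
Lemma identity1 (rho : R) K f (eta : R) : 0 < rho -> 0 < eta ->
  hol (fun _ : unit => rho) K f ->
  (forall t : R, 0 < t -> t <= eta -> f (fun=> real_complex R t) = 0) ->
  forall c, cmod c < rho -> f (fun=> c) = 0.
Proof.
move=> r0 e0 hf fz c hc.
wlog ler : eta e0 fz / eta <= rho / 2.
  move=> W; apply: (W (Num.min eta (rho / 2))); last by rewrite ge_min lexx orbT.
    by rewrite lt_min e0 divr_gt0.
  by move=> t t0; rewrite le_min => /andP[te _]; exact: fz.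
have key k : exists2 g, hol (fun _ : unit => rho) (K / rho ^+ k) g &
    (forall x, polydisc (fun _ : unit => rho) x -> f x = x tt ^+ k * g x) /\
    (forall t : R, 0 < t -> t <= eta -> g (fun=> real_complex R t) = 0).
  elim: k => [|k [g hg [fg gz]]].
    exists f; first by rewrite expr0 divr1.
    by split=> // x _; rewrite expr0 mul1r.
  have g0 : g (fun=> 0) = 0.
    have r20 : 0 < rho / 2 by rewrite divr_gt0.
    apply: (@clim_unique _ _ (0^'+ : set_system R) _
       (fun t : R => g (fun=> real_complex R t))).
      apply: (@hol_clim _ _ _ _ _ (fun=> rho / 2) (rho / 2)
         (K / rho ^+ k)) => //.
      - by move=> _; exact: ltW.
      - by apply: hol_le hg => // _; rewrite -splitr// ltW.
      - move=> _; split => /=; last exact: cvg_cst.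
        by apply: cvg_at_right_filter; exact: cvg_id.
      - by move=> _; rewrite cmod0 ltW.
    apply/climP => e he; near=> t.
    rewrite gz ?subrr ?cmod0 ?(ltW he)//.
    near: t; exact: nbhs_right_le.
  have [h hh gh] := hol_quot0 r0 hg g0.
  exists h; first by rewrite exprSr invfM mulrA.
  split=> [x hx|t t0 te].
    by rewrite fg// gh// mulrA exprSr.
  have /eqP := gz t t0 te; rewrite gh; last first.
    move=> _; rewrite cmodR ger0_norm ?(ltW t0)//.
    by rewrite (le_trans te)// (le_trans ler)// ler_pdivrMr// ler_peMr ?(ltW r0)// ler1n.
  by rewrite mulf_eq0 => /orP[|/eqP//]; rewrite eq_complex/= eqxx andbT gt_eqF.
have hx : polydisc (fun _ : unit => rho) (fun=> c) by move=> _; exact: ltW.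
have q0 : 0 <= cmod c / rho by rewrite divr_ge0 ?cmod_ge0 ?(ltW r0).
have q1 : cmod c / rho < 1 by rewrite ltr_pdivrMr// mul1r.
apply: cmod_eps0 => e he.
have [k hk] := filter_ex (pow_small q0 q1 (hol_K0 hf) he).
have [g hg [-> // _]] := key k.
rewrite (le_trans (cmodM _ _))//.
apply: (@le_trans _ _ (cmod c ^+ k * (K / rho ^+ k))).
  by apply: ler_pM; rewrite ?cmod_ge0 ?cmodX//; exact: hol_bound hg hx.
by rewrite mulrCA -expr_div_n.
Unshelve. all: by end_near. Qed.

Lemma hol_line V (r : V -> R) K f (a b : V -> C) (rho : R) : 0 <= rho ->
  hol r K f -> (forall v, cmod (a v) + rho * cmod (b v) <= r v) ->
  hol (fun _ : unit => rho) K (fun t => f (fun v => a v + t tt * b v)).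
Proof.
move=> r0 hf hab; apply: hol_comp hf _ => // v.
have := @hol_pexp _ unit (fun=> rho) (fun=> r0) (Add (Cst (a v)) (Mul (Var tt) (Cst (b v)))).
by apply: hol_leK => /=.
Qed.

Lemma identity_line V (r : V -> R) K f (a b : V -> C) (rho eta : R) :
  hol r K f -> (forall v, cmod (a v) + rho * cmod (b v) <= r v) ->
  0 < eta ->
  (forall t : R, 0 < t -> t <= eta ->
     f (fun v => a v + real_complex R t * b v) = 0) ->
  forall c, cmod c < rho -> f (fun v => a v + c * b v) = 0.
Proof.
move=> hf hab e0 fz c hc.
have r0 : 0 < rho by exact: le_lt_trans (cmod_ge0 c) hc.
by apply: (identity1 r0 e0 (hol_line (ltW r0) hf hab) _ hc).
Qed.

End Identity.

(** * Fixed points depending holomorphically on parameters *)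

Section FixedPoint.
Context {R : realType}.
Local Notation C := R[i].
Variables (P : finType) (V : Type) (rho : P -> R) (r : V -> R).
Variable Phi : P -> (P + V -> C) -> C.

Definition contracting := forall (u u' : P -> C) (x : V -> C) (d : R),
  polydisc rho u -> polydisc rho u' -> polydisc r x ->
  (forall q, cmod (u q - u' q) <= d) ->
  forall p, cmod (Phi p (pairpt u x) - Phi p (pairpt u' x)) <= d / 2.

Hypothesis Phi_contr : contracting.

Lemma fixpoint_unique (u u' : P -> C) x : polydisc rho u -> polydisc rho u' ->
  polydisc r x -> (forall p, Phi p (pairpt u x) = u p) ->
  (forall p, Phi p (pairpt u' x) = u' p) -> u = u'.
Proof.
move=> hu hu' hx fu fu'.
pose D := \sum_p cmod (u p - u' p).
have hk k : forall p, cmod (u p - u' p) <= D * (1/2) ^+ k.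
  elim: k => [|k IH] p.
    rewrite expr0 mulr1 /D (bigD1 p)//= lerDl sumr_ge0// => i _; exact: cmod_ge0.
  rewrite -fu -fu' (le_trans (Phi_contr hu hu' hx IH p))//.
  by rewrite exprSr; set q2 := (1/2) ^+ k; lra.
have D0 : 0 <= D by apply: sumr_ge0 => p _; exact: cmod_ge0.
apply/funext => p; apply/eqP; rewrite -subr_eq0; apply/eqP.
apply: cmod_eps0 => e he.
have [q0 q1] : 0 <= 1/2 :> R /\ 1/2 < 1 :> R by split; lra.
have [k h] := filter_ex (pow_small q0 q1 D0 he).
exact: le_trans (hk k p) h.
Qed.

Hypothesis r0 : forall v, 0 <= r v.
Hypothesis hPhi : forall p, hol (pairpt rho r) (rho p) (Phi p).

(** Picard's iterates are holomorphic in the parameters, with uniform bounds; so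
    is their limit along an ultrafilter. *)
Lemma fixpoint : exists2 S : P -> (V -> C) -> C,
  (forall p, hol r (rho p) (S p)) &
  forall x, polydisc r x -> forall p, Phi p (pairpt (S^~ x) x) = S p x.
Proof.
pose u := fix u (k : nat) (p : P) (x : V -> C) : C := match k with
  | 0%N => 0 | k'.+1 => Phi p (pairpt ((u k')^~ x) x) end.
have rho0 p : 0 <= rho p by exact: hol_K0 (hPhi p).
have hu k p : hol r (rho p) (u k p).
  elim: k p => [|k IH] p /=.
    by apply: hol_leK (hol_cst r0 0); rewrite cmod0.
  apply: (@hol_comp _ _ _ (pairpt rho r) r (rho p) (Phi p)
    (fun s x => match s with inl q => u k q x | inr v => x v end)) => //.
  by move=> [q|v]; [exact: IH|exact: hol_var].
have [U [UU UN]] := @ultraFilterLemma nat \oo _.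
have /choice[S hS] : forall px : P * (V -> C), exists l, polydisc r px.2 ->
    clim U (fun k => u k px.1 px.2) l.
  move=> [p x]; have [hx|nx] := pselect (polydisc r x); last first.
    by exists 0 => /nx.
  have [|l hl] := @ultra_lim _ _ U UU (fun k => u k p x) (rho p).
    by apply: nearW => k; exact: hol_bound (hu k p) hx.
  by exists l.
exists (fun p x => S (p, x)).
  move=> p; apply: (@hol_lim _ _ _ U _ _ _ (fun k => u k p)) => //.
    by apply: nearW => k; exact: hu.
  by move=> x hx; exact: (hS (p, x)).
move=> x hx p.
have hSx q : cmod (S (q, x)) <= rho q.
  apply: (clim_le (hS (q, x) hx)); apply: nearW => k.
  exact: hol_bound (hu k q) hx.
pose D := \sum_q rho q.
have hk k : forall q, cmod (u k.+1 q x - u k q x) <= D * (1/2) ^+ k.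
  elim: k => [|k IH] q.
    rewrite expr0 mulr1 [u 0%N q x]/= subr0 (le_trans (hol_bound (hu 1%N q) hx))//.
    by rewrite /D (bigD1 q)//= lerDl sumr_ge0.
  rewrite [u k.+2]/= [X in _ - X]/=.
  have h1 : polydisc rho ((u k.+1)^~ x) by move=> w; exact: hol_bound (hu _ _) hx.
  have h2 : polydisc rho ((u k)^~ x) by move=> w; exact: hol_bound (hu _ _) hx.
  rewrite (le_trans (Phi_contr h1 h2 hx IH q))//.
  by rewrite exprSr; set q2 := (1/2) ^+ k; lra.
have D0 : 0 <= D by apply: sumr_ge0.
have hSp : polydisc rho (fun q => S (q, x)) by [].
apply/eqP; rewrite -subr_eq0; apply/eqP; apply: cmod_eps0 => e he.
have e3 : 0 < e / 3 by rewrite divr_gt0.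
have n1 : \forall k \near U, forall q, cmod (u k q x - S (q, x)) <= e / 3.
  by apply: filter_forall => q; have /climP/(_ _ e3) := hS (q, x) hx.
have n2 : \forall k \near U, D * (1/2) ^+ k <= e / 3.
  by apply: UN; apply: pow_small; lra.
have [k [k1 k2]] : exists k, (forall q, cmod (u k q x - S (q, x)) <= e / 3) /\
    D * (1/2) ^+ k <= e / 3.
  apply/(@filter_ex _ U); near=> k; split; near: k; [exact: n1|exact: n2].
have h1 : polydisc rho ((u k)^~ x) by move=> w; exact: hol_bound (hu _ _) hx.
have k3 := hk k p.
have := Phi_contr h1 hSp hx k1 p.
rewrite -[Phi p (pairpt ((u k)^~ x) x)]/(u k.+1 p x) => k4.
rewrite [X in cmod X](_ : _ = - (u k.+1 p x - Phi p (pairpt (fun q => S (q, x)) x))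
  + ((u k.+1 p x - u k p x) + (u k p x - S (p, x)))); last by ring.
rewrite (le_trans (cmodD _ _))// cmodN.
have := cmodD (u k.+1 p x - u k p x) (u k p x - S (p, x)).
have := k1 p.
lra.
Unshelve. all: by end_near. Qed.

End FixedPoint.

(** * Convergent power series and holomorphic functions *)

Section PowerSeries.
Context {R : realType}.
Local Notation C := R[i].

Lemma mx_entry_le m (h : 'rV[R]_m) i : `|h 0 i| <= `|h|.
Proof.
rewrite [leRHS]/Num.Def.normr/= mx_normrE.
exact: (le_bigmax _ (fun ij : 'I_1 * 'I_m => `|h ij.1 ij.2|) (0, i)).
Qed.

Lemma mx_norm_le m (h : 'rV[R]_m) r : 0 <= r -> (forall i, `|h 0 i| <= r) ->
  `|h| <= r.
Proof.
move=> r0 hr; rewrite [leLHS]/Num.Def.normr/= mx_normrE.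
by apply: bigmax_le => // -[i j] _ /=; rewrite ord1.
Qed.

Lemma mx_norm_lt m (h : 'rV[R]_m) r : 0 < r -> (forall i, `|h 0 i| < r) ->
  `|h| < r.
Proof.
move=> r0 hr; rewrite [ltLHS]/Num.Def.normr/= mx_normrE.
by apply: bigmax_lt => // -[i j] _ /=; rewrite ord1.
Qed.

Definition rpt m (h : 'rV[R]_m) : 'I_m -> C := fun i => real_complex R (h 0 i).

Definition psexp m (c : {ffun 'I_m -> nat} -> C) (N : nat) : pexp R 'I_m :=
  \big[(@Add R 'I_m)/Cst 0]_(a : {ffun 'I_m -> 'I_N})
    Mul (Cst (c [ffun i => a i : nat]))
      (\big[(@Mul R 'I_m)/Cst 1]_(i < m) iter (a i) (Mul (Var i)) (Cst 1)).

Lemma peval_psexp m c N x : peval x (@psexp m c N) =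
  \sum_(a : {ffun 'I_m -> 'I_N}) c [ffun i => a i : nat] * \prod_(i < m) x i ^+ a i.
Proof.
rewrite /psexp (big_morph (peval x) (fun p q => erefl) erefl).
apply: eq_bigr => a _ /=; congr (_ * _).
rewrite (big_morph (peval x) (fun p q => erefl) erefl).
apply: eq_bigr => i _; elim: (nat_of_ord (a i)) => [|k IH] //=.
by rewrite IH exprS.
Qed.

Lemma pnorm_psexp m c N r : pnorm r (@psexp m c N) =
  \sum_(a : {ffun 'I_m -> 'I_N})
     cmod (c [ffun i => a i : nat]) * \prod_(i < m) r i ^+ a i.
Proof.
have c0 : pnorm r (Cst 0 : pexp R 'I_m) = 0 by rewrite /= cmod0.
have c1 : pnorm r (Cst 1 : pexp R 'I_m) = 1 by rewrite /= cmod1.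
rewrite /psexp (big_morph (pnorm r) (fun p q => erefl) c0).
apply: eq_bigr => a _ /=; congr (_ * _).
rewrite (big_morph (pnorm r) (fun p q => erefl) c1).
apply: eq_bigr => i _; elim: (nat_of_ord (a i)) => [|k IH] /=.
  by rewrite cmod1.
by rewrite IH exprS.
Qed.

Lemma geom_half_le N : \sum_(j < N) (1/2 : R) ^+ j <= 2.
Proof.
have -> : \sum_(j < N) (1/2 : R) ^+ j = 2 - 2 * (1/2) ^+ N.
  elim: N => [|N IH]; first by rewrite big_ord0 expr0; ring.
  by rewrite big_ord_recr /= IH exprSr; field.
by rewrite lerBlDr lerDl mulr_ge0// exprn_ge0// divr_ge0.
Qed.

Lemma half_box_le m N : \sum_(a : {ffun 'I_m -> 'I_N})
  \prod_(i < m) (1/2 : R) ^+ a i <= 2 ^+ m.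
Proof.
rewrite -(@bigA_distr_bigA R 0 1 _ _ 'I_m 'I_N (fun i j => (1/2 : R) ^+ (j : nat))).
rewrite -[leRHS](_ : \prod_(i < m) 2 = _); last by rewrite prodr_const card_ord.
apply: ler_prod => i _; rewrite geom_half_le andbT.
by apply: sumr_ge0 => j _; rewrite exprn_ge0// divr_ge0.
Qed.

(** On half of the radius of the series, the terms are dominated by a geometric
    series in each variable. A term of degree at least [k] at radius [t <= r0 /
    2] carries in addition the factor [(2 t / r0)^k], whence the bound by [t^k].
    *)
Lemma power_series_hol m k (f : 'rV[R]_m -> R) : vanishing_analytic k f ->
  exists r C0 : R, exists F : ('I_m -> C) -> C,
  [/\ 0 < r, 0 <= C0,
      forall t, 0 <= t -> t <= r -> hol (fun=> t) (C0 * t ^+ k) F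
    & forall h : 'rV[R]_m, (forall i, `|h 0 i| <= r) ->
        F (rpt h) = real_complex R (f h)].
Proof.
move=> [c [r0 [K [r00 cK cf]]] ck].
have K0 : 0 <= K.
  by apply: le_trans (cK [ffun=> 0%N]); rewrite mulr_ge0// exprn_ge0// ltW.
pose r := r0 / 2; have r_gt0 : 0 < r by rewrite divr_gt0.
pose C0 := K * (2 / r0) ^+ k * 2 ^+ m.
have C00 : 0 <= C0.
  by rewrite !mulr_ge0// exprn_ge0// divr_ge0// ltW.
pose cc a := real_complex R (c a).
have nb t N : 0 <= t -> t <= r -> pnorm (fun=> t) (psexp cc N) <= C0 * t ^+ k.
  move=> t0 tr; rewrite pnorm_psexp.
  have t2 : 0 <= 2 * t / r0 by rewrite divr_ge0 ?mulr_ge0 ?(ltW r00).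
  have t21 : 2 * t / r0 <= 1.
    by rewrite ler_pdivrMr// mul1r; move: tr; rewrite /r; lra.
  have E : C0 * t ^+ k = K * (2 * t / r0) ^+ k * 2 ^+ m.
    rewrite /C0 [2 * t / r0]mulrAC [in RHS]exprMn; ring.
  rewrite E.
  apply: (@le_trans _ _ (\sum_(a : {ffun 'I_m -> 'I_N})
     K * (2 * t / r0) ^+ k * \prod_(i < m) (1/2 : R) ^+ a i)); last first.
    by rewrite -mulr_sumr ler_wpM2l ?half_box_le// mulr_ge0// exprn_ge0.
  apply: ler_sum => a _; rewrite cmodR.
  rewrite !prodrXr; set s := (\sum_i _)%N.
  have [sk|ks] := ltnP s k.
    rewrite ck ?normr0 ?mul0r.
      by rewrite !mulr_ge0// exprn_ge0// divr_ge0.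
    by under eq_bigr do rewrite ffunE.
  have -> : t ^+ s = r0 ^+ s * ((2 * t / r0) ^+ s * (1/2) ^+ s).
    rewrite -!exprMn; congr (_ ^+ _); field.
    by rewrite gt_eqF.
  rewrite mulrA; have := cK [ffun i => a i : nat].
  under eq_bigr do rewrite ffunE.
  rewrite -/s => h.
  have q0 : 0 <= (1/2 : R) ^+ s by rewrite exprn_ge0// divr_ge0.
  rewrite -[leRHS]mulrA ler_pM//.
  - by rewrite mulr_ge0// exprn_ge0// ltW.
  - by rewrite mulr_ge0// exprn_ge0.
  - by rewrite ler_wpM2r// ler_wiXn2l.
have [U [UU UN]] := @ultraFilterLemma nat \oo _.
have /choice[F hF] : forall x : 'I_m -> C, exists l,
    polydisc (fun=> r) x -> clim U (fun N => peval x (psexp cc N)) l.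
  move=> x; have [hx|nx] := pselect (polydisc (fun=> r) x); last first.
    by exists 0 => /nx.
  have [|l hl] := @ultra_lim _ _ U UU (fun N => peval x (psexp cc N)) (C0 * r ^+ k).
    apply: nearW => N; apply: le_trans (nb r N (ltW r_gt0) (lexx r)).
    exact: peval_le.
  by exists l.
exists r, C0, F; split=> //.
  move=> t t0 tr; apply: (@hol_lim _ _ _ U _ _ _ (fun N x => peval x (psexp cc N))) => //.
    apply: nearW => N; apply: hol_leK (nb t N t0 tr) _.
    exact: (hol_pexp (fun=> t0)).
  by move=> x hx; apply: hF => v; exact: le_trans (hx v) tr.
move=> h hr.
have hx : polydisc (fun=> r) (rpt h) by move=> i; rewrite /rpt cmodR.
apply: (@clim_unique _ _ U _ (fun N => peval (rpt h) (psexp cc N))); first exact: hF.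
have hr0 : `|h| < r0.
  apply: (@le_lt_trans _ _ r); first by apply: mx_norm_le; rewrite // ltW.
  by rewrite /r ltr_pdivrMr// ltr_pMr// ltr1n.
have E N : peval (rpt h) (psexp cc N) = real_complex R (pseries_sum c h N).
  rewrite peval_psexp /pseries_sum rmorph_sum; apply: eq_bigr => a _.
  rewrite rmorphM /=; congr (_ * _); rewrite /monomial rmorph_prod.
  by apply: eq_bigr => i _; rewrite ffunE rmorphXn.
under eq_fun do rewrite E.
split => /=; last exact: cvg_cst.
have := cf h hr0; rewrite add0r => cfh.
move=> A /cfh; exact: UN.
Qed.

Definition mono m := (C * {ffun 'I_m -> nat})%type.

Definition mono_mul m (u v : mono m) : mono m :=
  (u.1 * v.1, [ffun i => (u.2 i + v.2 i)%N]).

(** The expanded form of an expression. Limits of expressions say nothing on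
    their size as terms, but the coefficients of their expansions converge. *)
Fixpoint monomials m (p : pexp R 'I_m) : seq (mono m) :=
  match p with
  | Cst a => [:: (a, [ffun=> 0%N])]
  | Var i => [:: (1, [ffun j => (j == i : nat)])]
  | Add p q => monomials p ++ monomials q
  | Mul p q => [seq mono_mul u v | u <- monomials p, v <- monomials q]
  end.

Definition xmono (S : comPzRingType) m (x : 'I_m -> S) (a : {ffun 'I_m -> nat}) :=
  \prod_(i < m) x i ^+ a i.

Lemma xmono0 (S : comPzRingType) m (x : 'I_m -> S) : xmono x [ffun=> 0%N] = 1.
Proof. by apply: big1 => i _; rewrite ffunE expr0. Qed.

Lemma xmono1 (S : comPzRingType) m (x : 'I_m -> S) i :
  xmono x [ffun j => (j == i : nat)] = x i.
Proof.
rewrite /xmono (bigD1 i)//= ffunE eqxx expr1 big1 ?mulr1// => j /negbTE ji.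
by rewrite ffunE ji expr0.
Qed.

Lemma xmonoD (S : comPzRingType) m (x : 'I_m -> S) (a b : {ffun 'I_m -> nat}) :
  xmono x [ffun i => (a i + b i)%N] = xmono x a * xmono x b.
Proof. by rewrite -big_split; apply: eq_bigr => i _; rewrite ffunE exprD. Qed.

Lemma monomialsE m (x : 'I_m -> C) p :
  peval x p = \sum_(u <- monomials p) u.1 * xmono x u.2.
Proof.
elim: p => [a|i|p hp q hq|p hp q hq] /=.
- by rewrite big_seq1 xmono0 mulr1.
- by rewrite big_seq1 xmono1 mul1r.
- by rewrite big_cat hp hq.
- rewrite big_allpairs_dep /= hp hq big_distrl; apply: eq_bigr => u _ /=.
  by rewrite big_distrr; apply: eq_bigr => v _ /=; rewrite xmonoD; ring.
Qed.

Lemma monomials_norm m (r : 'I_m -> R) p : (forall i, 0 <= r i) ->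
  \sum_(u <- monomials p) cmod u.1 * xmono r u.2 <= pnorm r p.
Proof.
move=> r0; have x0 a : 0 <= xmono r a by apply: prodr_ge0 => i _; exact: exprn_ge0.
elim: p => [a|i|p hp q hq|p hp q hq] /=.
- by rewrite big_seq1 xmono0 mulr1.
- by rewrite big_seq1 xmono1 cmod1 mul1r.
- by rewrite big_cat lerD.
- rewrite big_allpairs_dep /=.
  apply: (@le_trans _ _ ((\sum_(u <- monomials p) cmod u.1 * xmono r u.2)
    * (\sum_(u <- monomials q) cmod u.1 * xmono r u.2))); last first.
    by apply: ler_pM => //; apply: sumr_ge0 => u _; rewrite mulr_ge0// cmod_ge0.
  rewrite big_distrl; apply: ler_sum => u _ /=.
  rewrite big_distrr; apply: ler_sum => v _ /=; rewrite xmonoD.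
  rewrite [leRHS](_ : _ = cmod u.1 * cmod v.1 * (xmono r u.2 * xmono r v.2)).
    by rewrite ler_wpM2r ?mulr_ge0// cmodM.
  by ring.
Qed.

Definition coef m (a : {ffun 'I_m -> nat}) (l : seq (mono m)) : C :=
  \sum_(u <- l | u.2 == a) u.1.

Lemma coef_le m (r : 'I_m -> R) a (l : seq (mono m)) : (forall i, 0 <= r i) ->
  cmod (coef a l) * xmono r a <= \sum_(u <- l) cmod u.1 * xmono r u.2.
Proof.
move=> r0; have x0 b : 0 <= xmono r b by apply: prodr_ge0 => i _; exact: exprn_ge0.
apply: (@le_trans _ _ (\sum_(u <- l | u.2 == a) cmod u.1 * xmono r u.2)).
  rewrite /coef (le_trans (ler_wpM2r (x0 a) (cmod_sum _ _ _)))// mulr_suml.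
  by apply: ler_sum => u /eqP ->.
rewrite big_mkcond; apply: ler_sum => u _; case: ifP => // _.
by rewrite mulr_ge0// cmod_ge0.
Qed.

Lemma coef_box m (x : 'I_m -> C) N (l : seq (mono m)) :
  \sum_(a : {ffun 'I_m -> 'I_N})
     coef [ffun i => a i : nat] l * xmono x [ffun i => a i : nat]
  = \sum_(u <- l | [forall i, (u.2 i < N)%N]) u.1 * xmono x u.2.
Proof.
pose nf (a : {ffun 'I_m -> 'I_N}) : {ffun 'I_m -> nat} := [ffun i => a i : nat].
transitivity (\sum_(a : {ffun 'I_m -> 'I_N})
    \sum_(u <- l) (if u.2 == nf a then u.1 * xmono x u.2 else 0)).
  apply: eq_bigr => a _; rewrite -big_mkcond /coef big_distrl /=.
  by apply: eq_bigr => u /eqP ->.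
rewrite exchange_big [RHS]big_mkcond; apply: eq_bigr => u _.
case: ifPn => [/forallP uN|uN].
  pose b : {ffun 'I_m -> 'I_N} := [ffun i => Ordinal (uN i)].
  rewrite (bigD1 b)//= ifT; last first.
    by apply/eqP/ffunP => i; rewrite !ffunE.
  rewrite big1 ?addr0// => a ab; rewrite ifF//; apply/negP => /eqP E.
  move/eqP: ab; apply; apply/ffunP => i; apply: val_inj.
  by rewrite ffunE /= E ffunE.
rewrite big1// => a _; rewrite ifF//; apply/negP => /eqP E.
move/negP: uN; apply; apply/forallP => i; by rewrite E ffunE.
Qed.

(** A monomial with an exponent at least [N] is smaller by [q^N] at radius [q r]
    than at radius [r]. *)
Lemma box_remainder m (x : 'I_m -> C) (r q : R) N p : 0 <= r -> 0 <= q -> q <= 1 ->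
  (forall i, cmod (x i) <= q * r) ->
  cmod (peval x p - \sum_(a : {ffun 'I_m -> 'I_N})
     coef [ffun i => a i : nat] (monomials p) * xmono x [ffun i => a i : nat])
  <= q ^+ N * pnorm (fun=> r) p.
Proof.
move=> r0 q0 q1 xr.
have x0 a : 0 <= xmono (fun _ : 'I_m => r) a.
  by apply: prodr_ge0 => i _; exact: exprn_ge0.
rewrite coef_box monomialsE (bigID (fun u : mono m => [forall i, (u.2 i < N)%N])) /=.
rewrite addrAC subrr add0r (le_trans (cmod_sum _ _ _))//.
apply: le_trans (ler_wpM2l (exprn_ge0 _ q0) (monomials_norm p (fun=> r0))).
rewrite mulr_sumr big_mkcond; apply: ler_sum => u _; case: ifP => [|_]; last first.
  by rewrite !mulr_ge0 ?cmod_ge0// exprn_ge0.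
rewrite negb_forall => /existsP[i0]; rewrite -leqNgt => Ni.
rewrite (le_trans (cmodM _ _))// mulrCA ler_wpM2l ?cmod_ge0//.
apply: (@le_trans _ _ (xmono (fun=> q * r) u.2)).
  rewrite /xmono; elim/big_ind2: _ => [|a b c d ab cd|j _].
  - by rewrite cmod1.
  - by rewrite (le_trans (cmodM _ _))// ler_pM// cmod_ge0.
  - by rewrite (le_trans (cmodX _ _))// lerXn2r// nnegrE ?cmod_ge0 ?mulr_ge0.
rewrite {1}/xmono; under eq_bigr do rewrite exprMn.
rewrite big_split; apply: ler_wpM2r; first exact: x0.
rewrite /= (bigD1 i0)//= -[leRHS]mulr1; apply: ler_pM; rewrite ?exprn_ge0//.
- by apply: prodr_ge0 => j _; exact: exprn_ge0.
- exact: ler_wiXn2l.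
- by apply: prodr_ile1 => j; rewrite exprn_ge0//= exprn_ile1.
Qed.

(** The coefficients of the approximating expressions converge along the
    ultrafilter, and [box_remainder] bounds the remainder of the partial sums
    uniformly in the expression. *)
Lemma hol_power_series m (f : ('I_m -> C) -> C) (r K : R) (phi : 'rV[R]_m -> R) p :
  0 < r -> hol (fun=> r) K f ->
  (forall h, `|h| < r -> phi (p + h) = complex.Re (f (rpt h))) ->
  exists c, power_series_at phi p c.
Proof.
move=> r0 hf fphi; have [F [UF FK Ff]] := hol_ultra hf.
have rr0 (i : 'I_m) := ltW r0.
have xr a : xmono (fun _ : 'I_m => r) a = r ^+ (\sum_i a i)%N by rewrite /xmono prodrXr.
have cb a : \forall e \near F, cmod (coef a (monomials e)) * r ^+ (\sum_i a i)%N <= K.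
  apply: filterS FK => e eK; rewrite -xr.
  exact: le_trans (coef_le _ _ rr0) (le_trans (monomials_norm _ rr0) eK).
have /choice[c hc] : forall a, exists l, clim F (fun e => coef a (monomials e)) l.
  move=> a; apply: (@ultra_lim _ _ F UF _ (K / r ^+ (\sum_i a i)%N)).
  by apply: filterS (cb a) => e; rewrite ler_pdivlMr// exprn_gt0.
exists (fun a => complex.Re (c a)), r, K; split=> //.
  move=> a; apply: (@le_trans _ _ (cmod (c a) * r ^+ (\sum_i a i)%N)).
    by rewrite ler_wpM2r ?Re_le_cmod// exprn_ge0// ltW.
  rewrite -ler_pdivlMr ?exprn_gt0//.
  apply: (clim_le (hc a)); apply: filterS (cb a) => e.
  by rewrite ler_pdivlMr// exprn_gt0.
move=> h hr.
pose q := `|h| / r.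
have q0 : 0 <= q by rewrite divr_ge0// ltW.
have q1 : q < 1 by rewrite ltr_pdivrMr// mul1r.
have hq i : cmod (rpt h i) <= q * r.
  by rewrite /rpt cmodR /q divfK ?gt_eqF// mx_entry_le.
have hx : polydisc (fun=> r) (rpt h).
  by move=> i; rewrite (le_trans (hq i))// ler_piMl ?(ltW r0)// ltW.
have key N : cmod (f (rpt h) - \sum_(a : {ffun 'I_m -> 'I_N})
     c [ffun i => a i : nat] * xmono (rpt h) [ffun i => a i : nat]) <= q ^+ N * K.
  apply: (@clim_le _ _ F _ (fun e => peval (rpt h) e - \sum_(a : {ffun 'I_m -> 'I_N})
     coef [ffun i => a i : nat] (monomials e) * xmono (rpt h) [ffun i => a i : nat])).
    apply: climD; first exact: Ff.
    by apply: climN; apply: clim_sum => a; apply: climM => //; exact: clim_cst.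
  apply: filterS FK => e eK.
  apply: le_trans (box_remainder _ _ (ltW r0) q0 (ltW q1) hq) _.
  by rewrite ler_wpM2l// exprn_ge0.
have K0 := hol_K0 hf.
have E N : pseries_sum (fun a => complex.Re (c a)) h N =
   complex.Re (\sum_(a : {ffun 'I_m -> 'I_N})
     c [ffun i => a i : nat] * xmono (rpt h) [ffun i => a i : nat]).
  have Resum (I : finType) (G : I -> C) : complex.Re (\sum_i G i) = \sum_i complex.Re (G i).
    by apply: (big_morph _ (@cReD R)).
  rewrite Resum; apply: eq_bigr => a _; rewrite cReM.
  have -> : xmono (rpt h) [ffun i => a i : nat]
     = real_complex R (monomial h [ffun i => a i : nat]).
    by rewrite /monomial rmorph_prod; apply: eq_bigr => i _; rewrite rmorphXn.
  by rewrite /= mulr0 subr0.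
apply/cvgrPdist_le => e e0; apply: filterS (pow_small q0 q1 K0 e0) => N hN.
rewrite E fphi// -cReN -cReD (le_trans (Re_le_cmod _))// (le_trans (key N))//.
by rewrite mulrC.
Qed.

End PowerSeries.

(** * Complex-valued curves and real derivatives *)

Section DerivativeBridge.
Context {R : realType}.
Local Notation C := R[i].

Lemma is_derive_quot (g q : R -> R) (t0 d : R) : q @ t0 --> d ->
  (\forall t \near t0, g t - g t0 = (t - t0) * q t) -> is_derive t0 1 g d.
Proof.
move=> qd gq.
have H : (fun h => h^-1 *: ((g \o shift t0) (h *: (1 : R)) - g t0)) @ 0^' --> d.
  apply/cvgrPdist_le => e e0.
  move/cvgrPdist_le : qd => /(_ e e0) qd.
  have h1 : \forall h \near (0 : R), `|d - q (h + t0)| <= e.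
    by rewrite (near_shift t0); apply: filterS qd => t; rewrite /= sub0r subrK.
  have h2 : \forall h \near (0 : R),
      g (h + t0) - g t0 = h * q (h + t0).
    rewrite (near_shift t0); apply: filterS gq => t /=; rewrite sub0r subrK => ->.
    by [].
  move/nbhs_dnbhs : h1 => h1; move/nbhs_dnbhs : h2 => h2.
  have ne := @nbhs_dnbhs_neq R 0.
  near=> h.
  rewrite /= [h *: 1](mulr1 h).
  have -> : g (h + t0) - g t0 = h * q (h + t0) by near: h; exact: h2.
  rewrite [_ *: _](mulKf _ (q (h + t0))).
    by near: h; exact: h1.
  by near: h; exact: ne.
split; first by apply/cvg_ex; exists d.
by apply/cvg_lim.
Unshelve. all: by end_near. Qed.

Lemma derive_quot (g : R -> R) (t0 d : R) : is_derive t0 1 g d ->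
  (fun t => if t == t0 then d else (t - t0)^-1 * (g t - g t0)) @ t0 --> d.
Proof.
move=> [/cvg_ex[l hl] gd].
have {}gd : l = d.
  by rewrite -gd /derive; apply/esym/cvg_lim.
subst l; apply/cvgrPdist_le => e e0.
move/cvgrPdist_le : hl => /(_ e e0) hl.
have : \forall h \near (0 : R), h != 0 ->
    `|d - h^-1 *: (g (h *: 1 + t0) - g t0)| <= e by exact: hl.
move=> H.
suff G : \forall t \near t0,
    `|d - (if t == t0 then d else (t - t0)^-1 * (g t - g t0))| <= e by exact: G.
rewrite (near_shift (0 : R)).
apply: filterS H => h /=.
have -> : h + (t0 - 0) = h + t0 by rewrite subr0.
rewrite -(subr_eq0 (h + t0)) addrK [h *: 1](mulr1 h).
by case: eqP => [_ _|_ /(_ isT)//]; rewrite /= subrr normr0 ltW.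
Qed.

Lemma cderP (g : R -> C) t0 d : cder g t0 d <->
  is_derive t0 1 (fun t => complex.Re (g t)) (complex.Re d) /\
  is_derive t0 1 (fun t => complex.Im (g t)) (complex.Im d).
Proof.
split=> [[q [q1 q2] gq]|[h1 h2]].
  split.
    apply: is_derive_quot q1 _; apply: filterS gq => t E.
    by rewrite -cReN -cReD E cReM /= mul0r subr0.
  apply: is_derive_quot q2 _; apply: filterS gq => t E.
  by rewrite -cImN -cImD E cImM /= mul0r addr0.
move/derive_quot: h1 => h1; move/derive_quot: h2 => h2.
exists (fun t => Complex
  (if t == t0 then complex.Re d
   else (t - t0)^-1 * (complex.Re (g t) - complex.Re (g t0)))
  (if t == t0 then complex.Im d
   else (t - t0)^-1 * (complex.Im (g t) - complex.Im (g t0)))).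
  by split.
near=> t; apply: complex_ext.
  rewrite cReD cReN cReM /= mul0r subr0; case: eqP => [->|/eqP tt0].
    by rewrite !subrr mul0r.
  by rewrite mulVKf// subr_eq0.
rewrite cImD cImN cImM /= mul0r addr0; case: eqP => [->|/eqP tt0].
  by rewrite !subrr mul0r.
by rewrite mulVKf// subr_eq0.
Unshelve. all: by end_near. Qed.

Lemma mean_value (g d : R -> R) (M : R) :
  (forall t : R, 0 <= t <= 1 -> is_derive t 1 g (d t)) ->
  (forall t : R, 0 <= t <= 1 -> `|d t| <= M) -> `|g 1 - g 0| <= M.
Proof.
move=> gd dM.
have [t||c] := @MVT_segment R g d 0 1 ler01.
- by rewrite in_itv /= => /andP[t0 t1]; apply: gd; rewrite !ltW.
- apply: derivable_within_continuous => x; rewrite in_itv /= => x01.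
  by have [] := gd x x01.
by rewrite in_itv /= subr0 mulr1 => c01 ->; exact: dM.
Qed.

Lemma cmean_value (g d : R -> C) (M : R) :
  (forall t : R, 0 <= t <= 1 -> cder g t (d t)) ->
  (forall t : R, 0 <= t <= 1 -> cmod (d t) <= M) -> cmod (g 1 - g 0) <= 2 * M.
Proof.
move=> gd dM; rewrite /cmod cReD cImD cReN cImN mulrDl mul1r lerD//.
  apply: (@mean_value (fun t => complex.Re (g t)) (fun t => complex.Re (d t))).
    by move=> t /gd /cderP[].
  by move=> t /dM; exact: le_trans (Re_le_cmod _).
apply: (@mean_value (fun t => complex.Im (g t)) (fun t => complex.Im (d t))).
  by move=> t /gd /cderP[].
by move=> t /dM; exact: le_trans (Im_le_cmod _).
Qed.

Lemma cder_conj (g : R -> C) t0 d : cder g t0 d ->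
  cder (fun t => conjc (g t)) t0 (conjc d).
Proof.
have ReC (x : C) : complex.Re (conjc x) = complex.Re x by case: x.
have ImC (x : C) : complex.Im (conjc x) = - complex.Im x by case: x.
move=> /cderP[h1 h2]; apply/cderP; rewrite ReC ImC; split.
  by under eq_fun do rewrite ReC.
by under eq_fun do rewrite ImC; exact: is_deriveN.
Qed.

End DerivativeBridge.

(** * Conjugation and real points *)

Lemma hol_star_perm (R : realType) (W : Type) (p : W -> W) (r : W -> R) K g :
  (forall w, r (p w) = r w) -> hol r K g ->
  hol r K (fun y => conjc (g (fun w => conjc (y (p w))))).
Proof.
move=> rp hg; have r0 := hol_r0 hg.
have := @hol_comp _ W W r r K _ (fun v x => x (p v)) r0 (hol_conj hg).
by apply=> v; rewrite -[r v]rp; exact: hol_var.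
Qed.

Section Star.
Context {R : realType} {n : nat}.
Local Notation C := R[i].
Local Notation V := ('I_n + 'I_n)%type.

Definition swp (s : V) : V := match s with inl j => inr j | inr j => inl j end.
(** The reflection of C^n x C^n that fixes the real points [xi = conj z]. *)
Definition sw (x : V -> C) : V -> C := fun s => conjc (x (swp s)).
Definition star (g : (V -> C) -> C) (x : V -> C) : C := conjc (g (sw x)).

Lemma swpK : involutive swp. Proof. by case. Qed.
Lemma swK x : sw (sw x) = x.
Proof. by apply/funext => s; rewrite /sw swpK conjcK. Qed.
Lemma sw_polydisc (r : V -> R) x : (forall s, r (swp s) = r s) ->
  polydisc r x -> polydisc r (sw x).
Proof. by move=> rs hx s; rewrite /sw cmod_conj -rs; exact: hx. Qed.
Lemma star_real g x : sw x = x -> star g x = conjc (g x).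
Proof. by move=> xr; rewrite /star xr. Qed.
Lemma hol_star (r : V -> R) K g : (forall s, r (swp s) = r s) ->
  hol r K g -> hol r K (star g).
Proof. exact: (@hol_star_perm R V swp). Qed.
End Star.

(** * Segre varieties as graphs *)

Section Segre.
Context {R : realType} {n : nat} (hn : (2 <= n)%N).
Local Notation C := R[i].
Local Notation V := ('I_n + 'I_n)%type.
Local Notation o1 := (Ordinal (ltnW hn) : 'I_n).
Local Notation o2 := (Ordinal hn : 'I_n).
Local Notation rc := (real_complex R).

Variables (delta e : R) (eps : C) (E : (V -> C) -> C).
Hypothesis d0 : 0 < delta.
Hypothesis e0 : 0 <= e.
Hypothesis e1 : e <= 1 / 1000.
Hypothesis eps1 : cmod eps <= 1.
Hypothesis hE : hol (fun _ : V => 10 * delta) (e * delta ^+ 2) E.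

Local Ltac dlra := have := d0; have := e0; have := e1; lra.

(** The left summand of [V] holds the coordinates of [z], the right one those of
    [xi]. *)
Definition fC (x : V -> C) : C :=
  x (inr o1) * x (inl o2) + eps * x (inr o1) ^+ 2 + E x.

(** The two coordinates that label a Segre variety stay small compared with
    [delta]; the others must reach both the base point, of size [delta], and the
    origin. *)
Definition rS (s : V) : R :=
  match s with inl j | inr j => if j == o1 then delta / 16 else 3 * delta end.

(** The line of base points [(a, delta, 0, ..., 0)]. *)
Definition line (a : C) (j : 'I_n) : C :=
  if j == o1 then a else if j == o2 then rc delta else 0.

(** The base point labelled by the first coordinate of [x], paired with the
    antiholomorphic coordinates of [x], the first of them replaced by [u]. *)
Definition bz (x : V -> C) (u : C) : V -> C := fun s =>
  match s with
  | inl j => line (x (inl o1)) j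
  | inr j => if j == o1 then u else x (inr j)
  end.

Definition bb (x : V -> C) : V -> C := fun s =>
  match s with
  | inl j => line (x (inl o1)) j
  | inr j => line (x (inr o1)) j
  end.

Lemma rS_swp s : rS (swp s) = rS s. Proof. by case: s. Qed.
Lemma rS_ge0 s : 0 <= rS s.
Proof. by case: s => j /=; case: ifP => _; dlra. Qed.
Lemma rS_le s : rS s <= 3 * delta.
Proof. by case: s => j /=; case: ifP => _; have := d0; dlra. Qed.
Lemma rS_z1 x : polydisc rS x -> cmod (x (inl o1)) <= delta / 16.
Proof. exact: (fun h => h (inl o1)). Qed.
Lemma rS_xi1 x : polydisc rS x -> cmod (x (inr o1)) <= delta / 16.
Proof. exact: (fun h => h (inr o1)). Qed.

Lemma line_le a j c : cmod a <= c -> delta <= c -> cmod (line a j) <= c.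
Proof.
move=> ac dc; rewrite /line; case: ifP => // _; case: ifP => _.
  by rewrite cmodR gtr0_norm.
rewrite cmod0; dlra.
Qed.

Lemma bz_polydisc x u : polydisc rS x -> cmod u <= delta / 8 ->
  polydisc (fun=> 3 * delta) (bz x u).
Proof.
move=> hx hu [j|j] /=.
  by apply: line_le; have := rS_z1 hx; dlra.
case: ifP => _; first dlra.
exact: le_trans (hx (inr j)) (rS_le _).
Qed.

Lemma bb_polydisc x : polydisc rS x -> polydisc (fun=> 3 * delta) (bb x).
Proof.
move=> hx [j|j] /=; apply: line_le; [|dlra| |dlra].
  by have := rS_z1 hx; dlra.
by have := rS_xi1 hx; dlra.
Qed.

Lemma fC_bz x u : fC (bz x u) = rc delta * u + eps * u ^+ 2 + E (bz x u).
Proof. by rewrite /fC /= /line /= mulrC. Qed.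

Lemma fC_bb x :
  fC (bb x) = rc delta * x (inr o1) + eps * x (inr o1) ^+ 2 + E (bb x).
Proof. by rewrite /fC /= /line /= mulrC. Qed.

Lemma E_lip x x' : polydisc (fun=> 9 * delta) x ->
  polydisc (fun=> 9 * delta) x' ->
  cmod (E x - E x') <= e * delta * \sum_v cmod (x v - x' v).
Proof.
move=> hx hx'.
have hE' : hol (fun _ : V => 9 * delta + delta) (e * delta ^+ 2) E.
  by apply: hol_le hE => // _; dlra.
have r90 (v : V) : 0 <= 9 * delta by dlra.
apply: le_trans (hol_lip d0 r90 hE' hx hx') _.
rewrite ler_wpM2r//; first by apply: sumr_ge0 => v _; exact: cmod_ge0.
by rewrite expr2 mulrA mulfK// gt_eqF.
Qed.

Lemma sub39 x : polydisc (fun=> 3 * delta) x -> polydisc (fun _ : V => 9 * delta) x.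
Proof. by move=> hx v; apply: le_trans (hx v) _; dlra. Qed.

Lemma scaled_le (a c : R) : a <= c * delta ^+ 2 -> delta^-1 * a <= c * delta.
Proof.
move=> h; rewrite mulrC ler_pdivrMr//; apply: le_trans h _.
by rewrite expr2 mulrA.
Qed.

Lemma rc_dV : rc delta * rc delta^-1 = 1.
Proof. by rewrite -rmorphM divff ?gt_eqF// rmorph1. Qed.

Section HolomorphicSolution.

(** The equation [fC (bz x u) = fC (bb x)] solved for the [u] in its dominant
    term [delta u]. *)
Let PhiH (_ : unit) (y : unit + V -> C) : C :=
  let x := fun v => y (inr v) in let u := y (inl tt) in
  x (inr o1) + rc delta^-1 *
    (eps * (x (inr o1) ^+ 2 - u ^+ 2) + (E (bb x) - E (bz x u))).

Lemma PhiH_fix x u : PhiH tt (pairpt (fun=> u) x) = u <->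
  fC (bz x u) = fC (bb x).
Proof.
rewrite fC_bz fC_bb /PhiH /=; set s := x (inr o1).
set a := E (bz _ _); set b := E (bb _); have dd := rc_dV.
split=> h.
  have := congr1 (fun z => rc delta * z) h; rewrite mulrDr mulrA dd mul1r => {}h.
  by rewrite -h; ring.
have dn : rc delta != 0.
  by apply: contra_eqN dd => /eqP ->; rewrite mul0r eq_sym oner_eq0.
apply: (mulfI dn); rewrite mulrDr mulrA dd mul1r.
have -> : eps * (s ^+ 2 - u ^+ 2) + (b - a) =
  (rc delta * s + eps * s ^+ 2 + b) - (eps * u ^+ 2 + a) - rc delta * s by ring.
by rewrite -h; ring.
Qed.

Lemma hol_PhiH p : hol (pairpt (fun _ : unit => delta / 8) rS) (delta / 8) (PhiH p).
Proof.
set rr := pairpt _ _.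
have rr0 v : 0 <= rr v by case: v => [[]|v] /=; [dlra|exact: rS_ge0].
have vs := hol_var rr0 (inr (inr o1)).
have vz := hol_var rr0 (inr (inl o1)).
have vu := hol_var rr0 (inl tt).
have hl (v : V) K (j : 'I_n) : hol rr (rr (inr v)) (fun y => y (inr v)) ->
    rr (inr v) <= K -> delta <= K -> hol rr K (fun y => line (y (inr v)) j).
  move=> hv vK dK; rewrite /line; case: (j == o1); first exact: hol_leK vK hv.
  case: (j == o2); first by apply: hol_leK _ (hol_cst rr0 _); rewrite cmodR gtr0_norm.
  apply: hol_leK _ (hol_cst rr0 _); rewrite cmod0; dlra.
have r1 : rr (inr (inr o1)) = delta / 16 by [].
have r2 : rr (inr (inl o1)) = delta / 16 by [].
have hbb : hol rr (e * delta ^+ 2) (fun y => E (bb (fun v => y (inr v)))).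
  apply: (@hol_comp _ V _ (fun=> 10 * delta) rr _ E
    (fun s y => bb (fun v => y (inr v)) s)) => //.
  by move=> [j|j] /=; apply: hl => //; rewrite ?r1 ?r2; dlra.
have hbz : hol rr (e * delta ^+ 2)
    (fun y => E (bz (fun v => y (inr v)) (y (inl tt)))).
  apply: (@hol_comp _ V _ (fun=> 10 * delta) rr _ E
    (fun s y => bz (fun v => y (inr v)) (y (inl tt)) s)) => //.
  move=> [j|j] /=; first by apply: hl => //; rewrite ?r1 ?r2; dlra.
  case: (j == o1); first by apply: hol_leK _ vu => /=; dlra.
  by apply: hol_leK _ (hol_var rr0 (inr (inr j))); have := rS_le (inr j); rewrite /rr /=; dlra.
have := holD vs (holZ (rc delta^-1) (holD (holZ eps
   (holB (holM vs vs) (holM vu vu))) (holB hbb hbz))).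
apply: hol_leK; rewrite r1 [rr (inl tt)]/= cmodR gtr0_norm ?invr_gt0//.
suff : delta^-1 * (cmod eps * (delta / 16 * (delta / 16) + delta / 8 * (delta / 8)) +
   (e * delta ^+ 2 + e * delta ^+ 2)) <= (1 / 16) * delta by dlra.
apply: scaled_le.
have : cmod eps * (delta / 16 * (delta / 16) + delta / 8 * (delta / 8)) <=
  1 * (delta / 16 * (delta / 16) + delta / 8 * (delta / 8)).
  by rewrite ler_wpM2r// addr_ge0// mulr_ge0//; dlra.
have : e * delta ^+ 2 <= 1 / 1000 * delta ^+ 2 by rewrite ler_wpM2r// sqr_ge0.
have : 0 <= delta ^+ 2 by exact: sqr_ge0.
rewrite !expr2; dlra.
Qed.

Lemma PhiH_contr : contracting (fun _ : unit => delta / 8) rS PhiH.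
Proof.
move=> u u' x d hu hu' hx huu p; rewrite /PhiH /=.
set a := u tt; set b := u' tt.
have ha : cmod a <= delta / 8 by exact: hu.
have hb : cmod b <= delta / 8 by exact: hu'.
have hab : cmod (b - a) <= d by rewrite cmod_distC; exact: huu.
have d00 : 0 <= d by exact: le_trans (cmod_ge0 _) hab.
rewrite [X in cmod X](_ : _ = rc delta^-1 * (eps * ((b - a) * (b + a))
  + (E (bz x b) - E (bz x a)))); last by rewrite /a /b; ring.
rewrite (le_trans (cmodM _ _))// cmodR gtr0_norm ?invr_gt0//.
rewrite mulrC ler_pdivrMr//.
have h1 : cmod (eps * ((b - a) * (b + a))) <= 1 * (d * (delta / 4)).
  rewrite (le_trans (cmodM _ _))// ler_pM ?cmod_ge0// (le_trans (cmodM _ _))//.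
  rewrite ler_pM ?cmod_ge0// (le_trans (cmodD _ _))//; dlra.
have h2 : cmod (E (bz x b) - E (bz x a)) <= e * delta * d.
  apply: le_trans (E_lip _ _) _; try by apply: sub39; exact: bz_polydisc.
  rewrite ler_wpM2l ?mulr_ge0 ?(ltW d0)//.
  rewrite (bigD1 (inr o1))//= big1 ?addr0// => -[j|j] /=.
    by rewrite subrr cmod0.
  by rewrite (inj_eq inr_inj) => /negbTE ->; rewrite subrr cmod0.
have h3 : e * (delta * d) <= 1 / 1000 * (delta * d).
  by rewrite ler_wpM2r// mulr_ge0// ltW.
have h4 : 0 <= delta * d by rewrite mulr_ge0// ltW.
rewrite (le_trans (cmodD _ _))//; dlra.
Qed.

(** At scale [delta] the derivative of [fC] in [u] is [delta] up to a small
    error, as the square is restricted to small [u] and the third order terms of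
    [fC] are small. *)
Lemma segre_solution : exists2 H : (V -> C) -> C, hol rS (delta / 8) H &
  forall x, polydisc rS x -> forall u, cmod u <= delta / 8 ->
    (fC (bz x u) = fC (bb x) <-> u = H x).
Proof.
have [S hS Sfix] := fixpoint PhiH_contr rS_ge0 hol_PhiH.
exists (S tt) => // x hx u hu.
have Sx : cmod (S tt x) <= delta / 8 by exact: hol_bound (hS tt) hx.
have S1 : PhiH tt (pairpt (fun=> S tt x) x) = S tt x.
  have -> : (fun=> S tt x) = S^~ x by apply/funext => -[].
  exact: Sfix.
split=> [/PhiH_fix h|->]; last exact/PhiH_fix.
have := @fixpoint_unique _ _ _ _ _ _ PhiH_contr (fun=> u) (fun=> S tt x) x.
move=> /(_ (fun=> hu) (fun=> Sx) hx) E1.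
have /(congr1 (@^~ tt)) := E1 (fun p => match p with tt => h end)
  (fun p => match p with tt => S1 end).
by [].
Qed.

End HolomorphicSolution.

End Segre.

(** * The Segre variety through a given point *)

Section SegreInverse.
Context {R : realType} {n : nat} (hn : (2 <= n)%N).
Local Notation C := R[i].
Local Notation V := ('I_n + 'I_n)%type.
Local Notation o1 := (Ordinal (ltnW hn) : 'I_n).
Local Notation o2 := (Ordinal hn : 'I_n).
Local Notation rc := (real_complex R).

Variables (delta e : R) (eps : C) (E : (V -> C) -> C).
Hypothesis d0 : 0 < delta.
Hypothesis e0 : 0 <= e.
Hypothesis e1 : e <= 1 / 1000.
Hypothesis eps1 : cmod eps <= 1.
Hypothesis hE : hol (fun _ : V => 10 * delta) (e * delta ^+ 2) E.
Local Ltac dlra := have := d0; have := e0; have := e1; lra.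
Local Notation rS := (rS hn delta).
Local Notation line := (line hn delta).
Local Notation bz := (bz hn delta).
Local Notation bb := (bb hn delta).
Local Notation fC := (fC hn eps E).

Variable H : (V -> C) -> C.
Hypothesis hH : hol rS (delta / 8) H.
Hypothesis eqH : forall x, polydisc rS x -> forall u, cmod u <= delta / 8 ->
    (fC (bz x u) = fC (bb x) <-> u = H x).

(** Half of the label radius of [rS], so that the labels found here are
    admissible for [H]. *)
Definition rT (s : V) : R :=
  match s with inl j | inr j => if j == o1 then delta / 32 else 3 * delta end.

Definition repl (x : V -> C) (s sigma : C) : V -> C := fun v =>
  match v with
  | inl j => if j == o1 then s else x (inl j)
  | inr j => if j == o1 then sigma else x (inr j)
  end.

Lemma rT_swp s : rT (swp s) = rT s. Proof. by case: s. Qed.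
Lemma rT_ge0 s : 0 <= rT s.
Proof. by case: s => j /=; case: ifP => _; dlra. Qed.
Lemma rT_xi1 x : polydisc rT x -> cmod (x (inr o1)) <= delta / 32.
Proof. exact: (fun h => h (inr o1)). Qed.
Lemma repl_polydisc x s sigma : polydisc rT x -> cmod s <= delta / 16 ->
  cmod sigma <= delta / 16 -> polydisc rS (repl x s sigma).
Proof.
move=> hx hs hsg [j|j] /=; have := hx (inl j); have := hx (inr j) => /=;
  by case: ifP.
Qed.
Lemma sw_repl x s sigma : sw (repl x s sigma) = repl (sw x) (conjc sigma) (conjc s).
Proof. by apply/funext => -[j|j] /=; rewrite /sw /=; case: ifP. Qed.

(** The equation [H (repl x s sigma) = x (inr o1)] says that [x (inr o1)] solves
    the equation of the Segre variety with labels [s] and [sigma]. That equation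
    is explicit, and it is solved here for the [sigma] in its dominant term,
    without mention of [H]. *)
Let G (y : bool + V -> C) : C :=
  let x := fun v => y (inr v) in
  let xr := repl x (y (inl true)) (y (inl false)) in
  x (inr o1) - rc delta^-1 * (eps * (y (inl false) ^+ 2 - x (inr o1) ^+ 2)
     + (E (bb xr) - E (bz xr (x (inr o1))))).

Let swB (w : bool + V) : bool + V :=
  match w with inl b => inl (~~ b) | inr v => inr (swp v) end.

(** The labels [s] and [sigma] are exchanged by the reflection [sw], so the
    equation for [s] is the reflected equation for [sigma]. *)
Let PhiT (b : bool) (y : bool + V -> C) : C :=
  if b then conjc (G (fun w => conjc (y (swB w)))) else G y.

Lemma G_fix u x : polydisc rT x -> polydisc (fun _ : bool => delta / 16) u ->
  (G (pairpt u x) = u false <-> H (repl x (u true) (u false)) = x (inr o1)).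
Proof.
move=> hx hu; set xr := repl x (u true) (u false).
have hxr : polydisc rS xr by apply: repl_polydisc.
have hxi : cmod (x (inr o1)) <= delta / 8 by have := rT_xi1 hx; dlra.
have E1 := eqH hxr hxi.
suff : G (pairpt u x) = u false <-> fC (bz xr (x (inr o1))) = fC (bb xr).
  by move=> ->; rewrite E1; split.
rewrite (fC_bz hn) (fC_bb hn) /G /= -/xr.
set a := E (bz _ _); set b := E (bb _); have dd := rc_dV d0.
set s := u false; set z := x (inr o1).
split=> h.
  have := congr1 (fun z => rc delta * z) h; rewrite mulrBr mulrA dd mul1r => {}h.
  by rewrite -h; ring.
have dn : rc delta != 0.
  by apply: contra_eqN dd => /eqP ->; rewrite mul0r eq_sym oner_eq0.
apply: (mulfI dn); rewrite mulrBr mulrA dd mul1r.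
have -> : eps * (s ^+ 2 - z ^+ 2) + (b - a) =
  (rc delta * s + eps * s ^+ 2 + b) - (eps * z ^+ 2 + a) - rc delta * s by ring.
by rewrite -h; ring.
Qed.

Lemma swB_pairpt (u : bool -> C) (x : V -> C) : (fun w => conjc (pairpt u x (swB w)))
  = pairpt (fun b => conjc (u (~~ b))) (sw x).
Proof. by apply/funext => -[b|v]. Qed.

Lemma PhiT_fix u x : polydisc rT x -> polydisc (fun _ : bool => delta / 16) u ->
  (forall b, PhiT b (pairpt u x) = u b) <->
  H (repl x (u true) (u false)) = x (inr o1) /\
  star H (repl x (u true) (u false)) = x (inl o1).
Proof.
move=> hx hu.
have hu' : polydisc (fun _ : bool => delta / 16) (fun b => conjc (u (~~ b))).
  by move=> b; rewrite cmod_conj.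
have hx' := sw_polydisc rT_swp hx.
have F1 := G_fix hx hu; have F2 := G_fix hx' hu'.
rewrite /star sw_repl /=.
split=> [h|[h1 h2] [|]].
- split; first by apply/F1; exact: (h false).
  have := h true; rewrite /PhiT swB_pairpt => h2.
  have /F2 -> : G (pairpt (fun b => conjc (u (~~ b))) (sw x)) = conjc (u true).
    by rewrite -h2 conjcK.
  by rewrite /sw /= conjcK.
- rewrite /PhiT swB_pairpt; apply: (can_inj (@conjcK R)); rewrite conjcK.
  by apply/F2 => /=; rewrite -[LHS]conjcK h2.
- by apply/F1.
Qed.

Lemma hol_G : hol (pairpt (fun _ : bool => delta / 16) rT) (delta / 16) G.
Proof.
set rr := pairpt _ _.
have rr0 v : 0 <= rr v by case: v => [b|v] /=; [dlra|exact: rT_ge0].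
have vxi := hol_var rr0 (inr (inr o1)).
have vs := hol_var rr0 (inl true).
have vsg := hol_var rr0 (inl false).
have hl (K : R) (j : 'I_n) b : delta <= K ->
    hol rr K (fun y => line (y (inl b)) j).
  move=> dK; rewrite /line; case: (j == o1).
    by apply: hol_leK _ (hol_var rr0 (inl b)); rewrite /=; dlra.
  case: (j == o2); first by apply: hol_leK _ (hol_cst rr0 _); rewrite cmodR gtr0_norm.
  apply: hol_leK _ (hol_cst rr0 _); rewrite cmod0; dlra.
have hbb : hol rr (e * delta ^+ 2)
    (fun y => E (bb (repl (fun v => y (inr v)) (y (inl true)) (y (inl false))))).
  apply: (@hol_comp _ V _ (fun=> 10 * delta) rr _ E
    (fun s y => bb (repl (fun v => y (inr v)) (y (inl true)) (y (inl false))) s)) => //.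
  by move=> [j|j] /=; apply: hl; dlra.
have hbz : hol rr (e * delta ^+ 2) (fun y => E (bz (repl (fun v => y (inr v))
      (y (inl true)) (y (inl false))) (y (inr (inr o1))))).
  apply: (@hol_comp _ V _ (fun=> 10 * delta) rr _ E
    (fun s y => bz (repl (fun v => y (inr v)) (y (inl true)) (y (inl false)))
       (y (inr (inr o1))) s)) => //.
  move=> [j|j] /=; first by apply: hl; dlra.
  case: (j == o1); first by apply: hol_leK _ vxi => /=; dlra.
  apply: hol_leK _ (hol_var rr0 (inr (inr j))) => /=.
  by case: ifP => _; dlra.
have := holB vxi (holZ (rc delta^-1) (holD (holZ eps
   (holB (holM vsg vsg) (holM vxi vxi))) (holB hbb hbz))).
apply: hol_leK.
rewrite [rr (inl _)]/= [rr (inr _)](_ : _ = delta / 32)// cmodR gtr0_norm ?invr_gt0//.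
suff : delta^-1 * (cmod eps * (delta / 16 * (delta / 16) + delta / 32 * (delta / 32)) +
   (e * delta ^+ 2 + e * delta ^+ 2)) <= (1 / 32) * delta by lra.
apply: (scaled_le d0).
have : cmod eps * (delta / 16 * (delta / 16) + delta / 32 * (delta / 32)) <=
  1 * (delta / 16 * (delta / 16) + delta / 32 * (delta / 32)).
  by rewrite ler_wpM2r// addr_ge0// mulr_ge0//; dlra.
have : e * delta ^+ 2 <= 1 / 1000 * delta ^+ 2 by rewrite ler_wpM2r// sqr_ge0.
have : 0 <= delta ^+ 2 by exact: sqr_ge0.
rewrite !expr2; lra.
Qed.

Lemma sum_two (F : V -> R) d : (forall v, v != inl o1 -> v != inr o1 -> F v = 0) ->
  F (inl o1) <= d -> F (inr o1) <= d -> \sum_v F v <= d + d.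
Proof.
move=> F0 F1 F2; rewrite (bigD1 (inl o1))//= (bigD1 (inr o1))//= big1 ?addr0.
  exact: lerD.
by move=> v /andP[v1 v2]; exact: F0.
Qed.

Lemma G_contr (u u' : bool -> C) x d :
  polydisc (fun _ : bool => delta / 16) u ->
  polydisc (fun _ : bool => delta / 16) u' -> polydisc rT x ->
  (forall q, cmod (u q - u' q) <= d) ->
  cmod (G (pairpt u x) - G (pairpt u' x)) <= d / 2.
Proof.
move=> hu hu' hx huu; rewrite /G /=.
set xr := repl x (u true) _; set xr' := repl x (u' true) _.
have hxr : polydisc rS xr by apply: repl_polydisc.
have hxr' : polydisc rS xr' by apply: repl_polydisc.
have hxi : cmod (x (inr o1)) <= delta / 8 by have := rT_xi1 hx; dlra.
set a := u false; set b := u' false; set z := x (inr o1).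
have ha : cmod a <= delta / 16 by exact: hu.
have hb : cmod b <= delta / 16 by exact: hu'.
have hab : cmod (b - a) <= d by rewrite cmod_distC; exact: huu.
have d00 : 0 <= d by exact: le_trans (cmod_ge0 _) hab.
rewrite [X in cmod X](_ : _ = rc delta^-1 * (eps * ((b - a) * (b + a))
  + (E (bb xr') - E (bb xr)) - (E (bz xr' z) - E (bz xr z)))); last by ring.
rewrite (le_trans (cmodM _ _))// cmodR gtr0_norm ?invr_gt0//.
rewrite mulrC ler_pdivrMr//.
have h1 : cmod (eps * ((b - a) * (b + a))) <= 1 * (d * (delta / 8)).
  rewrite (le_trans (cmodM _ _))// ler_pM ?cmod_ge0// (le_trans (cmodM _ _))//.
  rewrite ler_pM ?cmod_ge0// (le_trans (cmodD _ _))//; dlra.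
have lineE c c' j : cmod (c - c') <= d -> cmod (line c j - line c' j) <= d.
  by rewrite /line; case: ifP => // _; rewrite subrr cmod0.
have line0 c c' j : j != o1 -> line c j - line c' j = 0.
  by rewrite /line => /negbTE ->; rewrite subrr.
have hd q : cmod (u' q - u q) <= d by rewrite cmod_distC; exact: huu.
have inlI (j : 'I_n) : (inl j != inl o1 :> V) = (j != o1) by [].
have inrI (j : 'I_n) : (inr j != inr o1 :> V) = (j != o1) by [].
have h2 : cmod (E (bb xr') - E (bb xr)) <= e * delta * (d + d).
  apply: le_trans (E_lip d0 e0 e1 hE _ _) _;
    try by apply: (sub39 d0 e0 e1); exact: (bb_polydisc d0 e0 e1).
  rewrite ler_wpM2l ?mulr_ge0 ?(ltW d0)//.
  apply: sum_two; [|exact: hd|exact: hd].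
  by move=> [j|j]; rewrite ?inlI ?inrI /= => n1 n2; rewrite line0 ?cmod0.
have h3 : cmod (E (bz xr' z) - E (bz xr z)) <= e * delta * (d + d).
  apply: le_trans (E_lip d0 e0 e1 hE _ _) _;
    try by apply: (sub39 d0 e0 e1); exact: (bz_polydisc d0 e0 e1).
  rewrite ler_wpM2l ?mulr_ge0 ?(ltW d0)//.
  apply: sum_two; [|exact: hd|by rewrite /= subrr cmod0].
  move=> [j|j]; rewrite ?inlI ?inrI /= => n1 n2; first by rewrite line0 ?cmod0.
  by rewrite (negbTE n2) subrr cmod0.
have h4 : e * (delta * d) <= 1 / 1000 * (delta * d).
  by rewrite ler_wpM2r// mulr_ge0// ltW.
have h5 : 0 <= delta * d by rewrite mulr_ge0// ltW.
have := cmodB (eps * ((b - a) * (b + a)) + (E (bb xr') - E (bb xr)))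
   (E (bz xr' z) - E (bz xr z)).
have := cmodD (eps * ((b - a) * (b + a))) (E (bb xr') - E (bb xr)).
lra.
Qed.

Lemma PhiT_contr : contracting (fun _ : bool => delta / 16) rT PhiT.
Proof.
move=> u u' x d hu hu' hx huu [|]; rewrite /PhiT; last exact: G_contr.
rewrite !swB_pairpt -conjcN -conjcD cmod_conj; apply: G_contr.
- by move=> b; rewrite cmod_conj.
- by move=> b; rewrite cmod_conj.
- exact: sw_polydisc rT_swp hx.
- by move=> q; rewrite -conjcN -conjcD cmod_conj.
Qed.

(** Every point close to the origin lies on exactly one of the varieties, and
    their labels depend holomorphically on the point. *)
Lemma segre_inverse : exists Ts Tsg : (V -> C) -> C,
  [/\ hol rT (delta / 16) Ts, hol rT (delta / 16) Tsg
    & forall x, polydisc rT x -> forall s sigma,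
        cmod s <= delta / 16 -> cmod sigma <= delta / 16 ->
        (H (repl x s sigma) = x (inr o1) /\ star H (repl x s sigma) = x (inl o1))
        <-> (s = Ts x /\ sigma = Tsg x)].
Proof.
have hPhi b : hol (pairpt (fun _ : bool => delta / 16) rT) (delta / 16) (PhiT b).
  case: b; rewrite /PhiT; last exact: hol_G.
  apply: (@hol_star_perm _ _ swB _ _ _ _ hol_G).
  by move=> [b|v] //=; rewrite rT_swp.
have [S hS Sfix] := fixpoint PhiT_contr rT_ge0 hPhi.
exists (S true), (S false); split=> // x hx s sigma hs hsg.
have hSx : polydisc (fun _ : bool => delta / 16) (S^~ x).
  by move=> b; exact: hol_bound (hS b) hx.
have [/(_ (Sfix x hx)) [T1 T2] _] := PhiT_fix hx hSx.
split=> [[h1 h2]|[-> ->]//].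
pose u (b : bool) := if b then s else sigma.
have hu : polydisc (fun _ : bool => delta / 16) u by case.
have [_ /(_ (conj h1 h2)) uf] := PhiT_fix hx hu.
have := fixpoint_unique PhiT_contr hu hSx hx uf (Sfix x hx) => E1.
by split; [have /(congr1 (@^~ true)) := E1|have /(congr1 (@^~ false)) := E1].
Qed.

End SegreInverse.

(** * Segre varieties are complex tangent *)

Lemma rc2 (R : realType) : real_complex R 2 = 2.
Proof. by rewrite rmorphMn rmorph1. Qed.

Section SegreLeaves.
Context {R : realType} {n : nat} (hn : (2 <= n)%N).
Local Notation C := R[i].
Local Notation V := ('I_n + 'I_n)%type.
Local Notation o1 := (Ordinal (ltnW hn) : 'I_n).
Local Notation o2 := (Ordinal hn : 'I_n).
Local Notation rc := (real_complex R).

Variables (delta e : R) (eps : C) (E : (V -> C) -> C).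
Hypothesis d0 : 0 < delta.
Hypothesis e0 : 0 <= e.
Hypothesis e1 : e <= 1 / 1000.
Hypothesis eps1 : cmod eps <= 1.
Local Ltac dlra := have := d0; have := e0; have := e1; lra.
Local Notation rS := (rS hn delta).
Local Notation line := (line hn delta).
Local Notation bz := (bz hn delta).
Local Notation bb := (bb hn delta).
Local Notation fC := (fC hn eps E).

Variable H : (V -> C) -> C.
Hypothesis hH : hol rS (delta / 8) H.
Hypothesis eqH : forall x, polydisc rS x -> forall u, cmod u <= delta / 8 ->
    (fC (bz x u) = fC (bb x) <-> u = H x).

Variables (K : R) (Df : V -> (V -> C) -> C) (D2 : 'I_n -> V -> (V -> C) -> C).
Hypothesis hDf : forall v, hol (fun=> 9 * delta) K (Df v).
Hypothesis gDf : isgrad (fun=> 9 * delta) fC Df.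
Hypothesis hD2 : forall k v, hol (fun=> 8 * delta) K (D2 k v).
Hypothesis gD2 : forall k, isgrad (fun=> 8 * delta) (Df (inr k)) (D2 k).
Local Notation A := (Df (inr o1)).
Local Notation B := (fun k => Df (inr k)).
Hypothesis A_approx : forall x, polydisc (fun=> 9 * delta) x ->
  cmod (A x - (x (inl o2) + 2 * eps * x (inr o1))) <= 3 * e * delta.

(** The Levi form of the graph on the fields with components [conj A e_j - conj
    B_j e_1], which span the tangent vectors of type (1,0) where [A <> 0].
    Conjugates are written with [star], to make it a holomorphic function of [z]
    and [xi]. *)
Definition levi_form (j k : 'I_n) (x : V -> C) : C :=
  star A x * A x * D2 k (inl j) x - star A x * B k x * D2 o1 (inl j) x
  - star (B j) x * A x * D2 k (inl o1) x
  + star (B j) x * B k x * D2 o1 (inl o1) x.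

Hypothesis levi0 : forall x, polydisc (fun=> 8 * delta) x -> sw x = x ->
  A x != 0 -> forall j k, levi_form j k x = 0.

Lemma K_ge0 : 0 <= K. Proof. exact: hol_K0 (hDf (inr o1)). Qed.

(** The real points form a set of uniqueness: [y] is the value at [c = i] of a
    complex line [a + c b] on which real [c] give real points. The factor [A]
    takes care of the points where the Levi form is not known to vanish. *)
Lemma levi_complex j k y : polydisc (fun=> 3 * delta) y -> A y != 0 ->
  levi_form j k y = 0.
Proof.
move=> hy Ay.
have hB v : hol (fun _ : V => 8 * delta) K (Df v).
  by apply: hol_le (hDf v) => // _; dlra.
have hsB v : hol (fun _ : V => 8 * delta) K (star (Df v)).
  exact: hol_star (hB v).
have hL : exists K', hol (fun _ : V => 8 * delta) K' (fun x => A x * levi_form j k x).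
  eexists; apply: holM (hB _) _; apply: holD; last first.
    by apply: holM; [apply: holM; [exact: hsB|exact: hB]|exact: hD2].
  apply: holB; last first.
    by apply: holM; [apply: holM; [exact: hsB|exact: hB]|exact: hD2].
  apply: holB.
    by apply: holM; [apply: holM; [exact: hsB|exact: hB]|exact: hD2].
  by apply: holM; [apply: holM; [exact: hsB|exact: hB]|exact: hD2].
have [K' hL'] := hL.
(* the number 1 / (2 i): a and b are the real and imaginary parts of y for the
   reflection sw *)
pose i2 : C := Complex 0 (- (1 / 2)).
pose a v := rc (1 / 2) * (y v + sw y v).
pose b v := i2 * (y v - sw y v).
have hsy : polydisc (fun=> 3 * delta) (sw y) by exact: sw_polydisc hy.
have ab v : cmod (a v) + 5 / 3 * cmod (b v) <= 8 * delta.
  have half0 : 0 <= 1 / 2 :> R by lra.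
  have i2n : cmod i2 = 1 / 2.
    by rewrite /cmod /= normr0 add0r normrN ger0_norm.
  have h1 : cmod (a v) <= 1 / 2 * (3 * delta + 3 * delta).
    rewrite (le_trans (cmodM _ _))// cmodR (ger0_norm half0) ler_wpM2l//.
    by rewrite (le_trans (cmodD _ _))// lerD.
  have h2 : cmod (b v) <= 1 / 2 * (3 * delta + 3 * delta).
    rewrite (le_trans (cmodM _ _))// i2n ler_wpM2l//.
    by rewrite (le_trans (cmodB _ _))// lerD.
  lra.
have i2c : conjc i2 = - i2 by rewrite /i2; apply: complex_ext; rewrite /= ?oppr0.
have rcc (t : R) : conjc (rc t) = rc t by apply: complex_ext; rewrite /= ?oppr0.
have rl (t : R) : sw (fun v => a v + rc t * b v) = (fun v => a v + rc t * b v).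
  apply/funext => v; rewrite /sw /a /b /sw !swpK !(conjcD, conjcM, conjcN) !rcc i2c.
  by rewrite !conjcK; ring.
have := identity_line hL' ab ltr01.
have abt (t : R) : 0 < t -> t <= 1 ->
    polydisc (fun=> 8 * delta) (fun v => a v + rc t * b v).
  move=> t0 t1 v; apply: le_trans (ab v).
  rewrite (le_trans (cmodD _ _))// lerD2l (le_trans (cmodM _ _))// cmodR.
  rewrite gtr0_norm// ler_wpM2r ?cmod_ge0//; lra.
have z0 (t : R) : 0 < t -> t <= 1 ->
    A (fun v => a v + rc t * b v) * levi_form j k (fun v => a v + rc t * b v) = 0.
  move=> t0 t1; have [->|An] := eqVneq (A (fun v => a v + rc t * b v)) 0.
    by rewrite mul0r.
  by rewrite levi0 ?mulr0//; exact: abt.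
move=> /(_ z0 (Complex 0 1)) W.
have ye : (fun v => a v + Complex 0 1 * b v) = y.
  apply/funext => v; rewrite /a /b mulrA.
  have -> : Complex 0 1 * i2 = rc (1 / 2).
    by apply: complex_ext; rewrite /= ?(mul0r, mulr0, mul1r, sub0r, addr0, opprK).
  rewrite [LHS](_ : _ = rc (1 / 2) * 2 * y v); last by ring.
  have -> : rc (1 / 2) * 2 = 1.
    by rewrite -rc2 -rmorphM mul1r mulVf// rmorph1.
  by rewrite mul1r.
have /eqP : A y * levi_form j k y = 0.
  rewrite -ye; apply: W.
  by rewrite /cmod /= normr0 add0r normr1; lra.
by rewrite mulf_eq0 (negbTE Ay) => /eqP.
Qed.

(** The point of C^n x C^n on the two Segre varieties labelled by [x]. *)
Definition Psi (x : V -> C) : V -> C := repl hn x (star H x) (H x).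
(** The same variety in [xi], paired with its base point. *)
Definition Pt (x : V -> C) : V -> C := bz x (H x).
(** The failure of the gradients in [xi] at [Psi x] and at [Pt x] to be
    proportional. The gradient at [Pt x] is the conormal of the variety, that at
    [Psi x] is the conormal of [T^c]. *)
Definition defect (k : 'I_n) (x : V -> C) : C :=
  B k (Psi x) * A (Pt x) - A (Psi x) * B k (Pt x).

Lemma H_le x : polydisc rS x -> cmod (H x) <= delta / 8.
Proof. exact: hol_bound hH. Qed.

Lemma sw_rS x : polydisc rS x -> polydisc rS (sw x).
Proof. exact: sw_polydisc (@rS_swp _ _ hn delta). Qed.

Lemma starH_le x : polydisc rS x -> cmod (star H x) <= delta / 8.
Proof. by move=> hx; rewrite /star cmod_conj H_le//; exact: sw_rS. Qed.

Lemma Pt_polydisc x : polydisc rS x -> polydisc (fun=> 3 * delta) (Pt x).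
Proof. by move=> hx; apply: (bz_polydisc d0 e0 e1) => //; exact: H_le. Qed.

Lemma Psi_polydisc x : polydisc rS x -> polydisc (fun=> 3 * delta) (Psi x).
Proof.
move=> hx [j|j] /=; case: ifP => _.
- by have := starH_le hx; dlra.
- exact: le_trans (hx (inl j)) (rS_le hn d0 e0 e1 _).
- by have := H_le hx; dlra.
- exact: le_trans (hx (inr j)) (rS_le hn d0 e0 e1 _).
Qed.

Lemma sw_Psi x : sw (Psi x) = Psi (sw x).
Proof. by rewrite /Psi sw_repl /star swK conjcK. Qed.

Lemma p39 (x : V -> C) : polydisc (fun=> 3 * delta) x -> polydisc (fun=> 9 * delta) x.
Proof. exact: (sub39 d0 e0 e1). Qed.

Lemma A_near y c : polydisc (fun=> 3 * delta) y -> cmod (y (inr o1)) <= delta / 8 ->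
  cmod (y (inl o2) - rc delta) <= c -> cmod (A y - rc delta) <= delta / 2 - delta / 5 + c.
Proof.
move=> hy y1 y2; have := A_approx (p39 hy) => h.
rewrite [X in cmod X](_ : _ = (A y - (y (inl o2) + 2 * eps * y (inr o1)))
  + (y (inl o2) - rc delta) + 2 * eps * y (inr o1)); last by ring.
have h3 : cmod (2 * eps * y (inr o1)) <= 2 * 1 * (delta / 8).
  rewrite (le_trans (cmodM _ _))// ler_pM ?cmod_ge0// (le_trans (cmodM _ _))//.
  by rewrite ler_pM ?cmod_ge0// -rc2 cmodR ger0_norm.
have h4 : e * delta <= 1 / 1000 * delta by rewrite ler_wpM2r// ltW.
have := cmodD (A y - (y (inl o2) + 2 * eps * y (inr o1)) + (y (inl o2) - rc delta))
  (2 * eps * y (inr o1)).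
have := cmodD (A y - (y (inl o2) + 2 * eps * y (inr o1))) (y (inl o2) - rc delta).
dlra.
Qed.

Lemma near_delta_inv a : cmod (a - rc delta) <= delta / 2 ->
  a != 0 /\ cmod a^-1 <= 4 / delta.
Proof.
move=> ha; have re : delta / 2 <= complex.Re a.
  have := le_trans (Re_le_cmod _) ha; rewrite cReD cReN /= ler_norml => /andP[h _].
  by have := d0; lra.
have a0 : a != 0.
  apply: contraTneq re => ->; rewrite /= -ltNge; have := d0; lra.
split=> //.
case: a re {ha a0} => p q /= re.
have p0 : 0 < p by have := d0; lra.
have q2 : 0 < p ^+ 2 + q ^+ 2 by rewrite ltr_pwDl ?sqr_ge0// exprn_gt0.
rewrite /cmod /= normrN !normrM (gtr0_norm p0).
have iN : 0 < (p ^+ 2 + q ^+ 2)^-1 by rewrite invr_gt0.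
rewrite (gtr0_norm iN) -mulrDl ler_pdivrMr// mulrAC ler_pdivlMr//.
have : 0 <= (p - `|q|) ^+ 2 by exact: sqr_ge0.
have -> : q ^+ 2 = `|q| ^+ 2 by rewrite real_normK ?num_real.
have qq : 0 <= `|q| by [].
have : delta * (p + `|q|) <= 2 * p * (p + `|q|).
  by rewrite ler_wpM2r ?addr_ge0 ?(ltW p0)//; lra.
rewrite sqrrB !expr2; nra.
Qed.

Lemma A_Pt x : polydisc rS x -> A (Pt x) != 0 /\ cmod (A (Pt x))^-1 <= 4 / delta.
Proof.
move=> hx; apply: near_delta_inv.
have := @A_near (Pt x) 0 (Pt_polydisc hx) (H_le hx).
rewrite /= /line /= subrr cmod0 => /(_ (lexx _)); dlra.
Qed.

Lemma A_Psi x : polydisc rS x -> cmod (x (inl o2) - rc delta) <= delta / 5 ->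
  A (Psi x) != 0 /\ cmod (A (Psi x))^-1 <= 4 / delta.
Proof.
move=> hx hx2; apply: near_delta_inv.
have := @A_near (Psi x) (delta / 5) (Psi_polydisc hx) (H_le hx) hx2.
dlra.
Qed.

Definition rH (s : V) : R :=
  match s with inl j | inr j => if j == o1 then delta / 32 else 2 * delta end.

Lemma rH_ge0 s : 0 <= rH s.
Proof. by case: s => j /=; case: ifP => _; dlra. Qed.
Lemma rH_rS s : rH s + delta / 32 <= rS s.
Proof. by case: s => j /=; case: ifP => _; dlra. Qed.
Lemma rHS x : polydisc rH x -> polydisc rS x.
Proof.
move=> hx s; apply: le_trans (hx s) _; apply: le_trans (rH_rS s).
by rewrite lerDl; dlra.
Qed.

(** Differentiate [fC (bz x (H x)) = fC (bb x)] along a curve of constant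
    labels, where the right-hand side is constant. *)
Lemma H_cder (g : V -> R -> C) t0 d : (forall v, cder (g v) t0 (d v)) ->
  polydisc rH (fun v => g v t0) ->
  (forall t, g (inl o1) t = g (inl o1) t0) ->
  (forall t, g (inr o1) t = g (inr o1) t0) ->
  exists2 dH, cder (fun t => H (fun v => g v t)) t0 dH &
    A (Pt (fun v => g v t0)) * dH
      + \sum_(k | k != o1) d (inr k) * B k (Pt (fun v => g v t0)) = 0.
Proof.
move=> gd hg cs csg.
have h0 : 0 < delta / 32 by dlra.
have hH' : hol (fun v => rH v + delta / 32) (delta / 8) H.
  apply: hol_le hH => // v; last exact: rH_rS.
  by have := rH_ge0 v; dlra.
have [DH _ gH] := hol_grad h0 rH_ge0 hH'.
have gHd := gH g t0 d gd hg.
set dH := \sum_v _ in gHd; exists dH => //.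
pose gb (s : V) (t : R) : C := bz (fun v => g v t) (H (fun v => g v t)) s.
pose db (s : V) : C := match s with inl j => 0 | inr j => if j == o1 then dH else d (inr j) end.
have gbd s : cder (gb s) t0 (db s).
  rewrite /gb /db; case: s => j /=.
    rewrite /line; under eq_fun do rewrite cs.
    exact: cder_cst.
  by case: (j == o1); [exact: gHd|exact: gd].
have hPt := p39 (Pt_polydisc (rHS hg)).
have := gDf gbd hPt.
rewrite big_sumType /= big1 ?add0r; last by move=> i _; rewrite mul0r.
rewrite (bigD1 o1)//= => h1.
have h2 : cder (fun t => fC (gb^~ t)) t0 0.
  apply: (@cder_ext _ (fun=> fC (bb (fun v => g v t0)))); last exact: cder_cst.
  have : \forall t \near t0, polydisc (fun v => rH v + delta / 32) (g^~ t).
    exact: (@near_polydisc _ _ (nbhs t0) _ V rH (delta / 32) (fun t v => g v t) _ h0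
      (fun v => cder_clim (gd v)) hg).
  apply: filterS => t ht.
  have htS : polydisc rS (g^~ t) by move=> v; exact: le_trans (ht v) (rH_rS v).
  have -> : bb (g^~ t0) = bb (g^~ t).
    by apply/funext => -[j|j] /=; rewrite -?cs -?csg ?(cs t) ?(csg t).
  by apply/esym/(eqH htS (H_le htS)).
rewrite -[RHS](cder_unique h1 h2); congr (_ + _); first by rewrite mulrC.
by apply: eq_bigr => k /negbTE ->.
Qed.

Lemma starH_cder (g : V -> R -> C) t0 d : (forall v, cder (g v) t0 (d v)) ->
  polydisc rH (fun v => g v t0) ->
  (forall t, g (inl o1) t = g (inl o1) t0) ->
  (forall t, g (inr o1) t = g (inr o1) t0) ->
  exists2 w, cder (fun t => star H (fun v => g v t)) t0 w &
    conjc (A (Pt (sw (fun v => g v t0)))) * w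
      + \sum_(k | k != o1) d (inl k) * conjc (B k (Pt (sw (fun v => g v t0)))) = 0.
Proof.
move=> gd hg cs csg.
have := @H_cder (fun v t => conjc (g (swp v) t)) t0 (fun v => conjc (d (swp v))).
case.
- by move=> v; exact: cder_conj.
- apply: (@sw_polydisc _ _ rH) hg; by case.
- by move=> t /=; rewrite csg.
- by move=> t /=; rewrite cs.
move=> dH h1 h2; exists (conjc dH); first exact: cder_conj h1.
have := congr1 (@conjc R) h2; rewrite conjcD conjcM.
rewrite conjc_sum => h3.
rewrite -[RHS]conjc0 -h3; congr (_ + _); apply: eq_bigr => k _.
by rewrite conjcM conjcK.
Qed.

Definition bp (s : V) : C := match s with inl j | inr j => line 0 j end.
Definition near_bp (eta : R) (x : V -> C) := forall s, cmod (x s - bp s) <= eta * delta.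

Lemma bp_le s : cmod (bp s) <= delta.
Proof. by case: s => j; apply: (line_le hn d0 e0 e1) => //; rewrite cmod0 ltW. Qed.

Lemma sw_bp : sw bp = bp.
Proof.
apply/funext => -[j|j]; rewrite /sw /= /line;
  case: (j == o1); try case: (j == o2);
  by apply: complex_ext; rewrite /= ?oppr0.
Qed.

Section NearBase.
Variable eta : R.
Hypothesis eta0 : 0 <= eta.
Hypothesis eta1 : eta <= 1 / 64.

Lemma eta_le : eta * delta <= delta / 64.
Proof. have := ler_wpM2r (ltW d0) eta1; lra. Qed.

Lemma near_bp_rH x : near_bp eta x -> polydisc rH x.
Proof.
have he := eta_le.
move=> hx s; have h1 := hx s; have h2 := bp_le s.
have h3 : cmod (x s) <= eta * delta + cmod (bp s).
  rewrite [X in cmod X](_ : _ = (x s - bp s) + bp s); last by ring.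
  by rewrite (le_trans (cmodD _ _))// lerD2r.
case: s h1 h2 h3 => j /=; rewrite /line; case: ifP => _ h1 h2 h3.
- by move: h3; rewrite cmod0; dlra.
- dlra.
- by move: h3; rewrite cmod0; dlra.
- dlra.
Qed.

Lemma near_bp_sw x : near_bp eta x -> near_bp eta (sw x).
Proof.
move=> hx s; rewrite -sw_bp /sw -conjcN -conjcD cmod_conj; exact: hx.
Qed.

Lemma near_bp_o2 x : near_bp eta x -> cmod (x (inl o2) - rc delta) <= delta / 5.
Proof. by move=> /(_ (inl o2)); rewrite /= /line /=; have := eta_le; dlra. Qed.

Definition pv (x : V -> C) (j : 'I_n) : C := if j == o1 then 0 else x (inl j) - bp (inl j).
(** A path in the variety of [z], at constant label and constant [xi], from the
    base point with the label of [x], at time 0, to [x], at time 1. *)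
Definition px (x : V -> C) (s : V) (t : R) : C :=
  match s with inl j => x (inl j) + rc (t - 1) * pv x j | inr j => x (inr j) end.

Lemma pv_le x j : near_bp eta x -> cmod (pv x j) <= eta * delta.
Proof.
move=> hx; rewrite /pv; case: ifP => _; last exact: hx.
by rewrite cmod0 mulr_ge0// ltW.
Qed.

Lemma px_near x (t : R) : near_bp eta x -> 0 <= t <= 1 -> near_bp eta (fun s => px x s t).
Proof.
move=> hx /andP[t0 t1] [j|j] /=; last exact: hx.
rewrite /pv; case: eqP => [->|_].
  by rewrite mulr0 addr0; exact: hx.
have -> : x (inl j) + rc (t - 1) * (x (inl j) - bp (inl j)) - line 0 j
  = rc t * (x (inl j) - bp (inl j)) by rewrite rmorphB rmorph1 /=; ring.
rewrite (le_trans (cmodM _ _))// cmodR ger0_norm// -[leRHS]mul1r.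
by rewrite ler_pM// ?cmod_ge0//; exact: hx.
Qed.

Lemma px_o1l x t : px x (inl o1) t = x (inl o1).
Proof. by rewrite /= /pv eqxx mulr0 addr0. Qed.

Lemma px1 x : (fun s => px x s 1) = x.
Proof. by apply/funext => -[j|j] //=; rewrite subrr mul0r addr0. Qed.

Lemma H_px x t : near_bp eta x -> polydisc rS (fun s => px x s t) ->
  H (fun s => px x s t) = H x.
Proof.
move=> hx hX; have hxS := rHS (near_bp_rH hx).
have e2 u : bz (fun s => px x s t) u = bz x u.
  by apply/funext => -[j|j] //=; congr (line _ _); exact: px_o1l.
have e3 : bb (fun s => px x s t) = bb x.
  by apply/funext => -[j|j] //=; congr (line _ _); exact: px_o1l.
have [_ W] := eqH hxS (H_le hxS).
have [W2 _] := eqH hX (H_le hxS).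
by rewrite -W2// e2 e3; exact: W.
Qed.

Lemma Pt_px x t : near_bp eta x -> polydisc rS (fun s => px x s t) -> Pt (fun s => px x s t) = Pt x.
Proof.
move=> hx hX; rewrite /Pt H_px//.
by apply/funext => -[j|j] //=; congr (line _ _); exact: px_o1l.
Qed.

(** The variety passes through its own base point: there [Psi] and [Pt]
    coincide. *)
Lemma defect_px0 k x : near_bp eta x -> defect k (fun s => px x s 0) = 0.
Proof.
move=> hx; have h01 : (0 : R) <= 0 <= (1 : R) by rewrite lexx ler01.
have hX := near_bp_rH (px_near hx h01).
set y := fun s => px x s 0 in hX *.
have yl j : j != o1 -> y (inl j) = line 0 j.
  by move=> /negbTE jo; rewrite /y /= /pv jo sub0r rmorphN1 /=; ring.
have yo : y (inl o1) = x (inl o1) by exact: px_o1l.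
have sHy : star H y = x (inl o1).
  have hsX := sw_rS (rHS hX).
  have hu : cmod (conjc (x (inl o1))) <= delta / 8.
    by rewrite cmod_conj -yo; have := hX (inl o1); rewrite /=; dlra.
  have [W _] := eqH hsX hu.
  rewrite /star -W ?conjcK//; congr fC; apply/funext => -[j|j] //.
  change ((if j == o1 then conjc (x (inl o1)) else conjc (y (inl j)))
    = line (conjc (y (inl o1))) j).
  rewrite yo; case: (eqVneq j o1) => [->|jo]; first by rewrite /line eqxx.
  rewrite yl//; have := congr1 (@^~ (inr j)) sw_bp; rewrite /sw /= => ->.
  by rewrite /line (negbTE jo).
suff E1 : Psi y = Pt y by rewrite /defect E1 mulrC subrr.
apply/funext => -[j|j] //.
change ((if j == o1 then star H y else y (inl j)) = line (y (inl o1)) j).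
rewrite sHy yo; case: (eqVneq j o1) => [->|jo]; first by rewrite /line eqxx.
by rewrite yl// /line (negbTE jo).
Qed.

(** By the vanishing of the Levi form, the derivative of a defect along [px] is,
    up to factors bounded away from 0, a combination of defects at points of the
    path and at their reflections. Integrating from the base point, where the
    defect is zero, multiplies any bound by a constant times the length of the
    path. *)
Lemma gronwall_step (S : R) : 0 <= S ->
  (forall x k, near_bp eta x -> cmod (defect k x) <= S) ->
  forall x k, near_bp eta x ->
    cmod (defect k x) <= eta * (n%:R * (2 * (4 / delta) ^+ 3 * delta * (4 * K ^+ 3))) * S.
Proof.
move=> S0 hS x k hx.
have K0 := K_ge0.
pose X t := fun s => px x s t.
have key (t : R) : 0 <= t <= 1 -> exists2 d, cder (fun t => defect k (X t)) t d &
    cmod d <= eta * (n%:R * ((4 / delta) ^+ 3 * delta * (4 * K ^+ 3))) * S.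
  move=> ht.
  have hX := px_near hx ht; rewrite -/(X t) in hX.
  have hXH := near_bp_rH hX; have hXS := rHS hXH.
  pose dX (s : V) : C := match s with inl j => pv x j | inr j => 0 end.
  have gdX s : cder (px x s) t (dX s).
    case: s => j /=; last exact: cder_cst.
    rewrite -[pv x j]add0r; apply: cderD; first exact: cder_cst.
    rewrite -[X in cder _ _ X]mul1r -[X in cder _ _ X]addr0 -(mulr0 (rc (t - 1))).
    apply: cderM; last exact: cder_cst.
    apply: (@cder_eq _ (fun u => rc u + -1)) => [u|].
      by rewrite rmorphB rmorph1.
    by have := cderD (cder_id t) (cder_cst (-1) t); rewrite addr0.
  have [w hw ew] := starH_cder gdX hXH (fun t => etrans (px_o1l _ _) (esym (px_o1l _ _))) (fun t => erefl).
  rewrite -/(X t) in hw ew.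
  pose y := Psi (X t); pose P := Pt x.
  have hy : polydisc (fun=> 3 * delta) y by exact: Psi_polydisc.
  have hxS := rHS (near_bp_rH hx).
  have hP : polydisc (fun=> 3 * delta) P by exact: Pt_polydisc.
  have hsX := sw_rS hXS.
  have hPs := Pt_polydisc hsX.
  pose dy (s : V) : C := match s with
    inl j => if j == o1 then w else pv x j | inr j => 0 end.
  pose yc (s : V) (u : R) : C := match s with
    | inl j => if j == o1 then star H (X u) else px x (inl j) u
    | inr j => if j == o1 then H x else x (inr j) end.
  have gy s : cder (yc s) t (dy s).
    case: s => j; rewrite /yc /dy; last by case: (j == o1); exact: cder_cst.
    by case: (j == o1); [exact: hw|exact: (gdX (inl j))].
  have ycE u : polydisc rS (X u) -> (fun s => yc s u) = Psi (X u).
    move=> hu; apply/funext => -[j|j] //.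
    by change ((if j == o1 then H x else x (inr j)) =
      (if j == o1 then H (X u) else x (inr j))); rewrite H_px.
  have yct := ycE t hXS; rewrite -/y in yct.
  have hy8 : polydisc (fun=> 8 * delta) (fun s => yc s t).
    by rewrite yct => s; apply: le_trans (hy s) _; dlra.
  have dB k' : cder (fun u => B k' (fun s => yc s u)) t
     (w * D2 k' (inl o1) y + \sum_(j | j != o1) pv x j * D2 k' (inl j) y).
    have := gD2 k' gy hy8; rewrite yct big_sumType /= [X in _ + X]big1 ?addr0; last first.
      by move=> i _; rewrite mul0r.
    rewrite (bigD1 o1)//=; congr (cder _ _ (_ + _)).
    by apply: eq_bigr => j /negbTE ->.
  have h320 : 0 < delta / 32 by dlra.
  have nX : \forall u \near t, polydisc rS (X u).
    have : \forall u \near t, polydisc (fun v => rH v + delta / 32) (X u).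
      exact: (@near_polydisc _ _ (nbhs t) _ V rH (delta / 32) (fun u => X u) _ h320
        (fun v => cder_clim (gdX v)) hXH).
    by apply: filterS => u hu v; exact: le_trans (hu v) (rH_rS v).
  pose A0 := A P; pose B0 := B k P.
  pose d := (w * D2 k (inl o1) y + \sum_(j | j != o1) pv x j * D2 k (inl j) y) * A0
    - (w * D2 o1 (inl o1) y + \sum_(j | j != o1) pv x j * D2 o1 (inl j) y) * B0.
  have hd : cder (fun u => defect k (X u)) t d.
    apply: (@cder_ext _ (fun u => B k (yc^~ u) * A0 - A (yc^~ u) * B0)).
      apply: filterS nX => u hu.
      by rewrite /defect (ycE u hu) /A0 /B0 /P -(Pt_px hx hu).
    apply: cderD.
      have := cderM (dB k) (cder_cst A0 t); by rewrite mulr0 addr0.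
    apply: cderN; have := cderM (dB o1) (cder_cst B0 t); by rewrite mulr0 addr0.
  exists d => //.
  pose as0 := conjc (A (Pt (sw (X t)))).
  pose bs0 j := conjc (B j (Pt (sw (X t)))).
  pose a := A y; pose as_ := star A y; pose b := B k y; pose bs j := star (B j) y.
  pose g j := conjc (defect j (sw (X t))); pose f := defect k (X t).
  have gE j : g j = bs j * as0 - as_ * bs0 j.
    by rewrite /g /defect conjcD conjcN !conjcM /bs /as_ /star /y sw_Psi.
  have fE : f = b * A0 - a * B0.
    by rewrite /f /defect /b /a /A0 /B0 /P -(Pt_px hx hXS).
  have [a_n0 a_inv] := A_Psi hXS (near_bp_o2 hX).
  have hnsX := near_bp_sw hX.
  have [s_n0 s_inv] := A_Psi hsX (near_bp_o2 hnsX).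
  have [p_n0 p_inv] := A_Pt hsX.
  have conj_n0 (c : C) : c != 0 -> conjc c != 0.
    by apply: contra_neq => h; rewrite -[c]conjcK h; apply: complex_ext; rewrite /= ?oppr0.
  have conj_inv (c : C) : cmod (conjc c)^-1 = cmod c^-1.
    by case: c => p q; rewrite /cmod /= sqrrN mulNr !normrN.
  have as0_n0 : as0 != 0 by exact: conj_n0.
  have as_E : as_ = conjc (A (Psi (sw (X t)))) by rewrite /as_ /star /y sw_Psi.
  have as_n0 : as_ != 0 by rewrite as_E; exact: conj_n0.
  pose T j := A0 * g j * (a * D2 k (inl o1) y - b * D2 o1 (inl o1) y)
    + as_ * f * (as0 * D2 o1 (inl j) y - bs0 j * D2 o1 (inl o1) y).
  have dE : as_ * a * as0 * d = \sum_(j | j != o1) pv x j * T j.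
    have E1 : as0 * w = - \sum_(j | j != o1) pv x j * bs0 j.
      by apply/eqP; rewrite -addr_eq0; apply/eqP; exact: ew.
    have E2 : as0 * d = \sum_(j | j != o1) pv x j *
        ((as0 * D2 k (inl j) y - bs0 j * D2 k (inl o1) y) * A0
         - (as0 * D2 o1 (inl j) y - bs0 j * D2 o1 (inl o1) y) * B0).
      rewrite /d.
      rewrite [LHS](_ : _ = (as0 * w) * (D2 k (inl o1) y * A0 - D2 o1 (inl o1) y * B0)
        + (\sum_(j | j != o1) pv x j * D2 k (inl j) y) * (as0 * A0)
        - (\sum_(j | j != o1) pv x j * D2 o1 (inl j) y) * (as0 * B0)); last by ring.
      rewrite E1 mulNr !mulr_suml -!sumrN -!big_split /=.
      by apply: eq_bigr => j _; ring.
    rewrite -[LHS]mulrA E2 mulr_sumr; apply: eq_bigr => j _.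
    rewrite mulrCA; congr (_ * _).
    (* the only place where the vanishing of the Levi form enters *)
  have L0 := @levi_complex j k y hy a_n0.
    rewrite /levi_form -/a -/b -/as_ -/(bs j) in L0.
    rewrite /T gE fE; apply/eqP; rewrite -subr_eq0; apply/eqP.
    rewrite [LHS](_ : _ = as0 * A0 * (as_ * a * D2 k (inl j) y - as_ * b * D2 o1 (inl j) y
      - bs j * a * D2 k (inl o1) y + bs j * b * D2 o1 (inl o1) y)); last by ring.
    by rewrite L0 mulr0.
  have hy9 := p39 hy; have hP9 := p39 hP.
  have hsy : polydisc (fun=> 9 * delta) (sw y) by apply: sw_polydisc hy9.
  have bd v z : polydisc (fun=> 9 * delta) z -> cmod (Df v z) <= K.
    by move=> hz; exact: hol_bound (hDf v) hz.
  have hy8' : polydisc (fun=> 8 * delta) y by move=> s; apply: le_trans (hy s) _; dlra.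
  have bd2 k' v : cmod (D2 k' v y) <= K by exact: hol_bound (hD2 k' v) hy8'.
  have hgS j : cmod (g j) <= S by rewrite /g cmod_conj; exact: hS.
  have hfS : cmod f <= S by exact: hS.
  have KK c1 c2 : cmod c1 <= K -> cmod c2 <= K -> cmod (c1 * c2) <= K * K.
    by move=> h1 h2; rewrite (le_trans (cmodM _ _))// ler_pM// cmod_ge0.
  have KS c1 c2 : cmod c1 <= K -> cmod c2 <= S -> cmod (c1 * c2) <= K * S.
    by move=> h1 h2; rewrite (le_trans (cmodM _ _))// ler_pM// cmod_ge0.
  have bas0 : cmod as0 <= K by rewrite cmod_conj; apply: bd; exact: p39.
  have bbs0 j : cmod (bs0 j) <= K by rewrite cmod_conj; apply: bd; exact: p39.
  have bas : cmod as_ <= K by rewrite /as_ /star cmod_conj; exact: bd.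
  have bT j : cmod (T j) <= 4 * K ^+ 3 * S.
    have h1 : cmod (A0 * g j * (a * D2 k (inl o1) y - b * D2 o1 (inl o1) y))
        <= (K * S) * (K * K + K * K).
      rewrite (le_trans (cmodM _ _))// ler_pM ?cmod_ge0//; first by apply: KS => //; exact: bd.
      by rewrite (le_trans (cmodB _ _))// lerD// KK//; exact: bd.
    have h2 : cmod (as_ * f * (as0 * D2 o1 (inl j) y - bs0 j * D2 o1 (inl o1) y))
        <= (K * S) * (K * K + K * K).
      rewrite (le_trans (cmodM _ _))// ler_pM ?cmod_ge0//; first exact: KS.
      by rewrite (le_trans (cmodB _ _))// lerD// KK.
    rewrite (le_trans (cmodD _ _))// (le_trans (lerD h1 h2))//.
    rewrite le_eqVlt; apply/orP; left; apply/eqP; ring.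
  have bsum : cmod (\sum_(j | j != o1) pv x j * T j)
      <= n%:R * (eta * delta * (4 * K ^+ 3 * S)).
    rewrite (le_trans (cmod_sum _ _ _))//.
    apply: (@le_trans _ _ (\sum_(j : 'I_n) eta * delta * (4 * K ^+ 3 * S))).
      rewrite big_mkcond; apply: ler_sum => j _; case: ifP => _; last first.
        by rewrite !mulr_ge0 ?(ltW d0)// exprn_ge0.
      by rewrite (le_trans (cmodM _ _))// ler_pM ?cmod_ge0//; exact: pv_le.
    by rewrite sumr_const card_ord -[X in X <= _]mulr_natl.
  have -> : d = (as0^-1 * a^-1 * as_^-1) * (\sum_(j | j != o1) pv x j * T j).
    rewrite -dE; field; by rewrite as_n0 a_n0 as0_n0.
  have d4 : 0 <= 4 / delta by rewrite divr_ge0// ltW.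
  rewrite (le_trans (cmodM _ _))//.
  have binv : cmod (as0^-1 * a^-1 * as_^-1) <= (4 / delta) ^+ 3.
    rewrite (le_trans (cmodM _ _))// !exprSr expr0 mul1r ler_pM ?cmod_ge0//.
      rewrite (le_trans (cmodM _ _))// ler_pM ?cmod_ge0//.
      by rewrite conj_inv.
    by rewrite as_E conj_inv.
  rewrite (le_trans (ler_pM (cmod_ge0 _) (cmod_ge0 _) binv bsum))//.
  rewrite le_eqVlt; apply/orP; left; apply/eqP; ring.
pose dd t := match pselect (0 <= t <= 1) with
  | left h => sval (cid2 (key t h)) | right _ => 0 end.
have := @cmean_value R (fun t => defect k (X t)) dd
   (eta * (n%:R * ((4 / delta) ^+ 3 * delta * (4 * K ^+ 3))) * S).
rewrite /X px1 defect_px0// subr0 => W.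
apply: le_trans (W _ _) _.
- move=> t ht; rewrite /dd; case: pselect => // h.
  by case: cid2.
- move=> t ht; rewrite /dd; case: pselect => // h.
  by case: cid2.
- rewrite le_eqVlt; apply/orP; left; apply/eqP; ring.
Qed.

End NearBase.

Lemma hol_Psi s : hol rS (3 * delta) (fun x => Psi x s).
Proof.
have r0 := rS_ge0 hn d0 e0 e1.
have hv s' : hol rS (3 * delta) (fun x => x s').
  exact: hol_leK (rS_le hn d0 e0 e1 s') (hol_var r0 s').
case: s => j; rewrite /Psi /repl; case: (j == o1) => //.
  by apply: hol_leK _ (hol_star (@rS_swp _ _ hn delta) hH); dlra.
by apply: hol_leK _ hH; dlra.
Qed.

Lemma hol_Pt s : hol rS (3 * delta) (fun x => Pt x s).
Proof.
have r0 := rS_ge0 hn d0 e0 e1.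
have hv s' : hol rS (3 * delta) (fun x => x s').
  exact: hol_leK (rS_le hn d0 e0 e1 s') (hol_var r0 s').
case: s => j; rewrite /Pt.
  rewrite [X in hol _ _ X](_ : _ = fun x => line (x (inl o1)) j)// /line.
  case: (j == o1) => //; case: (j == o2).
    by apply: hol_leK _ (hol_cst r0 _); rewrite cmodR gtr0_norm//; dlra.
  apply: hol_leK _ (hol_cst r0 _); rewrite cmod0; dlra.
rewrite [X in hol _ _ X](_ : _ = fun x => if j == o1 then H x else x (inr j))//.
by case: (j == o1) => //; apply: hol_leK hH; dlra.
Qed.

Lemma hol_defect k : exists K', hol rS K' (defect k).
Proof.
have r0 := rS_ge0 hn d0 e0 e1.
have h1 v : hol rS K (fun x => Df v (Psi x)).
  apply: (@hol_comp _ _ _ (fun=> 9 * delta) rS K (Df v) (fun s x => Psi x s)) => // s.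
  by apply: hol_leK _ (hol_Psi s); dlra.
have h2 v : hol rS K (fun x => Df v (Pt x)).
  apply: (@hol_comp _ _ _ (fun=> 9 * delta) rS K (Df v) (fun s x => Pt x s)) => // s.
  by apply: hol_leK _ (hol_Pt s); dlra.
by eexists; apply: holB; apply: holM.
Qed.

(** Near enough to the base point, [gronwall_step] halves any bound. *)
Lemma defect_near0 : exists eta, [/\ 0 < eta, eta <= 1 / 64 &
  forall x k, near_bp eta x -> defect k x = 0].
Proof.
have K0 := K_ge0.
pose M := n%:R * (2 * (4 / delta) ^+ 3 * delta * (4 * K ^+ 3)).
have M0 : 0 <= M.
  have d43 : 0 <= (4 / delta) ^+ 3 by rewrite exprn_ge0// divr_ge0// ltW.
  have K3 : 0 <= K ^+ 3 by exact: exprn_ge0.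
  have hd := ltW d0.
  by apply: mulr_ge0 => //; apply: mulr_ge0; apply: mulr_ge0 => //; apply: mulr_ge0.
pose eta := (1 / 64) / (M + 1).
have M1 : 0 < M + 1 by lra.
have eta0 : 0 < eta by rewrite divr_gt0//; lra.
have eta1 : eta <= 1 / 64 by rewrite ler_pdivrMr// ler_peMr//; lra.
have etaM : eta * M <= 1 / 2.
  rewrite /eta mulrAC ler_pdivrMr//; lra.
exists eta; split=> // x k hx.
pose S0 := K * K + K * K.
have S00 : 0 <= S0 by rewrite addr_ge0// mulr_ge0.
have ini y k' : near_bp eta y -> cmod (defect k' y) <= S0.
  move=> hy; have hyS := rHS (near_bp_rH eta1 hy).
  have hP := p39 (Pt_polydisc hyS); have hQ := p39 (Psi_polydisc hyS).
  rewrite (le_trans (cmodB _ _))// lerD// (le_trans (cmodM _ _))//;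
    rewrite ler_pM ?cmod_ge0//; by apply: hol_bound (hDf _) _.
have key m : forall y k', near_bp eta y -> cmod (defect k' y) <= S0 * (1 / 2) ^+ m.
  elim: m => [|m IH] y k' hy; first by rewrite expr0 mulr1; exact: ini.
  have q0 : 0 <= S0 * (1 / 2) ^+ m by rewrite mulr_ge0// exprn_ge0//; lra.
  apply: le_trans (gronwall_step (ltW eta0) eta1 q0 IH k' hy) _.
  apply: le_trans (ler_wpM2r q0 etaM) _; rewrite exprSr.
  by rewrite le_eqVlt; apply/orP; left; apply/eqP; ring.
apply: cmod_eps0 => d dpos.
have [q0 q1] : 0 <= 1/2 :> R /\ 1/2 < 1 :> R by split; lra.
have [m h] := filter_ex (pow_small q0 q1 S00 dpos).
exact: le_trans (key m x k hx) h.
Qed.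

Definition rB (s : V) : R :=
  match s with inl j | inr j => if j == o1 then delta / 32 else delta / 5 end.

Lemma rB_rH x : polydisc rB x -> polydisc rH x.
Proof.
by move=> hx s; apply: le_trans (hx s) _; case: s => j /=; case: ifP => _; dlra.
Qed.

(** [x] lies on a complex line through the base point, and near the base point
    the defect is zero. *)
Lemma defect_zero x k : polydisc rB x -> defect k x = 0.
Proof.
move=> hx; have [eta [eta0 eta1 hz]] := defect_near0.
have [K' hf] := hol_defect k.
have xb s : cmod (x s - bp s) <= 6 / 5 * delta.
  have := cmodB (x s) (bp s); have := bp_le s; have := hx s.
  by case: s => j /=; case: ifP => _; dlra.
have ab s : cmod (bp s) + 3 / 2 * cmod (x s - bp s) <= rS s.
  have := cmodB (x s) (bp s); have := bp_le s; have := hx s.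
  by case: s => j /=; rewrite /line; case: ifP => _; rewrite ?cmod0; dlra.
have := identity_line hf ab (divr_gt0 eta0 (ltr0n _ 2)).
have z0 (t : R) : 0 < t -> t <= eta / 2 -> defect k (fun v => bp v + rc t * (x v - bp v)) = 0.
  move=> t0 t1; apply: hz => s; rewrite addrAC subrr add0r (le_trans (cmodM _ _))//.
  rewrite cmodR gtr0_norm// (le_trans (ler_wpM2l (ltW t0) (xb s)))//.
  have : t * delta <= eta / 2 * delta by rewrite ler_wpM2r// ltW.
  have : 0 <= eta * delta by rewrite mulr_ge0 ?ltW.
  lra.
move=> /(_ z0 1) W; rewrite -W; last by rewrite cmod1; lra.
by congr (defect k _); apply/funext => s; ring.
Qed.

Lemma segre_tangent x k : polydisc rB x ->
  B k (Psi x) = A (Psi x) * (B k (Pt x) / A (Pt x)).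
Proof.
move=> hx; have := defect_zero k hx.
have [A0 _] := A_Pt (rHS (rB_rH hx)).
move=> /eqP; rewrite /defect subr_eq0 => /eqP h.
by apply: (mulIf A0); rewrite h mulrA divfK.
Qed.

End SegreLeaves.

(** * Complex coordinates of real vectors *)

Section Coordinates.
Context {R : realType}.
Local Notation C := R[i].
Local Notation rc := (real_complex R).

Definition ci : C := Complex 0 1.

Lemma ci_sq : ci * ci = -1.
Proof. by apply: complex_ext; rewrite /= ?(mul0r, mulr0, mulr1, sub0r, addr0, oppr0). Qed.
Lemma conjc_i : conjc ci = - ci.
Proof. by apply: complex_ext; rewrite /= ?oppr0. Qed.
Lemma cmod_i : cmod ci = 1.
Proof. by rewrite /cmod /= normr0 add0r normr1. Qed.
Lemma conjc_rc (t : R) : conjc (rc t) = rc t.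
Proof. by apply: complex_ext; rewrite /= ?oppr0. Qed.

Variable k : nat.
Implicit Types (v w : 'rV[R]_(k + k)) (j : 'I_k).

Definition mkrow (c : 'I_k -> C) : 'rV[R]_(k + k) :=
  row_mx (\row_j complex.Re (c j)) (\row_j complex.Im (c j)).

Lemma coord_mkrow c j : coord (mkrow c) j = c j.
Proof.
by apply: complex_ext; rewrite /coord /= ?row_mxEl ?row_mxEr mxE.
Qed.

Lemma coord_ext v w : (forall j, coord v j = coord w j) -> v = w.
Proof.
move=> h; apply/rowP => i; rewrite -(fintype.splitK i); case: (fintype.split i) => j /=.
  exact: (congr1 (@complex.Re R) (h j)).
exact: (congr1 (@complex.Im R) (h j)).
Qed.

Lemma coordD v w j : coord (v + w) j = coord v j + coord w j.
Proof. by apply: complex_ext; rewrite ?cReD ?cImD /coord /= mxE. Qed.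
Lemma coordN v j : coord (- v) j = - coord v j.
Proof. by apply: complex_ext; rewrite ?cReN ?cImN /coord /= mxE. Qed.
Lemma coordB v w j : coord (v - w) j = coord v j - coord w j.
Proof. by rewrite coordD coordN. Qed.
Lemma coord0 j : coord (0 : 'rV[R]_(k + k)) j = 0.
Proof. by apply: complex_ext; rewrite /coord /= mxE. Qed.
Lemma coordZ (t : R) v j : coord (t *: v) j = rc t * coord v j.
Proof.
by apply: complex_ext; rewrite ?cReM ?cImM /coord /= mxE mul0r ?subr0 ?addr0.
Qed.
Lemma coordJ v j : coord (J v) j = ci * coord v j.
Proof.
apply: complex_ext; rewrite ?cReM ?cImM /coord /= mul0r mul1r ?add0r ?sub0r ?addr0.
  by rewrite /J row_mxEl !mxE.
by rewrite /J row_mxEr !mxE.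
Qed.
Lemma JJ v : J (J v) = - v.
Proof.
by apply: coord_ext => j; rewrite !coordJ coordN mulrA ci_sq mulN1r.
Qed.
Lemma JN v : J (- v) = - J v.
Proof. by apply: coord_ext => j; rewrite !(coordJ, coordN) mulrN. Qed.

Lemma coord_le v j : cmod (coord v j) <= 2 * `|v|.
Proof. by rewrite mulrDl mul1r lerD//; exact: mx_entry_le. Qed.

Lemma norm_coord_lt v r : 0 < r -> (forall j, cmod (coord v j) < r) -> `|v| < r.
Proof.
move=> r0 h; apply: mx_norm_lt => // i; rewrite -(fintype.splitK i).
case: (fintype.split i) => j /=; apply: le_lt_trans (h j).
  exact: (Re_le_cmod (coord v j)).
exact: (Im_le_cmod (coord v j)).
Qed.

End Coordinates.

Arguments ci {R}.

(** * Derivatives of curves of row vectors *)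

Section RowDerivatives.
Context {R : realType}.
Local Notation C := R[i].
Local Notation rc := (real_complex R).

Lemma is_derive_row k (g : R -> 'rV[R]_k) (t0 : R) v :
  is_derive t0 1 g v <-> forall i, is_derive t0 1 (fun t => g t 0 i) (v 0 i).
Proof.
split=> [[dg gv] i|h].
  have dgi := (derivable_mxP g t0 1).1 dg 0 i.
  split => //; move: gv; rewrite derive_mx// => <-.
  by rewrite mxE.
have dg : derivable g t0 1.
  by apply/derivable_mxP => i j; rewrite ord1; have [] := h j.
split=> //; rewrite derive_mx//; apply/rowP => i; rewrite mxE.
by have [] := h i.
Qed.

Lemma cder_row k (g : R -> 'rV[R]_(k + k)) (t0 : R) v :
  is_derive t0 1 g v <-> forall j, cder (fun t => coord (g t) j) t0 (coord v j).
Proof.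
split=> [/is_derive_row h j|h].
  by apply/cderP; split; exact: h.
apply/is_derive_row => i; rewrite -(fintype.splitK i); case: (fintype.split i) => j /=.
  by have /cderP[] := h j.
by have /cderP[] := h j.
Qed.

Lemma derive_line (V W : normedModType R) (G : V -> W) p w :
  differentiable G p -> is_derive (0 : R) (1 : R) (fun t => G (p + t *: w)) ('d G p w).
Proof.
move=> dG; have dv := @diff_derivable _ _ _ G p w dG.
have E : (fun h : R => h^-1 *: (((fun t => G (p + t *: w)) \o shift 0) (h *: (1 : R))
     - G (p + 0 *: w)))
  = (fun h : R => h^-1 *: ((G \o shift p) (h *: w) - G p)).
  apply/funext => h /=; rewrite scale0r addr0 addr0 [h *: 1](mulr1 h).
  by rewrite [p + _]addrC.
split; first by rewrite /derivable E.
by rewrite /derive E -deriveE.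
Qed.

Lemma diff_cder k (V : normedModType R) (G : V -> 'rV[R]_(k + k)) p w j :
  differentiable G p ->
  cder (fun t => coord (G (p + t *: w)) j) 0 (coord ('d G p w) j).
Proof. by move=> /(derive_line w) /cder_row. Qed.

Lemma is_derive_eq_val (T : normedModType R) (f : R -> T) (t0 : R) (a b : T) :
  is_derive t0 1 f a -> is_derive t0 1 f b -> a = b.
Proof. by move=> [_ <-] [_ <-]. Qed.

Lemma diff_comp_val (U1 U2 U3 : normedModType R) (f : U1 -> U2) (g : U2 -> U3) x y w :
  f x = y -> differentiable f x -> differentiable g y ->
  'd g y ('d f x w) = 'd (g \o f) x w.
Proof. by move=> <- df dg; exact/esym/(congr1 (@^~ w) (diff_comp df dg)). Qed.

Lemma line_is_derive m (a u : 'rV[R]_m) :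
  is_derive (0 : R) (1 : R) (fun t : R => a + t *: u) u.
Proof.
apply/is_derive_row => k.
have [h _] := (cderP _ _ _).1 (rc_lin_cder (rc (a 0 k)) (rc (u 0 k)) 0).
rewrite (_ : (fun t => _) = (fun t => complex.Re (rc (a 0 k) + rc t * rc (u 0 k))))//.
by apply/funext => t; rewrite !mxE cReD cReM /= mul0r subr0.
Qed.

End RowDerivatives.

(** * Germs of real-analytic functions *)

Section RealAnalyticGerms.
Context {R : realType}.
Local Notation C := R[i].
Local Notation rc := (real_complex R).

(** The majorant norm on a small polydisc is close to the modulus at the center.
    This makes composition of germs possible under a bound at one point only. *)
Lemma hol_shrink (V : finType) (r : R) K f c : 0 < r ->
  hol (fun _ : V => r) K f -> cmod (f (fun=> 0)) < c ->
  \forall rho \near 0^'+, hol (fun _ : V => rho) c f.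
Proof.
move=> r0 hf fc.
have r2 : 0 < r / 2 by rewrite divr_gt0.
have r20 (v : V) : 0 <= r / 2 := ltW r2.
have hf' : hol (fun _ : V => r / 2 + r / 2) K f.
  by apply: hol_le hf => // _; rewrite -splitr// ltW.
have [Q [hQ fQ]] := hadamard r2 r20 hf'.
pose B := #|V|%:R * (K / (r / 2)).
have K0 := hol_K0 hf.
have B0 : 0 <= B by rewrite mulr_ge0// divr_ge0// ltW.
near=> rho.
have rho0 : 0 < rho by [].
have rhor : rho <= r / 2 by near: rho; exact: nbhs_right_le.
have rhoB : rho * (B + 1) <= c - cmod (f (fun=> 0)).
  rewrite -ler_pdivlMr ?ltr_pwDr//; near: rho; apply: nbhs_right_le.
  by rewrite divr_gt0 ?subr_gt0// ltr_pwDr.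
have rr0 (v : V) : 0 <= rho := ltW rho0.
have h1 : hol (fun _ : V => rho) (cmod (f (fun=> 0)) + \sum_(v : V) rho * (K / (r / 2)))
   (fun x => f (fun=> 0) + \sum_v x v * Q v (pairpt x (fun=> 0))).
  apply: holD; first exact: hol_cst.
  apply: hol_sum => // v; apply: holM; first exact: (hol_var rr0).
  apply: (@hol_comp _ _ _ (pairpt (fun=> r / 2) (fun=> r / 2)) _ _ (Q v)
    (fun s x => pairpt x (fun=> 0) s)) => //.
  move=> [w|w] /=; first exact: hol_leK rhor (hol_var rr0 w).
  by apply: hol_leK _ (hol_cst rr0 0); rewrite cmod0 ltW.
have h2 : hol (fun _ : V => rho) (cmod (f (fun=> 0)) + \sum_(v : V) rho * (K / (r / 2))) f.
  apply: hol_ext h1 => x hx.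
  have hx1 : polydisc (fun=> r / 2) x by move=> v; exact: le_trans (hx v) rhor.
  have hx2 : polydisc (fun _ : V => r / 2) (fun=> 0) by move=> v; rewrite cmod0 ltW.
  have -> : f x = f (fun=> 0) + (f x - f (fun=> 0)) by ring.
  by rewrite fQ//; congr (_ + _); apply: eq_bigr => v _; rewrite subr0.
apply: hol_leK h2.
have -> : \sum_(v : V) rho * (K / (r / 2)) = rho * B.
  by rewrite sumr_const -[LHS]mulr_natl /B; ring.
rewrite -lerBrDl.
by apply: le_trans rhoB; rewrite ler_wpM2l ?(ltW rho0)// lerDl.
Unshelve. all: by end_near. Qed.

Variable m : nat.
Implicit Types (phi psi : 'rV[R]_m -> C) (p : 'rV[R]_m).

(** Germs of real-analytic functions, as restrictions to real displacements of
    holomorphic functions. *)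
Definition ran phi p := exists r K f, [/\ 0 < r, hol (fun _ : 'I_m => r) K f
  & forall h, `|h| < r -> phi (p + h) = f (rpt h)].

Lemma rpt0 : rpt (0 : 'rV[R]_m) = fun=> 0.
Proof. by apply/funext => i; rewrite /rpt mxE. Qed.

Lemma ran_near phi p : ran phi p -> exists2 f,
  (forall c, cmod (phi p) < c -> \forall rho \near 0^'+, hol (fun _ : 'I_m => rho) c f) &
  \forall rho \near 0^'+, forall h, `|h| < rho -> phi (p + h) = f (rpt h).
Proof.
move=> [r [K [f [r0 hf phf]]]]; exists f => [c pc|].
  apply: (hol_shrink r0 hf).
  have h0 : `|(0 : 'rV[R]_m)| < r by rewrite normr0.
  by have := phf 0 h0; rewrite addr0 rpt0 => <-.
near=> rho => h hrho; apply: phf; apply: lt_le_trans hrho _.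
by near: rho; exact: nbhs_right_le.
Unshelve. all: by end_near. Qed.

Lemma ran_hol (V : finType) (rV : V -> R) K f (phi : V -> 'rV[R]_m -> C) p :
  hol rV K f -> (forall v, ran (phi v) p) -> (forall v, cmod (phi v p) < rV v) ->
  ran (fun x => f (fun v => phi v x)) p.
Proof.
move=> hf hphi hlt.
have /choice[g hg] : forall v, exists g,
    \forall rho \near (0 : R)^'+, hol (fun _ : 'I_m => rho) (rV v) g /\
      forall h, `|h| < rho -> phi v (p + h) = g (rpt h).
  move=> v; have [g h1 h2] := ran_near (hphi v); exists g.
  near=> rho; split; first by near: rho; exact: h1.
  by near: rho; exact: h2.
have : \forall rho \near (0 : R)^'+, forall v, hol (fun _ : 'I_m => rho) (rV v) (g v) /\
      forall h, `|h| < rho -> phi v (p + h) = g v (rpt h).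
  exact: filter_forall.
have pos : \forall rho \near (0 : R)^'+, 0 < rho by exact: nbhs_right_gt.
move=> H; have [rho [rho0 hrho]] := filter_ex (filterI pos H).
exists rho, K, (fun x => f (fun v => g v x)); split=> //.
  apply: (@hol_comp _ V _ rV _ K f g) => //.
    by move=> _; exact: ltW.
  by move=> v; have [] := hrho v.
move=> h hh; congr f; apply/funext => v; have [_] := hrho v; exact.
Unshelve. all: by end_near. Qed.

Lemma ran_cst a p : ran (fun=> a) p.
Proof.
exists 1, (cmod a), (fun=> a); split=> //.
by apply: hol_cst => _; exact: ler01.
Qed.

Lemma ran_entry i p : ran (fun x => rc (x 0 i)) p.
Proof.
exists 1, (cmod (rc (p 0 i)) + 1), (fun x => rc (p 0 i) + x i); split=> //.
  apply: holD; first by apply: hol_cst => _; exact: ler01.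
  have r0 (_ : 'I_m) : 0 <= 1 :> R by exact: ler01.
  exact: (hol_var r0 i).
by move=> h _; rewrite mxE rmorphD.
Qed.

Lemma ran_pexp (V : finType) (e : pexp R V) (phi : V -> 'rV[R]_m -> C) p :
  (forall v, ran (phi v) p) -> ran (fun x => peval (fun v => phi v x) e) p.
Proof.
move=> h; pose r v := cmod (phi v p) + 1.
have r0 v : 0 <= r v by rewrite addr_ge0// cmod_ge0.
apply: (ran_hol (hol_pexp r0 e)) => // v.
by rewrite /r ltrDl.
Qed.

Lemma ranD phi psi p : ran phi p -> ran psi p -> ran (fun x => phi x + psi x) p.
Proof.
move=> h1 h2; apply: (@ran_pexp bool (Add (Var true) (Var false))
  (fun b => if b then phi else psi)); by case.
Qed.
Lemma ranM phi psi p : ran phi p -> ran psi p -> ran (fun x => phi x * psi x) p.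
Proof.
move=> h1 h2; apply: (@ran_pexp bool (Mul (Var true) (Var false))
  (fun b => if b then phi else psi)); by case.
Qed.
Lemma ranN phi p : ran phi p -> ran (fun x => - phi x) p.
Proof.
move=> h; rewrite [X in ran X](_ : _ = (fun x => -1 * phi x)).
  by apply: ranM h; exact: ran_cst.
by apply/funext => x; rewrite mulN1r.
Qed.
Lemma ran_sum I (s : seq I) (phi : I -> 'rV[R]_m -> C) p :
  (forall i, ran (phi i) p) -> ran (fun x => \sum_(i <- s) phi i x) p.
Proof.
move=> h; elim: s => [|i s IH].
  by under eq_fun do rewrite big_nil; exact: ran_cst.
by under eq_fun do rewrite big_cons; exact: ranD.
Qed.
Lemma ran_conj phi p : ran phi p -> ran (fun x => conjc (phi x)) p.
Proof.
move=> [r [K [f [r0 hf E]]]].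
exists r, K, (fun x => conjc (f (fun v => conjc (x v)))); split=> //.
  exact: hol_conj.
move=> h hr; rewrite E//; congr (conjc (f _)); apply/funext => i.
by rewrite /rpt conjc_rc.
Qed.
Lemma ran_ext phi psi p : (forall x, phi x = psi x) -> ran phi p -> ran psi p.
Proof. by move=> /funext ->. Qed.

Lemma ran_analytic phi p : ran phi p ->
  exists c, power_series_at (fun x => complex.Re (phi x)) p c.
Proof.
move=> [r [K [f [r0 hf E]]]]; apply: (hol_power_series r0 hf) => h hr.
by rewrite E.
Qed.

Lemma cvg_sum_seq T (F : set_system T) {FF : Filter F} I (s : seq I)
    (f : I -> T -> R) (a : I -> R) : (forall i, f i @ F --> a i) ->
  (fun t => \sum_(i <- s) f i t) @ F --> \sum_(i <- s) a i.
Proof.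
move=> h; elim: s => [|i s IH].
  by rewrite big_nil; under eq_fun do rewrite big_nil; exact: cvg_cst.
by rewrite big_cons; under eq_fun do rewrite big_cons; exact: cvgD.
Qed.

(** Hadamard's factorization, applied to [f] and then to its quotients, gives a
    remainder of second order. *)
Lemma ran_differentiable_Re phi p : ran phi p ->
  differentiable (fun x => complex.Re (phi x) : R) p.
Proof.
move=> [r [K [f [r0 hf E]]]].
have r3 : 0 < r / 3 by rewrite divr_gt0.
pose r1 (_ : 'I_m) := r / 3; pose r2 (_ : 'I_m) := r / 3 + r / 3.
have r10 v : 0 <= r1 v by exact: ltW.
have r20 v : 0 <= r2 v by rewrite addr_ge0// ltW.
have hf' : hol (fun v => r2 v + r / 3) K f.
  by apply: hol_le hf => // v; rewrite /r2; lra.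
have [Q [hQ fQ]] := hadamard r3 r20 hf'.
pose rr := pairpt r1 r1.
have rr0 v : 0 <= rr v by case: v.
have hQ' i : hol (fun v => rr v + r / 3) (K / (r / 3)) (Q i).
  by apply: hol_le (hQ i) => // -[v|v] //=; rewrite ?addr_ge0// ltW.
pose z : 'I_m -> C := fun=> 0.
pose D i := complex.Re (Q i (pairpt z z)).
pose L (h : 'rV[R]_m) : R := \sum_i h 0 i * D i.
have Llin : linear L.
  move=> a u v; change (L (a *: u + v) = a * L u + L v).
  rewrite /L mulr_sumr -big_split; apply: eq_bigr => i _ /=.
  by rewrite !mxE mulrDl -mulrA.
pose LL := GRing.isLinear.Build R 'rV[R]_m R *:%R L Llin.
pose Lf : {linear 'rV[R]_m -> R} := HB.pack L LL.
have Lc : continuous Lf.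
  move=> x; apply: (@cvg_sum_seq _ (nbhs x) _ _ (index_enum 'I_m)
    (fun i (h : 'rV[R]_m) => h 0 i * D i)) => i.
  apply: (@cvgM _ _ (nbhs x) _ _ _ (x 0 i) (D i)); last exact: cvg_cst.
  exact: coord_continuous.
have C2 : exists C2 : R, 0 <= C2 /\ forall h : 'rV[R]_m, `|h| < r / 3 ->
   `|complex.Re (phi (p + h)) - complex.Re (phi p) - L h| <= C2 * `|h| * `|h|.
  exists (m%:R * (K / (r / 3) / (r / 3) * m%:R)); split.
    have K0 := hol_K0 hf; have r3' := ltW r3.
    by apply: mulr_ge0 => //; apply: mulr_ge0 => //; do 2 apply: divr_ge0 => //.
  move=> h hr.
  have hx : polydisc r1 (rpt h).
    by move=> i; rewrite /rpt cmodR (le_trans (mx_entry_le _ _))// ltW.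
  have hz : polydisc r1 z by move=> i; rewrite cmod0.
  have s12 x : polydisc r1 x -> polydisc r2 x.
    by move=> H i; rewrite (le_trans (H i))// /r2 lerDl ltW.
  have e0 : phi p = f z.
    have h0 : `|(0 : 'rV[R]_m)| < r by rewrite normr0.
    by have := E 0 h0; rewrite addr0 rpt0.
  have e1 : phi (p + h) - phi p = \sum_i rc (h 0 i) * Q i (pairpt (rpt h) z).
    rewrite E; last by rewrite (lt_trans hr)// ltr_pdivrMr// ltr_pMr// ltr1n.
    rewrite e0 (fQ _ _ (s12 _ hx) (s12 _ hz)); apply: eq_bigr => i _.
    by rewrite /z subr0.
  have e2 : complex.Re (phi (p + h)) - complex.Re (phi p) - L h
      = complex.Re (\sum_i rc (h 0 i) * (Q i (pairpt (rpt h) z) - Q i (pairpt z z))).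
    rewrite -cReN -cReD e1 /L.
    rewrite !(big_morph _ (@cReD R) (erefl : complex.Re 0 = 0)).
    rewrite -sumrB; apply: eq_bigr => i _.
    by rewrite !cReM !cReD !cReN /= !mul0r !subr0 mulrBr.
  rewrite e2 (le_trans (Re_le_cmod _))// (le_trans (cmod_sum _ _ _))//.
  apply: (@le_trans _ _ (\sum_(i < m) `|h| * (K / (r / 3) / (r / 3) * (m%:R * `|h|)))).
    apply: ler_sum => i _; rewrite (le_trans (cmodM _ _))// ler_pM ?cmod_ge0//.
      by rewrite cmodR mx_entry_le.
    have := @hol_lip _ _ rr (r / 3) (K / (r / 3)) (Q i) (pairpt (rpt h) z) (pairpt z z)
      r3 rr0 (hQ' i).
    have p1 : polydisc rr (pairpt (rpt h) z) by case.
    have p2 : polydisc rr (pairpt z z) by case.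
    move=> /(_ p1 p2) W; apply: le_trans W _.
    have q0 : 0 <= K / (r / 3) / (r / 3).
      by do 2 (apply: divr_ge0; last exact: ltW); exact: hol_K0 hf.
    apply: (ler_wpM2l q0); rewrite big_sumType /= [X in _ + X]big1 ?addr0; last first.
      by move=> i0 _; rewrite subrr cmod0.
    apply: (@le_trans _ _ (\sum_(i0 < m) `|h|)).
      by apply: ler_sum => i0 _; rewrite /z subr0 /rpt cmodR mx_entry_le.
    by rewrite sumr_const card_ord -[leLHS]mulr_natl.
  rewrite sumr_const card_ord -[leLHS]mulr_natl.
  by rewrite le_eqVlt; apply/orP; left; apply/eqP; ring.
have [c [c0 hc]] := C2.
have key : (fun x => complex.Re (phi x) : R) \o shift p
    = cst (complex.Re (phi p) : R) + Lf +o_ (0 : 'rV[R]_m) id.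
  apply/eqaddoP => e e0.
  have ec : 0 < e / (c + 1) by rewrite divr_gt0// ltr_pwDr.
  have n1 : \forall h \near (0 : 'rV[R]_m), `|h| < r / 3 by exact: nbhs0_lt.
  have n2 : \forall h \near (0 : 'rV[R]_m), `|h| < e / (c + 1) by exact: nbhs0_lt.
  near=> h.
  have -> : ((fun x => complex.Re (phi x) : R) \o shift p
     - (cst (complex.Re (phi p) : R) + Lf)) h
     = complex.Re (phi (p + h)) - complex.Re (phi p) - L h.
    by rewrite !fctE /= [h + p]addrC opprD addrA.
  have hr : `|h| < r / 3 by near: h; exact: n1.
  rewrite (le_trans (hc h hr))// ler_wpM2r//.
  have : `|h| < e / (c + 1) by near: h; exact: n2.
  by move=> /ltW he; exact: le_trans (ler_wpM2l c0 he) (le_frac c0 (ltW e0)).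
have dE := diff_unique Lc key.
by apply/diff_locallyP; rewrite dE.
Unshelve. all: by end_near. Qed.

Lemma ran_clim phi p : ran phi p -> clim (nbhs p) phi (phi p).
Proof.
move=> h; split; first exact: (differentiable_continuous (ran_differentiable_Re h)).
have := ran_differentiable_Re (ranM (ran_cst (- ci) p) h).
rewrite (_ : (fun x => _) = (fun x => complex.Im (phi x))).
  by move/differentiable_continuous.
by apply/funext => x; rewrite cReM /= oppr0 mul0r sub0r mulN1r opprK.
Qed.

End RealAnalyticGerms.

Section RowFunctions.
Context {R : realType}.
Local Notation C := R[i].
Local Notation rc := (real_complex R).

Definition entries_ran m l (G : 'rV[R]_m -> 'rV[R]_l) p :=
  forall i, exists2 psi, ran psi p & forall x, G x 0 i = complex.Re (psi x).

Lemma entries_ran_analytic m l (G : 'rV[R]_m -> 'rV[R]_l) p :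
  entries_ran G p -> analytic_at G p.
Proof.
move=> h i; have [psi hpsi E] := h i.
have [c hc] := ran_analytic hpsi; exists c.
by rewrite (funext E).
Qed.

Lemma entries_ran_differentiable m l (G : 'rV[R]_m -> 'rV[R]_l) p :
  entries_ran G p -> differentiable G p.
Proof.
move=> h.
have -> : G = \sum_(i < l) (fun x => G x 0 i *: delta_mx 0 i).
  apply/funext => x; rewrite fct_sumE; exact: row_sum_delta.
apply: differentiable_sum => i; have [psi hpsi E] := h i.
apply: differentiableZl.
by rewrite (funext E); exact: ran_differentiable_Re.
Qed.

Lemma coords_ran m k (G : 'rV[R]_m -> 'rV[R]_(k + k)) p :
  (forall j, ran (fun x => coord (G x) j) p) -> entries_ran G p.
Proof.
move=> h i; rewrite -(fintype.splitK i); case: (fintype.split i) => j /=.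
  by exists (fun x => coord (G x) j).
exists (fun x => - ci * coord (G x) j); first by apply: ranM (ran_cst _ _) (h j).
by move=> x; rewrite cReM /= oppr0 mul0r mulN1r sub0r opprK.
Qed.

Lemma ran_coord k (j : 'I_k) (p : 'rV[R]_(k + k)) : ran (fun x => coord x j) p.
Proof.
apply: ran_ext (ranD (ran_entry (lshift k j) p)
  (ranM (ran_cst ci p) (ran_entry (rshift k j) p))) => x.
apply: complex_ext; rewrite /coord ?cReD ?cImD ?cReM ?cImM /=;
  by rewrite ?(mul0r, mulr0, mul1r, sub0r, addr0, add0r, oppr0).
Qed.

Lemma near_norm_lt m (p : 'rV[R]_m) (eta : R) : `|p| < eta ->
  \forall q \near p, `|q| < eta.
Proof.
move=> h; have e0 : 0 < eta - `|p| by rewrite subr_gt0.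
have := nbhsx_ballx p (eta - `|p|) e0; apply: filterS => q.
rewrite -ball_normE /= => hq.
have -> : q = p - (p - q) by rewrite opprB addrC subrK.
by rewrite (le_lt_trans (ler_normB _ _))// -ltrBrDl.
Qed.

Lemma is_derive_cvg m (g : R -> 'rV[R]_m) (t0 : R) (v : 'rV[R]_m) :
  is_derive t0 1 g v -> g @ t0 --> g t0.
Proof.
by move=> [/derivable1_diffP/differentiable_continuous].
Qed.

Lemma tangent_germ m (A B : set 'rV[R]_m) p v :
  (\forall q \near p, A q -> B q) -> tangent A p v -> tangent B p v.
Proof.
move=> AB [g [g0 gA gd]]; exists g; split=> //.
have := is_derive_cvg gd; rewrite g0 => /(_ _ AB) AB'.
near=> t.
have h1 : A (g t) by near: t; exact: gA.
have h2 : A (g t) -> B (g t) by near: t; exact: AB'.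
exact: h2.
Unshelve. all: by end_near. Qed.

End RowFunctions.

(** * Tangent spaces of a graph over C^n *)

Section GraphCoordinates.
Context {R : realType} {n : nat}.
Local Notation C := R[i].
Local Notation V := ('I_n + 'I_n)%type.
Local Notation rc := (real_complex R).
Local Notation Cn1 := 'rV[R]_(n.+1 + n.+1).

Definition wid (j : 'I_n) : 'I_n.+1 := widen_ord (leqnSn n) j.

Lemma wid_lift j : wid j = lift ord_max j.
Proof. by apply: ord_inj; rewrite lift_max. Qed.

Lemma ord_wid (P : 'I_n.+1 -> Prop) : (forall j, P (wid j)) -> P ord_max ->
  forall i, P i.
Proof.
move=> h1 h2 i; case: (unliftP ord_max i) => [j ->|->//].
by rewrite -wid_lift.
Qed.

Definition mkp (c : 'I_n -> C) (w : C) : Cn1 :=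
  mkrow (fun i => if unlift ord_max i is Some j then c j else w).

Lemma coord_mkp c w j : coord (mkp c w) (wid j) = c j.
Proof. by rewrite coord_mkrow wid_lift liftK. Qed.
Lemma wcoord_mkp c w : wcoord (mkp c w) = w.
Proof. by rewrite /wcoord coord_mkrow unlift_none. Qed.

Lemma mkp_ext (a b : Cn1) : (forall j, coord a (wid j) = coord b (wid j)) ->
  wcoord a = wcoord b -> a = b.
Proof. by move=> h1 h2; apply: coord_ext; apply: ord_wid. Qed.

(** The real point of C^n x C^n under [p]. *)
Definition Xp (p : Cn1) : V -> C := fun s =>
  match s with inl j => coord p (wid j) | inr j => conjc (coord p (wid j)) end.

Lemma sw_Xp p : sw (Xp p) = Xp p.
Proof. by apply/funext => -[j|j] //; exact: conjcK. Qed.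

Lemma Xp_mkp c w s : Xp (mkp c w) s =
  match s with inl j => c j | inr j => conjc (c j) end.
Proof. by case: s => j; rewrite /Xp coord_mkp. Qed.

Lemma real_pt (x : V -> C) w : sw x = x -> Xp (mkp (fun j => x (inl j)) w) = x.
Proof.
move=> hx; apply/funext => -[j|j]; rewrite Xp_mkp//.
by have := congr1 (@^~ (inr j)) hx.
Qed.

Lemma XpD p q s : Xp (p + q) s = Xp p s + Xp q s.
Proof. by case: s => j; rewrite /Xp coordD ?conjcD. Qed.
Lemma XpZ (t : R) p s : Xp (t *: p) s = rc t * Xp p s.
Proof. by case: s => j; rewrite /Xp coordZ ?conjcM ?conjc_rc. Qed.

Lemma Xp_le p s : cmod (Xp p s) <= 2 * `|p|.
Proof. by case: s => j; rewrite /Xp ?cmod_conj; exact: coord_le. Qed.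

Lemma Xp_cder (g : R -> Cn1) (t0 : R) v s : is_derive t0 1 g v ->
  cder (fun t => Xp (g t) s) t0 (Xp v s).
Proof.
by move=> /cder_row h; case: s => j; [exact: h|exact/cder_conj/h].
Qed.

Lemma Xp_ran s p : ran (fun q => Xp q s) p.
Proof. by case: s => j; [exact: ran_coord|apply: ran_conj; exact: ran_coord]. Qed.

Lemma zpart_coord (p : Cn1) j : coord (zpart p) j = coord p (wid j).
Proof.
by apply: complex_ext; rewrite /coord /zpart /= ?row_mxEl ?row_mxEr mxE.
Qed.

Lemma mkp_is_derive (c : 'I_n -> R -> C) (w : R -> C) (t0 : R) v :
  (forall j, cder (c j) t0 (coord v (wid j))) -> cder w t0 (wcoord v) ->
  is_derive t0 1 (fun t => mkp (c^~ t) (w t)) v.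
Proof.
move=> h1 h2; apply/cder_row; apply: ord_wid => [j|].
  by apply: cder_eq (h1 j) => t; rewrite coord_mkp.
by apply: cder_eq h2 => t; rewrite -[RHS]/(wcoord _) wcoord_mkp.
Qed.

Lemma mkp_ran m (c : 'I_n -> 'rV[R]_m -> C) (w : 'rV[R]_m -> C) p :
  (forall j, ran (c j) p) -> ran w p ->
  forall i, ran (fun x => coord (mkp (c^~ x) (w x)) i) p.
Proof.
move=> h1 h2; apply: ord_wid => [j|].
  by apply: ran_ext (h1 j) => x; rewrite coord_mkp.
by apply: ran_ext h2 => x; rewrite -[RHS]/(wcoord _) wcoord_mkp.
Qed.

End GraphCoordinates.

Section GraphTangents.
Context {R : realType} {n : nat}.
Local Notation C := R[i].
Local Notation V := ('I_n + 'I_n)%type.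
Local Notation rc := (real_complex R).
Local Notation Cn1 := 'rV[R]_(n.+1 + n.+1).
Variables (rho : (V -> C) -> C) (r9 eta : R) (Df : V -> (V -> C) -> C).
Hypothesis gDf : isgrad (fun=> r9) rho Df.
Variable M : set Cn1.
Hypothesis hM : forall p, `|p| < eta -> (M p <-> wcoord p = rho (Xp p)).

(** For the converse, the curve is the graph over a segment. *)
Lemma tangent_graph p v : `|p| < eta -> polydisc (fun=> r9) (Xp p) -> M p ->
  (tangent M p v <-> wcoord v = \sum_s Xp v s * Df s (Xp p)).
Proof.
move=> pe hX Mp; split=> [[g [g0 gM gd]]|hv].
- have hX0 : polydisc (fun=> r9) (fun s => Xp (g 0) s) by rewrite g0.
  have := gDf (fun s => Xp_cder s gd) hX0; rewrite g0 => h1.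
  have h2 : cder (fun t => wcoord (g t)) 0 (wcoord v).
    by have /cder_row := gd; apply.
  apply: (cder_unique h2); apply: cder_ext h1.
  have ge : \forall t \near (0 : R), `|g t| < eta.
    by have := is_derive_cvg gd; rewrite g0 => /(_ _ (near_norm_lt pe)).
  near=> t.
  have h3 : M (g t) by near: t; exact: gM.
  have h4 : `|g t| < eta by near: t; exact: ge.
  by apply/esym/(hM h4).
- pose c (j : 'I_n) (t : R) := coord p (wid j) + rc t * coord v (wid j).
  pose x (s : V) (t : R) : C := match s with inl j => c j t | inr j => conjc (c j t) end.
  have cd j : cder (c j) 0 (coord v (wid j)).
    rewrite -[coord v _]add0r; apply: cderD; first exact: cder_cst.
    have := cderM (cder_id 0) (cder_cst (coord v (wid j)) 0).
    by rewrite mul1r mulr0 addr0.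
  have xd s : cder (x s) 0 (Xp v s).
    by case: s => j; [exact: cd|exact/cder_conj/cd].
  have x0 : (fun s => x s 0) = Xp p.
    by apply/funext => -[j|j]; rewrite /x /c mul0r addr0.
  have hX0 : polydisc (fun=> r9) (fun s => x s 0) by rewrite x0.
  have := gDf xd hX0; rewrite x0 -hv => wd.
  have gd := mkp_is_derive cd wd.
  set g := fun t : R => _ in gd.
  have g0 : g 0 = p.
    apply: mkp_ext => [j|]; first by rewrite coord_mkp /c mul0r addr0.
    rewrite wcoord_mkp x0; exact/esym/(hM pe).
  exists g; split=> //.
  have ge : \forall t \near (0 : R), `|g t| < eta.
    by have := is_derive_cvg gd; rewrite g0 => /(_ _ (near_norm_lt pe)).
  apply: filterS ge => t ht; apply/(hM ht); rewrite wcoord_mkp; congr rho.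
  by apply/funext => s; rewrite Xp_mkp; case: s.
Unshelve. all: by end_near. Qed.

(** The part of the derivative of the graphing function that is antilinear in
    [v], and [dlin] the linear one. *)
Definition dbar (x : V -> C) (v : Cn1) : C :=
  \sum_j conjc (coord v (wid j)) * Df (inr j) x.
Definition dlin (x : V -> C) (v : Cn1) : C :=
  \sum_j coord v (wid j) * Df (inl j) x.

Lemma dsum x v : \sum_s Xp v s * Df s x = dlin x v + dbar x v.
Proof. by rewrite big_sumType. Qed.

Lemma dbarJ x v : dbar x (J v) = - ci * dbar x v.
Proof.
rewrite /dbar mulr_sumr; apply: eq_bigr => j _.
by rewrite coordJ conjcM conjc_i mulrA.
Qed.
Lemma dlinJ x v : dlin x (J v) = ci * dlin x v.
Proof.
by rewrite /dlin mulr_sumr; apply: eq_bigr => j _; rewrite coordJ mulrA.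
Qed.
Lemma dbarD x v w : dbar x (v + w) = dbar x v + dbar x w.
Proof. by rewrite /dbar -big_split; apply: eq_bigr => j _; rewrite coordD conjcD mulrDl. Qed.
Lemma dlinD x v w : dlin x (v + w) = dlin x v + dlin x w.
Proof. by rewrite /dlin -big_split; apply: eq_bigr => j _; rewrite coordD mulrDl. Qed.

Lemma two_neq0 : (2 : C) != 0.
Proof. by rewrite pnatr_eq0. Qed.

Lemma tangent_both p v : `|p| < eta -> polydisc (fun=> r9) (Xp p) -> M p ->
  (tangent M p v /\ tangent M p (J v)) <->
  (dbar (Xp p) v = 0 /\ wcoord v = dlin (Xp p) v).
Proof.
move=> pe hX Mp; rewrite !tangent_graph// !dsum dbarJ dlinJ.
have wJ : wcoord (J v) = ci * wcoord v by rewrite /wcoord coordJ.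
rewrite wJ; split=> [[h1 h2]|[-> ->]]; last by rewrite mulr0 !addr0.
have : ci * dbar (Xp p) v *+ 2 = 0.
  move: h2; rewrite h1 mulrDr mulNr => /addrI h.
  by rewrite mulr2n {1}h addNr.
move=> /eqP; rewrite -mulr_natr !mulf_eq0 (negbTE two_neq0) orbF => /orP[/eqP i0|/eqP b0].
  have := @ci_sq R; rewrite i0 mul0r => /eqP.
  by rewrite eq_sym oppr_eq0 oner_eq0.
by split=> //; rewrite h1 b0 addr0.
Qed.

Lemma Tc_both p v : Tc M p v <-> tangent M p v /\ tangent M p (J (- v)).
Proof.
split=> [[h1 [u hu uv]]|[h1 h2]].
  by split=> //; rewrite -uv JN JJ opprK.
by split=> //; exists (J (- v)) => //; rewrite JJ opprK.
Qed.

(** Both [v] and [J v] are tangent; the linear and the antilinear part of the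
    derivative react to [J] by opposite factors, which separates the two
    equations. *)
Lemma Tc_graph p v : `|p| < eta -> polydisc (fun=> r9) (Xp p) -> M p ->
  (Tc M p v <-> dbar (Xp p) v = 0 /\ wcoord v = dlin (Xp p) v).
Proof.
move=> pe hX Mp.
have N1 x : dbar x (- v) = - dbar x v.
  by apply/eqP; rewrite -addr_eq0 -dbarD addNr /dbar big1// => j _;
    rewrite coord0 [conjc _](_ : _ = 0) ?mul0r//; apply: complex_ext; rewrite /= ?oppr0.
have N2 x : dlin x (- v) = - dlin x v.
  by apply/eqP; rewrite -addr_eq0 -dlinD addNr /dlin big1// => j _;
    rewrite coord0 mul0r.
rewrite -tangent_both// Tc_both !tangent_graph// !dsum !dbarJ !dlinJ N1 N2 /wcoord.
rewrite !coordJ coordN -!/(wcoord _).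
split=> -[h1 h2]; split=> //.
  by rewrite [LHS](_ : _ = - (ci * - wcoord v)); [rewrite h2; ring|ring].
by rewrite mulrN h2; ring.
Qed.

End GraphTangents.

(** * The CR part and the Levi map of a graph *)

Section Dimension.
Context {R : realType}.
Local Notation C := R[i].
Local Notation rc := (real_complex R).

Lemma has_dim_sub m (T : set 'rV[R]_m) d1 d2 :
  has_dim T d1 -> has_dim T d2 -> (d1 <= d2)%N.
Proof.
move=> [B1 f1 E1] [B2 f2 E2].
have : (B1 <= B2)%MS.
  apply/row_subP => i; have : T (row i B1) by rewrite E1 /= row_sub.
  by rewrite E2.
by move=> /mxrankS; rewrite (eqP f1) (eqP f2).
Qed.

Lemma has_dim_unique m (T : set 'rV[R]_m) d1 d2 :
  has_dim T d1 -> has_dim T d2 -> d1 = d2.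
Proof.
by move=> h1 h2; apply/eqP; rewrite eqn_leq (has_dim_sub h1 h2) (has_dim_sub h2 h1).
Qed.

Lemma has_dim_ker m k (l : 'I_k -> 'rV[R]_m -> C) :
  (forall j a u v, l j (a *: u + v) = rc a * l j u + l j v) ->
  (forall c : 'I_k -> C, exists v, forall j, l j v = c j) ->
  has_dim [set v | forall j, l j v = 0] (m - (k + k)).
Proof.
move=> lin surj.
pose L v := mkrow (fun j => l j v).
have Llin : linear L.
  move=> a u v; apply: coord_ext => j.
  by rewrite coordD coordZ !coord_mkrow lin.
pose LL := GRing.isLinear.Build R 'rV[R]_m 'rV[R]_(k + k) *:%R L Llin.
pose f : {linear 'rV[R]_m -> 'rV[R]_(k + k)} := HB.pack L LL.
pose N := lin1_mx f.
have NE v : v *m N = L v by exact: (mul_rV_lin1 f).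
have rN : \rank N = (k + k)%N.
  apply/eqP; rewrite -[_ == _]/(row_full N) -sub1mx; apply/row_subP => i.
  have [v hv] := surj (coord (row i (1%:M : 'M[R]_(k + k)))).
  apply/submxP; exists v; rewrite NE; apply: coord_ext => j.
  by rewrite coord_mkrow hv.
have E : [set v | forall j, l j v = 0] = [set v | (v <= row_base (kermx N))%MS].
  apply/seteqP; split=> v /=; rewrite eq_row_base sub_kermx NE => h.
    by apply/eqP; apply: coord_ext => j; rewrite coord_mkrow h coord0.
  move=> j; move/eqP: h => /(congr1 (fun u => coord u j)).
  by rewrite coord_mkrow coord0.
have <- : \rank (kermx N) = (m - (k + k))%N by rewrite mxrank_ker rN.
by rewrite E; exists (row_base (kermx N)); first exact: row_base_free.
Qed.

End Dimension.

Section BracketType.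
Context {R : realType} {k : nat}.
Local Notation C := R[i].
Local Notation rc := (real_complex R).
Local Notation CN := 'rV[R]_(k + k).

Lemma coord_ran_mul (G G' : CN -> CN) c p :
  (forall q i, coord (G' q) i = c * coord (G q) i) ->
  (forall i, ran (fun q => coord (G q) i) p) ->
  (forall i, ran (fun q => coord (G' q) i) p) /\
  (forall w i, coord ('d G' p w) i = c * coord ('d G p w) i).
Proof.
move=> GG h.
have h' i : ran (fun q => coord (G' q) i) p.
  by apply: ran_ext (ranM (ran_cst c p) (h i)) => q; rewrite GG.
split=> // w i.
have d1 := entries_ran_differentiable (coords_ran h).
have d2 := entries_ran_differentiable (coords_ran h').
apply: (cder_unique (diff_cder w i d2)).
apply: cder_eq (cderZ c (diff_cder w i d1)) => t; by rewrite GG.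
Qed.

(** [u] and [v] stand for fields of type (1,0), in the form [v - i J v]. The
    component of the bracket of type (0,1) is the derivative of the conjugate
    field along the first, since the derivative of the first is of type (1,0).
    *)
Lemma bracket_T01 (u v : CN -> CN) p (a b : CN * CN) :
  (forall i, ran (fun q => coord (u q) i) p) ->
  (forall i, ran (fun q => coord (v q) i) p) ->
  J a.1 = - a.2 -> J b.1 = - b.2 ->
  lie_bracketC (fun q => (v q, - J (v q))) (fun q => conjCV (u q, - J (u q))) p
    = a + conjCV b ->
  forall m, coord b.1 m = coord ('d u p (v p)) m + ci * coord ('d u p (J (v p))) m.
Proof.
move=> ru rv Ja Jb E m.
have EX2 q i : coord (- J (v q)) i = - ci * coord (v q) i by rewrite coordN coordJ mulNr.
have EZ2 q i : coord (- - J (u q)) i = ci * coord (u q) i by rewrite opprK coordJ.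
have [_ dX2] := coord_ran_mul EX2 rv.
have [_ dZ2] := coord_ran_mul EZ2 ru.
have [E1 E2] : lie_bracket v u p - lie_bracket (fun q => - J (v q)) (fun q => - - J (u q)) p
    = a.1 + b.1 /\
    lie_bracket v (fun q => - - J (u q)) p + lie_bracket (fun q => - J (v q)) u p
    = a.2 - b.2.
  by move: E; rewrite /lie_bracketC /= => /pair_equal_spec [-> ->].
have i2 := @ci_sq R.
have {}Ja : coord a.2 m = - (ci * coord a.1 m) by rewrite -coordJ Ja coordN opprK.
have {}Jb : coord b.2 m = - (ci * coord b.1 m) by rewrite -coordJ Jb coordN opprK.
have dN w : coord ('d u p (- w)) m = - coord ('d u p w) m by rewrite linearN coordN.
pose X2 q := - J (v q); pose Z2 q := - - J (u q).
have e1 : coord ('d u p (v p)) m - coord ('d v p (u p)) m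
    - (coord ('d Z2 p (- J (v p))) m - coord ('d X2 p (J (u p))) m)
    = coord a.1 m + coord b.1 m.
  by rewrite -!coordB -coordD -E1 /lie_bracket /X2 /Z2 opprK.
have e2 : coord ('d Z2 p (v p)) m - coord ('d v p (J (u p))) m
    + (coord ('d u p (- J (v p))) m - coord ('d X2 p (u p)) m)
    = coord a.2 m - coord b.2 m.
  by rewrite -!coordB -coordD -E2 /lie_bracket /X2 /Z2 opprK.
have dZN : coord ('d Z2 p (- J (v p))) m = - (ci * coord ('d u p (J (v p))) m).
  by rewrite dZ2 dN mulrN.
have alg (duv duJ dvu dvJ ca cb : C) :
    duv - dvu - (- (ci * duJ) - - ci * dvJ) = ca + cb ->
    ci * duv - dvJ + (- duJ - - ci * dvu) = - (ci * ca) - - (ci * cb) ->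
    cb = duv + ci * duJ.
  move=> h1 h2; apply: (mulfI (@two_neq0 R)).
  have -> : 2 * cb = (ca + cb) - ci * (- (ci * ca) - - (ci * cb)) + (ca - cb) * (- 1 - ci * ci).
    by ring.
  rewrite -h1 -h2 i2 subrr mulr0 addr0.
  have -> : duv - dvu - (- (ci * duJ) - - ci * dvJ) - ci * (ci * duv - dvJ + (- duJ - - ci * dvu))
    = duv - dvu + 2 * (ci * duJ) - ci * ci * duv - ci * ci * dvu by ring.
  by rewrite i2; ring.
apply: (alg _ _ (coord ('d v p (u p)) m) (coord ('d v p (J (u p))) m) (coord a.1 m)).
  rewrite -e1; congr (_ - (_ - _)); first exact: esym dZN.
  exact: esym (dX2 _ _).
rewrite -Ja -Jb -e2; congr (_ - _ + (_ - _)).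
- exact: esym (dZ2 _ _).
- exact: esym (dN _).
- exact: esym (dX2 _ _).
Qed.

End BracketType.

Section CRPart.
Context {R : realType} {n : nat} (hn : (2 <= n)%N).
Local Notation C := R[i].
Local Notation V := ('I_n + 'I_n)%type.
Local Notation o1 := (Ordinal (ltnW hn) : 'I_n).
Local Notation rc := (real_complex R).
Local Notation Cn1 := 'rV[R]_(n.+1 + n.+1).

Implicit Types (p q : Cn1).

Lemma CR_part_open (M : set Cn1) p : CR_part M p ->
  \forall q \near p, M q -> CR_part M q.
Proof.
move=> [Mp [d hd]]; have := near_join hd; apply: filterS => q hq Mq.
by split=> //; exists d.
Qed.

Lemma XpB (p q : Cn1) s : Xp (p - q) s = Xp p s - Xp q s.
Proof. by case: s => j; rewrite /Xp coordB// conjcD conjcN. Qed.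

Lemma Xp_clim (p : Cn1) s : clim (nbhs p) (fun q => Xp q s) (Xp p s).
Proof.
apply/climP => e e0.
have h : 0 < e / 2 by rewrite divr_gt0.
have := nbhsx_ballx p (e / 2) h; apply: filterS => q; rewrite -ball_normE /= => hq.
rewrite -XpB (le_trans (Xp_le _ _))// -ler_pdivlMl// mulrC distrC; exact: ltW.
Qed.

Variables (rho : (V -> C) -> C) (r8 r9 K eta : R).
Variables (Df : V -> (V -> C) -> C) (D2 : 'I_n -> V -> (V -> C) -> C).
Hypothesis r80 : 0 < r8.
Hypothesis r89 : r8 < r9.
Hypothesis gDf : isgrad (fun=> r9) rho Df.
Hypothesis hDf : forall v, hol (fun=> r9) K (Df v).
Hypothesis gD2 : forall k, isgrad (fun=> r8) (Df (inr k)) (D2 k).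
Variable M : set Cn1.
Hypothesis hM : forall p, `|p| < eta -> (M p <-> wcoord p = rho (Xp p)).
Local Notation A := (Df (inr o1)).
Local Notation B := (fun k => Df (inr k)).

Lemma sub89 (x : V -> C) : polydisc (fun=> r8) x -> polydisc (fun=> r9) x.
Proof. by move=> h v; exact: le_trans (h v) (ltW r89). Qed.

Lemma near_r9 p : polydisc (fun=> r8) (Xp p) ->
  \forall q \near p, polydisc (fun=> r9) (Xp q).
Proof.
move=> h; have r0 : 0 < r9 - r8 by rewrite subr_gt0.
have : \forall q \near p, polydisc (fun=> r8 + (r9 - r8)) (Xp q).
  exact: (@near_polydisc _ _ (nbhs p) _ V (fun=> r8) (r9 - r8) (fun q s => Xp q s) _ r0
    (fun s => Xp_clim p s) h).
by apply: filterS => q hq v; rewrite (le_trans (hq v))// subrKC.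
Qed.

Lemma A_neq0_near p : polydisc (fun=> r8) (Xp p) -> A (Xp p) != 0 ->
  \forall q \near p, A (Xp q) != 0.
Proof.
move=> h An; have r0 : 0 < r9 - r8 by rewrite subr_gt0.
have hA : hol (fun _ : V => r8 + (r9 - r8)) K A.
  by apply: hol_le (hDf (inr o1)) => // _; rewrite subrKC// ltW// (lt_trans r80).
have cA : clim (nbhs p) (fun q => A (Xp q)) (A (Xp p)).
  apply: (@hol_clim _ _ (nbhs p) _ _ (fun=> r8) (r9 - r8) K A (fun q s => Xp q s)) => //.
    by move=> _; exact: ltW.
  by move=> v; exact: Xp_clim.
have a0 : 0 < cmod (A (Xp p)).
  by rewrite lt_neqAle cmod_ge0 andbT eq_sym; apply: contra_neq An; exact: cmod_eq0.
have a20 : 0 < cmod (A (Xp p)) / 2 by rewrite divr_gt0.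
move/climP : cA => /(_ _ a20); apply: filterS => q.
apply: contraTneq => ->; rewrite sub0r cmodN -ltNge.
by rewrite ltr_pdivrMr// ltr_pMr// ltr1n.
Qed.

Lemma lin_dbar x a u v : dbar Df x (a *: u + v) = rc a * dbar Df x u + dbar Df x v.
Proof.
rewrite dbarD; congr (_ + _); rewrite /dbar mulr_sumr; apply: eq_bigr => j _.
by rewrite coordZ conjcM conjc_rc mulrA.
Qed.
Lemma lin_dlin x a u v : dlin Df x (a *: u + v) = rc a * dlin Df x u + dlin Df x v.
Proof.
rewrite dlinD; congr (_ + _); rewrite /dlin mulr_sumr; apply: eq_bigr => j _.
by rewrite coordZ mulrA.
Qed.
Lemma lin_wcoord a (u v : Cn1) : wcoord (a *: u + v) = rc a * wcoord u + wcoord v.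
Proof. by rewrite /wcoord coordD coordZ. Qed.

Lemma dlin_mkp x c w : dlin Df x (mkp c w) = \sum_j c j * Df (inl j) x.
Proof. by apply: eq_bigr => j _; rewrite coord_mkp. Qed.
Lemma dbar_mkp x c w : dbar Df x (mkp c w) = \sum_j conjc (c j) * Df (inr j) x.
Proof. by apply: eq_bigr => j _; rewrite coord_mkp. Qed.

(** Two complex equations, one antilinear and one linear; they are independent
    because [A] is the coefficient of [conj v_1] in the first. *)
Lemma Tc_dim4 p : `|p| < eta -> polydisc (fun=> r9) (Xp p) -> M p ->
  A (Xp p) != 0 -> has_dim (Tc M p) (n.+1 + n.+1 - (2 + 2)).
Proof.
move=> pe hX Mp An; set x := Xp p.
pose l (j : 'I_2) (v : Cn1) := if j == 0 then dbar Df x v else wcoord v - dlin Df x v.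
have -> : Tc M p = [set v | forall j, l j v = 0].
  apply/seteqP; split=> v /=.
    move=> /(Tc_graph gDf hM v pe hX Mp)[h1 h2] j; rewrite /l h1 h2 subrr.
    by case: ifP.
  move=> h; apply/(Tc_graph gDf hM v pe hX Mp); split.
    by have := h 0; rewrite /l eqxx.
  by have /eqP := h 1; rewrite /l /= subr_eq0 => /eqP.
apply: has_dim_ker => [j a u v|c]; rewrite /l.
  by case: ifP => _; rewrite ?lin_dbar// lin_wcoord lin_dlin; ring.
pose z (j : 'I_n) : C := if j == o1 then conjc (c 0 / A x) else 0.
exists (mkp z (c 1 + \sum_j z j * Df (inl j) x)) => j; case: eqP => [->|/eqP j0].
  rewrite dbar_mkp (bigD1 o1)//= big1 ?addr0.
    by rewrite /z eqxx conjcK divfK.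
  by move=> i /negbTE io; rewrite /z io conjc0 mul0r.
rewrite dlin_mkp wcoord_mkp addrK; congr c.
by apply/eqP; case: j j0 => -[|[|m]].
Qed.

Lemma Tc_dim2 p : `|p| < eta -> polydisc (fun=> r9) (Xp p) -> M p ->
  (forall k, B k (Xp p) = 0) -> has_dim (Tc M p) (n.+1 + n.+1 - (1 + 1)).
Proof.
move=> pe hX Mp B0; set x := Xp p.
pose l (j : 'I_1) (v : Cn1) := wcoord v - dlin Df x v.
have db v : dbar Df x v = 0 by rewrite /dbar big1// => j _; rewrite B0 mulr0.
have -> : Tc M p = [set v | forall j, l j v = 0].
  apply/seteqP; split=> v /=.
    by move=> /(Tc_graph gDf hM v pe hX Mp)[h1 h2] j; rewrite /l h2 subrr.
  move=> h; apply/(Tc_graph gDf hM v pe hX Mp); split; first exact: db.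
  by have /eqP := h 0; rewrite /l /= subr_eq0 => /eqP.
apply: has_dim_ker => [j a u v|c]; rewrite /l.
  by rewrite lin_wcoord lin_dlin; ring.
exists (mkp (fun=> 0) (c 0)) => j; rewrite dlin_mkp wcoord_mkp big1 ?subr0 ?ord1//.
by move=> i _; rewrite mul0r.
Qed.

Lemma CR_part_A p : `|p| < eta -> polydisc (fun=> r8) (Xp p) -> M p ->
  A (Xp p) != 0 -> CR_part M p.
Proof.
move=> pe hX Mp An; split=> //; exists (n.+1 + n.+1 - (2 + 2))%N.
have n1 := near_norm_lt pe; have n2 := near_r9 hX; have n3 := A_neq0_near hX An.
near=> q => Mq; apply: Tc_dim4 => //.
- by near: q; exact: n1.
- by near: q; exact: n2.
- by near: q; exact: n3.
Unshelve. all: by end_near. Qed.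

Lemma isT10 q v : `|q| < eta -> polydisc (fun=> r9) (Xp q) -> CR_part M q ->
  dbar Df (Xp q) v = 0 -> wcoord v = dlin Df (Xp q) v ->
  T10 (CR_part M) q (v, - J v).
Proof.
move=> qe hX CRq h1 h2; have [Mq _] := CRq.
have [t1 t2] : tangent M q v /\ tangent M q (J (- v)).
  by apply/Tc_both; apply/(Tc_graph gDf hM v qe hX Mq).
have germ := tangent_germ (CR_part_open CRq).
split=> /=; first exact: germ.
- by rewrite -JN; exact: germ.
- by rewrite opprK.
- by rewrite -JN JJ opprK.
Qed.

Lemma delta_sum (k : 'I_n) (c : C) (F : 'I_n -> C) :
  \sum_m ((m == k)%:R * c) * F m = c * F k.
Proof.
rewrite (bigD1 k)//= eqxx mul1r big1 ?addr0// => m /negbTE ->.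
by rewrite !mul0r.
Qed.

Lemma conjc_nat (b : bool) : conjc (b%:R : C) = b%:R.
Proof. by case: b; apply: complex_ext; rewrite /= ?oppr0. Qed.

(** The field [conj A e_j - conj B_j e_1], lifted to the graph. *)
Definition vf (j : 'I_n) (q : Cn1) : Cn1 :=
  let a m := (m == j)%:R * conjc (A (Xp q)) - (m == o1)%:R * conjc (B j (Xp q)) in
  mkp a (\sum_m a m * Df (inl m) (Xp q)).

Lemma vf_tangent j q : dbar Df (Xp q) (vf j q) = 0 /\
  wcoord (vf j q) = dlin Df (Xp q) (vf j q).
Proof.
split; last by rewrite dlin_mkp wcoord_mkp.
rewrite dbar_mkp.
under eq_bigr do rewrite conjcD conjcN !conjcM !conjc_nat !conjcK mulrBl.
by rewrite sumrB !delta_sum mulrC subrr.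
Qed.

Lemma Df_ran v p : polydisc (fun=> r8) (Xp p) -> ran (fun q => Df v (Xp q)) p.
Proof.
move=> hX; apply: (@ran_hol _ _ V (fun=> r9) K (Df v) (fun s q => Xp q s)) => //.
  by move=> s; exact: Xp_ran.
by move=> s; exact: le_lt_trans (hX s) r89.
Qed.

Lemma vf_ran j p : polydisc (fun=> r8) (Xp p) ->
  forall i, ran (fun q => coord (vf j q) i) p.
Proof.
move=> hX.
have ra m : ran (fun q : Cn1 => (m == j)%:R * conjc (A (Xp q))
    - (m == o1)%:R * conjc (B j (Xp q))) p.
  apply: ranD; first by apply: ranM; [exact: ran_cst|exact/ran_conj/Df_ran].
  by apply: ranN; apply: ranM; [exact: ran_cst|exact/ran_conj/Df_ran].
apply: mkp_ran => //; apply: ran_sum => m; apply: ranM => //; exact: Df_ran.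
Qed.

Hypothesis flat : Levi_flat M.

(** By flatness the bracket of [vf j] with the conjugate of [vf k] has its
    component of type (0,1) in the tangent space. Its antilinear equation [dbar]
    is the Levi form, up to the factor 2. *)
Lemma levi_real p j k : `|p| < eta -> polydisc (fun=> r8) (Xp p) -> M p ->
  A (Xp p) != 0 -> levi_form hn Df D2 j k (Xp p) = 0.
Proof.
move=> pe hX8 Mp An; have hX := sub89 hX8.
have CRp := CR_part_A pe hX8 Mp An.
pose u := vf k; pose v := vf j.
have ru := vf_ran k hX8; have rv := vf_ran j hX8; rewrite -/u -/v in ru rv.
have EJ (G : Cn1 -> Cn1) q i : coord (- J (G q)) i = - ci * coord (G q) i.
  by rewrite coordN coordJ mulNr.
have [rX2 _] := coord_ran_mul (EJ v) rv.
have [rY2 _] := coord_ran_mul (EJ u) ru.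
have sec j' : (forall i, ran (fun q => coord (- J (vf j' q)) i) p) ->
    T10_section (CR_part M) p (fun q => (vf j' q, - J (vf j' q))).
  move=> rJ; split.
  - exact/entries_ran_analytic/coords_ran/vf_ran.
  - exact/entries_ran_analytic/coords_ran.
  - have n1 := near_norm_lt pe; have n2 := near_r9 hX8.
    near=> q => CRq; have [h1 h2] := vf_tangent j' q; apply: isT10 => //.
      by near: q; exact: n1.
    by near: q; exact: n2.
have [a [b [[_ _ Ja _] [tb1 tb2 Jb _] E]]] := flat CRp (sec j rX2) (sec k rY2).
have cb := bracket_T01 ru rv Ja Jb E.
have TM : tangent M p b.1 /\ tangent M p (J (- b.1)).
  have sub : \forall q \near p, CR_part M q -> M q by near=> q => -[].
  split; first exact: tangent_germ sub tb1.
  by rewrite JN Jb opprK; exact: tangent_germ sub tb2.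
move/Tc_both : TM => /(Tc_graph gDf hM _ pe hX Mp)[db _].
set x := Xp p in db An *.
pose S k' w := \sum_s Xp w s * D2 k' s x.
have dS k' w : cder (fun t => B k' (Xp (p + t *: w))) 0 (S k' w).
  have gd s : cder (fun t => Xp (p + t *: w) s) 0 (Xp w s).
    rewrite -[X in cder _ _ X]add0r.
    apply: (@cder_eq _ (fun t => Xp p s + rc t * Xp w s)).
      by move=> t; rewrite XpD XpZ.
    apply: cderD; first exact: cder_cst.
    by have := cderM (cder_id 0) (cder_cst (Xp w s) 0); rewrite mul1r mulr0 addr0.
  have x0 : (fun s => Xp (p + 0 *: w) s) = x by rewrite scale0r addr0.
  have hx0 : polydisc (fun=> r8) (fun s => Xp (p + 0 *: w) s) by rewrite x0.
  by have := gD2 k' gd hx0; rewrite x0.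
have du w m : conjc (coord ('d u p w) (wid m))
    = (m == k)%:R * S o1 w - (m == o1)%:R * S k w.
  have d1 := diff_cder w (wid m) (entries_ran_differentiable (coords_ran ru)).
  have d2 := cderD (cderZ (m == k)%:R (cder_conj (dS o1 w)))
    (cderN (cderZ (m == o1)%:R (cder_conj (dS k w)))).
  have E3 : coord ('d u p w) (wid m)
      = (m == k)%:R * conjc (S o1 w) - (m == o1)%:R * conjc (S k w).
    apply: (cder_unique d1); apply: cder_eq d2 => t.
    by rewrite /u /vf coord_mkp.
  by rewrite E3 conjcD conjcN !conjcM !conjc_nat !conjcK.
pose T k' := \sum_l coord (v p) (wid l) * D2 k' (inl l) x.
have ST k' : S k' (v p) - ci * S k' (J (v p)) = 2 * T k'.
  rewrite /S !big_sumType /=.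
  have -> : \sum_l Xp (J (v p)) (inl l) * D2 k' (inl l) x = ci * T k'.
    by rewrite mulr_sumr; apply: eq_bigr => l _; rewrite /Xp coordJ mulrA.
  have -> : \sum_l Xp (J (v p)) (inr l) * D2 k' (inr l) x
      = - ci * \sum_l Xp (v p) (inr l) * D2 k' (inr l) x.
    rewrite mulr_sumr; apply: eq_bigr => l _.
    by rewrite /Xp coordJ conjcM conjc_i mulrA.
  have -> : \sum_l Xp (v p) (inl l) * D2 k' (inl l) x = T k' by [].
  set t2 := \sum_l Xp (v p) (inr l) * _.
  rewrite [LHS](_ : _ = T k' - ci * ci * T k' + (1 + ci * ci) * t2); last by ring.
  by rewrite ci_sq; ring.
have cbm m : conjc (coord b.1 (wid m)) = (m == k)%:R * (2 * T o1) - (m == o1)%:R * (2 * T k).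
  by rewrite cb conjcD conjcM conjc_i !du -!ST; ring.
have TE k' : T k' = conjc (A x) * D2 k' (inl j) x - conjc (B j x) * D2 k' (inl o1) x.
  rewrite /T /v /vf.
  under eq_bigr do rewrite coord_mkp mulrBl.
  by rewrite sumrB !delta_sum.
have : 2 * T o1 * B k x - 2 * T k * A x = 0.
  rewrite -db /dbar.
  under [in RHS]eq_bigr do rewrite cbm mulrBl.
  by rewrite sumrB !delta_sum.
have -> : 2 * T o1 * B k x - 2 * T k * A x = 2 * (T o1 * B k x - T k * A x) by ring.
move=> /eqP; rewrite mulf_eq0 (negbTE (@two_neq0 R)) /= => /eqP h.
rewrite /levi_form !star_real ?sw_Xp//.
rewrite [LHS](_ : _ = - (T o1 * B k x - T k * A x)); first by rewrite h oppr0.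
by rewrite !TE; ring.
Unshelve. all: by end_near. Qed.

End CRPart.

(** * The foliation and its parametrization *)

Section Chart.
Context {R : realType} {n : nat} (hn : (2 <= n)%N).
Local Notation C := R[i].
Local Notation V := ('I_n + 'I_n)%type.
Local Notation o1 := (Ordinal (ltnW hn) : 'I_n).
Local Notation o2 := (Ordinal hn : 'I_n).
Local Notation rc := (real_complex R).

Variables (delta e : R) (eps : C) (E : (V -> C) -> C).
Hypothesis d0 : 0 < delta.
Hypothesis e0 : 0 <= e.
Hypothesis e1 : e <= 1 / 1000.
Hypothesis eps1 : cmod eps <= 1.
Hypothesis hE : hol (fun _ : V => 10 * delta) (e * delta ^+ 2) E.
Local Ltac dlra := have := d0; have := e0; have := e1; lra.
Local Notation rS := (rS hn delta).
Local Notation line := (line hn delta).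
Local Notation bz := (bz hn delta).
Local Notation bb := (bb hn delta).
Local Notation fC := (fC hn eps E).

Local Notation Cn1 := 'rV[R]_(n.+1 + n.+1).
Local Notation dom := 'rV[R]_(2 + (n.-1 + n.-1)).

Variables (H Ts Tsg : (V -> C) -> C).
Hypothesis hH : hol rS (delta / 8) H.
Hypothesis eqH : forall x, polydisc rS x -> forall u, cmod u <= delta / 8 ->
    (fC (bz x u) = fC (bb x) <-> u = H x).
Local Notation rT := (rT hn delta).
Local Notation rB := (rB hn delta).
Local Notation repl := (repl hn).
Hypothesis hTs : hol rT (delta / 16) Ts.
Hypothesis eqT : forall x, polydisc rT x -> forall s sigma,
    cmod s <= delta / 16 -> cmod sigma <= delta / 16 ->
    (H (repl x s sigma) = x (inr o1) /\ star H (repl x s sigma) = x (inl o1))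
    <-> (s = Ts x /\ sigma = Tsg x).
Hypothesis hTsg : hol rT (delta / 16) Tsg.

Variables (K : R) (Df : V -> (V -> C) -> C) (D2 : 'I_n -> V -> (V -> C) -> C).
Hypothesis hDf : forall v, hol (fun=> 9 * delta) K (Df v).
Hypothesis gDf : isgrad (fun=> 9 * delta) fC Df.
Hypothesis hD2 : forall k v, hol (fun=> 8 * delta) K (D2 k v).
Hypothesis gD2 : forall k, isgrad (fun=> 8 * delta) (Df (inr k)) (D2 k).
Local Notation A := (Df (inr o1)).
Local Notation B := (fun k => Df (inr k)).
Hypothesis A_approx : forall x, polydisc (fun=> 9 * delta) x ->
  cmod (A x - (x (inl o2) + 2 * eps * x (inr o1))) <= 3 * e * delta.
Hypothesis levi0 : forall x, polydisc (fun=> 8 * delta) x -> sw x = x ->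
  A x != 0 -> forall j k, levi_form hn Df D2 j k x = 0.
Local Notation Psi := (Psi hn H).
Local Notation Pt := (Pt hn delta H).

Lemma tangentB x k : polydisc rB x -> B k (Psi x) = A (Psi x) * (B k (Pt x) / A (Pt x)).
Proof. move=> hx; exact: (segre_tangent d0 e0 e1 eps1 hH eqH hDf gDf hD2 gD2 A_approx levi0 k hx). Qed.

Lemma rB_ltS s : rB s < rS s.
Proof. by case: s => j /=; case: ifP => _; dlra. Qed.
Lemma rBS x : polydisc rB x -> polydisc rS x.
Proof. by move=> h s; exact: le_trans (h s) (ltW (rB_ltS s)). Qed.
Lemma rBH x : polydisc rB x -> polydisc (rH hn delta) x.
Proof. exact: (rB_rH d0 e0 e1). Qed.

(** The slopes of the Segre variety of [x] with respect to the antiholomorphic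
    coordinates. *)
Definition slope (x : V -> C) (k : 'I_n) : C := B k (Pt x) / A (Pt x).

Lemma APt x : polydisc rB x -> A (Pt x) != 0.
Proof.
by move=> /rBS h; case: (A_Pt d0 e0 e1 eps1 hH A_approx h).
Qed.

(** The motion of the first coordinate along a leaf when the others move by [d].
    *)
Definition dleaf (x : V -> C) (d : 'I_n -> C) : C :=
  - \sum_(k | k != o1) d k * conjc (slope x k).

(** By [tangentB] the antiholomorphic part of the derivative of [fC] cancels
    along a leaf: only derivatives in [z] remain, so the graph over a leaf moves
    holomorphically. *)
Lemma leaf_cder (g : V -> R -> C) t0 (d : 'I_n -> C) :
  (forall j, cder (g (inl j)) t0 (d j)) ->
  (forall j, cder (g (inr j)) t0 (conjc (d j))) ->
  polydisc rB (fun v => g v t0) -> sw (fun v => g v t0) = (fun v => g v t0) ->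
  (forall t, g (inl o1) t = g (inl o1) t0) ->
  (forall t, g (inr o1) t = g (inr o1) t0) ->
  let x := fun v => g v t0 in
  cder (fun t => star H (fun v => g v t)) t0 (dleaf x d) /\
  cder (fun t => fC (Psi (fun v => g v t))) t0
    (dleaf x d * Df (inl o1) (Psi x) + \sum_(k | k != o1) d k * Df (inl k) (Psi x)).
Proof.
move=> gl gr hx swx cl cr x.
pose dd (s : V) : C := match s with inl j => d j | inr j => conjc (d j) end.
have gd s : cder (g s) t0 (dd s) by case: s.
have hxH := rBH hx.
have [w hw ew] := starH_cder d0 e0 e1 hH eqH gDf gd hxH cl cr.
have [h hh eh] := H_cder d0 e0 e1 hH eqH gDf gd hxH cl cr.
rewrite swx -/x in ew; rewrite -/x in eh.
have An : A (Pt x) != 0 by exact: APt.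
have cAn : conjc (A (Pt x)) != 0.
  by apply: contra_neq An => E0; rewrite -[A _]conjcK E0; apply: complex_ext; rewrite /= ?oppr0.
have conjV (a : C) : conjc a^-1 = (conjc a)^-1.
  by case: a => p q; apply: complex_ext; rewrite /= sqrrN ?mulNr.
have wE : w = dleaf x d.
  apply: (mulfI cAn); rewrite /dleaf mulrN; apply/eqP; rewrite -addr_eq0; apply/eqP.
  rewrite -[RHS]ew; congr (_ + _); rewrite mulr_sumr; apply: eq_bigr => k _.
  rewrite /slope conjcM conjV [conjc (A _) * _]mulrC -!mulrA mulVf// mulr1.
  by [].
rewrite -wE; split=> //.
pose y (s : V) (t : R) : C := match s with
  | inl j => if j == o1 then star H (g^~ t) else g (inl j) t
  | inr j => if j == o1 then H (g^~ t) else g (inr j) t end.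
pose dy (s : V) : C := match s with
  | inl j => if j == o1 then w else d j
  | inr j => if j == o1 then h else conjc (d j) end.
have yd s : cder (y s) t0 (dy s) by case: s => j; rewrite /y /dy; case: (j == o1).
have yE t : (fun s => y s t) = Psi (g^~ t) by apply/funext => -[j|j].
have hPsi : polydisc (fun=> 9 * delta) (y^~ t0).
  by rewrite yE; apply: (sub39 d0 e0 e1); apply: (Psi_polydisc d0 e0 e1 hH); exact: rBS.
have := gDf yd hPsi; rewrite yE -/x => D.
have -> : w * Df (inl o1) (Psi x) + \sum_(k | k != o1) d k * Df (inl k) (Psi x)
   = \sum_v dy v * Df v (Psi x).
  have -> : \sum_v dy v * Df v (Psi x) =
      (w * Df (inl o1) (Psi x) + \sum_(i < n | i != o1)
         (if i == o1 then w else d i) * Df (inl i) (Psi x)) +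
      (h * A (Psi x) + \sum_(i < n | i != o1)
         (if i == o1 then h else conjc (d i)) * B i (Psi x)).
    by rewrite big_sumType; congr (_ + _); rewrite (bigD1 o1)// [dy _]/= eqxx.
  have -> : \sum_(i < n | i != o1) (if i == o1 then w else d i) * Df (inl i) (Psi x)
     = \sum_(k | k != o1) d k * Df (inl k) (Psi x).
    by apply: eq_bigr => k /negbTE ->.
  have -> : h * A (Psi x) + \sum_(i < n | i != o1)
      (if i == o1 then h else conjc (d i)) * B i (Psi x) = 0.
    have hE' : h + \sum_(k | k != o1) conjc (d k) * slope x k = 0.
      apply: (mulfI An); rewrite mulrDr mulr0 -[RHS]eh; congr (_ + _).
      rewrite mulr_sumr; apply: eq_bigr => k _.
      by rewrite /slope mulrCA [A _ * _]mulrC divfK.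
    transitivity (A (Psi x) * (h + \sum_(k | k != o1) conjc (d k) * slope x k)).
      rewrite mulrDr mulr_sumr mulrC; congr (_ + _); apply: eq_bigr => k /negbTE ->.
      by rewrite (tangentB k hx) -/(slope x k); ring.
    by rewrite hE' mulr0.
  by rewrite addr0.
by apply: cder_eq D => t; rewrite yE.
Qed.

(** The equation for [H] is [delta H = delta xi_1] up to terms bounded by a
    small multiple of [delta^2]. *)
Lemma H_close x : polydisc rS x -> cmod (H x - x (inr o1)) <= 22 / 1000 * delta.
Proof.
move=> hx; have hHx := H_le hH hx.
have [_ W] := eqH hx hHx; have := W erefl; rewrite (fC_bz hn) (fC_bb hn) => E1.
have dd := rc_dV d0.
set u := H x in E1 hHx *; set s := x (inr o1) in E1 *.
have hs : cmod s <= delta / 16 by exact: rS_xi1 hx.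
have -> : u - s = rc delta^-1 * (eps * (s ^+ 2 - u ^+ 2) + (E (bb x) - E (bz x u))).
  have dn : rc delta != 0.
    by apply: contra_eqN dd => /eqP ->; rewrite mul0r eq_sym oner_eq0.
  apply: (mulfI dn); rewrite mulrA dd mul1r.
  rewrite [LHS](_ : _ = (rc delta * u + eps * u ^+ 2 + E (bz x u)) - rc delta * s
     - eps * u ^+ 2 - E (bz x u)); last by ring.
  by rewrite E1; ring.
rewrite (le_trans (cmodM _ _))// cmodR gtr0_norm ?invr_gt0//.
apply: (scaled_le d0).
have b1 : cmod (E (bb x)) <= e * delta ^+ 2.
  apply: hol_bound hE _ => v; apply: le_trans (bb_polydisc d0 e0 e1 hx v) _; dlra.
have b2 : cmod (E (bz x u)) <= e * delta ^+ 2.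
  apply: hol_bound hE _ => v; apply: le_trans (bz_polydisc d0 e0 e1 hx hHx v) _; dlra.
have b3 : cmod (eps * (s ^+ 2 - u ^+ 2)) <=
    1 * (delta / 16 * (delta / 16) + delta / 8 * (delta / 8)).
  rewrite (le_trans (cmodM _ _))// ler_pM ?cmod_ge0// (le_trans (cmodB _ _))// lerD//.
    by rewrite (le_trans (cmodM _ _))// ler_pM ?cmod_ge0.
  by rewrite (le_trans (cmodM _ _))// ler_pM ?cmod_ge0.
have b4 : e * delta ^+ 2 <= 1 / 1000 * delta ^+ 2 by rewrite ler_wpM2r// sqr_ge0.
have b5 : 0 <= delta ^+ 2 by exact: sqr_ge0.
have := cmodD (eps * (s ^+ 2 - u ^+ 2)) (E (bb x) - E (bz x u)).
have := cmodB (E (bb x)) (E (bz x u)).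
move: b3 b4 b5; rewrite !expr2; lra.
Qed.

Variable etaW : R.
Hypothesis etaW0 : 0 < etaW.
Hypothesis etaW1 : 2 * etaW <= delta / 200.

Lemma Xp_small (p : Cn1) s : `|p| < etaW -> cmod (Xp p s) < delta / 200.
Proof.
move=> hp; apply: le_lt_trans (Xp_le p s) _; apply: lt_le_trans etaW1.
by rewrite ltr_pM2l.
Qed.

Lemma rT_gt s : delta / 200 < rT s.
Proof. by case: s => j /=; case: ifP => _; dlra. Qed.

Lemma Xp_rT (p : Cn1) : `|p| < etaW -> polydisc rT (Xp p).
Proof. by move=> hp s; exact: ltW (lt_trans (Xp_small s hp) (rT_gt s)). Qed.

Lemma Xp_delta (p : Cn1) c : 1 <= c -> `|p| < etaW -> polydisc (fun=> c * delta) (Xp p).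
Proof.
move=> c1 hp s; apply: le_trans (ltW (Xp_small s hp)) _.
have : 1 * delta <= c * delta by rewrite ler_wpM2r// ltW.
dlra.
Qed.

(** At a real point the pair of labels and its reflected conjugate solve the
    same equations. *)
Lemma T_real (p : Cn1) : `|p| < etaW -> Tsg (Xp p) = conjc (Ts (Xp p)).
Proof.
move=> hp; have hX := Xp_rT hp.
have b1 : cmod (Ts (Xp p)) <= delta / 16 by exact: hol_bound hTs hX.
have b2 : cmod (Tsg (Xp p)) <= delta / 16 by exact: hol_bound hTsg hX.
have [_ /(_ (conj erefl erefl)) [h1 h2]] := eqT hX b1 b2.
have b1' : cmod (conjc (Tsg (Xp p))) <= delta / 16 by rewrite cmod_conj.
have b2' : cmod (conjc (Ts (Xp p))) <= delta / 16 by rewrite cmod_conj.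
have [W _] := eqT hX b1' b2'.
have E1 : repl (Xp p) (conjc (Tsg (Xp p))) (conjc (Ts (Xp p)))
    = sw (repl (Xp p) (Ts (Xp p)) (Tsg (Xp p))) by rewrite sw_repl sw_Xp.
have [|W1 W2] := W; last by rewrite W2.
rewrite E1; split.
  have <- : conjc (star H (repl (Xp p) (Ts (Xp p)) (Tsg (Xp p)))) = Xp p (inr o1) by rewrite h2.
  by rewrite /star conjcK.
by rewrite /star swK h1; exact: conjcK.
Qed.

Definition yp (p : Cn1) : V -> C := repl (Xp p) (Ts (Xp p)) (conjc (Ts (Xp p))).

(** By [H_close] the label differs so little from the first coordinate that it
    stays within the radius [delta / 32] of [rB]. *)
Lemma Ts_small (p : Cn1) : `|p| < etaW -> cmod (Ts (Xp p)) < delta / 32.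
Proof.
move=> hp; have hX := Xp_rT hp.
have b1 : cmod (Ts (Xp p)) <= delta / 16 by exact: hol_bound hTs hX.
have b2 : cmod (Tsg (Xp p)) <= delta / 16 by exact: hol_bound hTsg hX.
have [_ /(_ (conj erefl erefl)) [h1 h2]] := eqT hX b1 b2.
have := H_close (repl_polydisc hX b1 b2).
rewrite h1 [repl _ _ _ (inr o1)]/= T_real// => h3.
have h4 := Xp_small (inr o1) hp.
rewrite -cmod_conj [X in cmod X](_ : _ = Xp p (inr o1) - (Xp p (inr o1) - conjc (Ts (Xp p))));
  last by ring.
apply: le_lt_trans (cmodB _ _) _; dlra.
Qed.

Lemma yp_rB (p : Cn1) : `|p| < etaW -> polydisc rB (yp p).
Proof.
move=> hp; have h1 := Ts_small hp.
move=> [j|j]; have := Xp_small (inl j) hp; have := Xp_small (inr j) hp;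
  rewrite /yp /repl /rB; case: ifP => _ h2 h3; rewrite ?cmod_conj; dlra.
Qed.

Lemma Psi_yp (p : Cn1) : `|p| < etaW -> Psi (yp p) = Xp p.
Proof.
move=> hp; have hX := Xp_rT hp.
have b1 : cmod (Ts (Xp p)) <= delta / 16 by exact: hol_bound hTs hX.
have b2 : cmod (Tsg (Xp p)) <= delta / 16 by exact: hol_bound hTsg hX.
have [_ /(_ (conj erefl erefl)) [h1 h2]] := eqT hX b1 b2.
rewrite T_real// in h1 h2.
apply/funext => -[j|j]; rewrite /Psi /yp [LHS]/=; case: eqP => [->|//].
  by rewrite h2.
by rewrite h1.
Qed.

Lemma sw_yp (p : Cn1) : sw (yp p) = yp p.
Proof. by rewrite /yp sw_repl sw_Xp conjcK. Qed.

Lemma Ts_Psi (p : Cn1) y : `|p| < etaW -> polydisc rB y -> sw y = y ->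
  Psi y = Xp p -> y (inl o1) = Ts (Xp p).
Proof.
move=> hp hy swy E1; have hX := Xp_rT hp.
have y1 : cmod (y (inl o1)) <= delta / 16 by exact: rS_z1 (rBS hy).
have y2 : cmod (y (inr o1)) <= delta / 16 by exact: rS_xi1 (rBS hy).
have [W _] := eqT hX y1 y2.
have E2 : repl (Xp p) (y (inl o1)) (y (inr o1)) = y.
  apply/funext => -[j|j]; rewrite -E1 /Psi /=; case: eqP => // ->//.
have [|] := W; last by [].
by rewrite E2 -E1; split.
Qed.

(** Only real [x] give points of [M]. *)
Definition graph_pt (x : V -> C) : Cn1 := mkp (fun j => x (inl j)) (fC x).

Lemma graph_pt_is_derive (g : V -> R -> C) t0 (v : Cn1) :
  (forall s, cder (g s) t0 (Xp v s)) -> polydisc (fun=> 9 * delta) (g^~ t0) ->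
  wcoord v = \sum_s Xp v s * Df s (g^~ t0) ->
  is_derive t0 1 (fun t => graph_pt (g^~ t)) v.
Proof.
move=> h1 h2 h3.
apply: (@mkp_is_derive _ _ (fun j => g (inl j)) (fun t => fC (g^~ t))) => [j|].
  exact: h1 (inl j).
by rewrite h3; exact: gDf.
Qed.

Variable M : set Cn1.
Hypothesis hM : forall p : Cn1, `|p| < etaW -> (M p <-> wcoord p = fC (Xp p)).
Hypothesis MW : forall p : Cn1, M p -> `|p| < etaW.

Lemma graph_pt_Xp p : M p -> graph_pt (Xp p) = p.
Proof.
move=> Mp; have /hM := MW Mp => -[/(_ Mp) E1 _].
by apply: mkp_ext => [j|]; rewrite ?coord_mkp// wcoord_mkp.
Qed.

Lemma M_graph_pt x : sw x = x -> `|graph_pt x| < etaW -> M (graph_pt x).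
Proof. by move=> sx hx; apply/hM => //; rewrite wcoord_mkp real_pt. Qed.

Lemma Xp9 p : M p -> polydisc (fun=> 9 * delta) (Xp p).
Proof. by move=> /MW; apply: Xp_delta; lra. Qed.

Lemma B_Xp (p : Cn1) k : `|p| < etaW ->
  B k (Xp p) = A (Xp p) * slope (yp p) k.
Proof. by move=> hp; rewrite -(Psi_yp hp); exact: tangentB (yp_rB hp). Qed.

(** If [A] vanishes at [p], then so do all [B k] by [B_Xp], and [T^c] has
    complex codimension 1 at [p]. It has complex codimension 2 where [A <> 0].
    The points [p + t e_2] provide such a contradiction for small [t]: otherwise
    [A] would vanish on the whole complex line, whereas it is close to [delta]
    at [t = delta]. *)
Lemma CR_A p : CR_part M p -> A (Xp p) != 0.
Proof.
move=> [Mp [d hd]]; have hp := MW Mp; apply/negP => /eqP Ap0.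
have d2 : has_dim (Tc M p) (n.+1 + n.+1 - (1 + 1)).
  by apply: (Tc_dim2 gDf hM) => // [|k]; [exact: Xp9|rewrite B_Xp// Ap0 mul0r].
have dE : d = (n.+1 + n.+1 - (1 + 1))%N.
  exact: has_dim_unique (nbhs_singleton hd Mp) d2.
pose b (s : V) : C := match s with inl j | inr j => if j == o2 then rc delta else 0 end.
pose g (s : V) (t : R) : C := Xp p s + rc t * b s.
pose v : Cn1 := mkp (fun j => b (inl j)) (\sum_s b s * Df s (Xp p)).
have swb s : conjc (b s) = b (swp s).
  by case: s => j /=; case: ifP; rewrite ?conjc_rc//; rewrite /= oppr0.
have Xv s : Xp v s = b s.
  by rewrite Xp_mkp; case: s => j //; rewrite swb.
have g0 : g^~ 0 = Xp p.
  by apply/funext => s; rewrite /g mul0r addr0.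
have swg t : sw (g^~ t) = g^~ t.
  apply/funext => s; rewrite /sw /g conjcD conjcM conjc_rc swb swpK.
  by rewrite -[conjc _]/(sw (Xp p) s) sw_Xp.
have gd : is_derive (0 : R) (1 : R) (fun t => graph_pt (g^~ t)) v.
  apply: graph_pt_is_derive => [s||].
  - by rewrite Xv; exact: rc_lin_cder.
  - by rewrite g0; exact: Xp9.
  - by rewrite wcoord_mkp g0; apply: eq_bigr => s _; rewrite Xv.
have := is_derive_cvg gd; rewrite g0 (graph_pt_Xp Mp) => gc.
have n1 : \forall t \near (0 : R), `|graph_pt (g^~ t)| < etaW := gc _ (near_norm_lt hp).
have n2 : \forall t \near (0 : R), M (graph_pt (g^~ t)) -> has_dim (Tc M (graph_pt (g^~ t))) d := gc _ hd.
have n3 : \forall t \near (0 : R), A (g^~ t) = 0.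
  near=> t.
  have h1 : `|graph_pt (g^~ t)| < etaW by near: t; exact: n1.
  have h2 : M (graph_pt (g^~ t)) -> has_dim (Tc M (graph_pt (g^~ t))) d by near: t; exact: n2.
  have Mt := M_graph_pt (swg t) h1.
  have XE : Xp (graph_pt (g^~ t)) = g^~ t by exact: real_pt.
  apply/eqP/negPn/negP => An; rewrite -XE in An.
  have := has_dim_unique (h2 Mt) (Tc_dim4 gDf hM h1 (Xp9 Mt) Mt An).
  have n0 : (0 < n)%N by exact: ltnW.
  rewrite dE !addSn !addnS !addn0 !subSS subn0 => /eqP.
  by apply/negP; rewrite gtn_eqF// ltn_subrL addn_gt0 n0.
have [eta /= eta0 heta] : exists2 eta : R, 0 < eta & forall t, `|t| < eta -> A (g^~ t) = 0.
  have [r /= r0 hr] := n3; exists r => // t tr; apply: hr.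
  by rewrite /ball_ /= sub0r normrN.
(* radius 2 on the line, as the point of interest is at parameter 1 *)
have z0 : A (fun s => Xp p s + 1 * b s) = 0.
  apply: (@identity_line _ _ _ K A (Xp p) b 2 (eta / 2) (hDf (inr o1))).
  - move=> s; have := Xp_small s hp.
    have : cmod (b s) <= delta by case: s => j; rewrite /b; case: ifP => _;
      rewrite ?cmod0 ?cmodR ?gtr0_norm// ltW.
    have := d0; lra.
  - by rewrite divr_gt0.
  - move=> t t0 tr; apply: heta; rewrite gtr0_norm//.
    by apply: le_lt_trans tr _; rewrite ltr_pdivrMr// ltr_pMr// ltr1n.
  - by rewrite cmod1; lra.
have hx : polydisc (fun=> 9 * delta) (fun s => Xp p s + 1 * b s).
  move=> s; rewrite mul1r (le_trans (cmodD _ _))//; have := Xp_small s hp.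
  have : cmod (b s) <= delta by case: s => j; rewrite /b; case: ifP => _;
      rewrite ?cmod0 ?cmodR ?gtr0_norm// ltW.
  have := d0; lra.
have := A_approx hx; rewrite z0 sub0r cmodN !mul1r.
have -> : b (inl o2) = rc delta by rewrite /b eqxx.
have -> : b (inr o1) = 0 by rewrite /b.
rewrite addr0 => h1.
have h2 : cmod (rc delta) <= cmod (Xp p (inl o2) + rc delta + 2 * eps * Xp p (inr o1)) +
    cmod (Xp p (inl o2) + 2 * eps * Xp p (inr o1)).
  apply: le_trans (cmodB _ _).
  rewrite [X in _ <= cmod X](_ : _ = rc delta)//; ring.
have h3 := cmodD (Xp p (inl o2)) (2 * eps * Xp p (inr o1)).
have h4 : cmod (2 * eps * Xp p (inr o1)) <= 2 * cmod (Xp p (inr o1)).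
  rewrite (le_trans (cmodM _ _))// ler_wpM2r ?cmod_ge0//.
  rewrite (le_trans (cmodM _ _))//.
  have -> : cmod (2 : C) = 2 by rewrite -(rmorph_nat rc) cmodR ger0_norm.
  by have := eps1; lra.
have h5 := Xp_small (inl o2) hp; have h6 := Xp_small (inr o1) hp.
have h7 : 3 * e * delta <= 3 / 1000 * delta.
  by apply: ler_wpM2r; [exact: ltW|have := e1; lra].
have h8 : cmod (rc delta) = delta by rewrite cmodR gtr0_norm.
rewrite h8 in h2.
by have := d0; lra.
Unshelve. all: by end_near. Qed.

(** The velocity of a leaf whose free coordinates move by [d]. *)
Definition leafvec (x : V -> C) (d : 'I_n -> C) : Cn1 :=
  mkp (fun j => if j == o1 then dleaf x d else d j)
    (dleaf x d * Df (inl o1) (Psi x) + \sum_(k | k != o1) d k * Df (inl k) (Psi x)).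

Lemma leaf_is_derive (g : V -> R -> C) t0 (d : 'I_n -> C) :
  (forall j, cder (g (inl j)) t0 (d j)) ->
  (forall j, cder (g (inr j)) t0 (conjc (d j))) ->
  polydisc rB (g^~ t0) -> sw (g^~ t0) = g^~ t0 ->
  (forall t, g (inl o1) t = g (inl o1) t0) ->
  (forall t, g (inr o1) t = g (inr o1) t0) ->
  is_derive t0 1 (fun t => graph_pt (Psi (g^~ t))) (leafvec (g^~ t0) d).
Proof.
move=> h1 h2 h3 h4 h5 h6.
have [D1 D2'] := leaf_cder h1 h2 h3 h4 h5 h6.
apply: (@mkp_is_derive _ _ (fun j t => Psi (g^~ t) (inl j)) (fun t => fC (Psi (g^~ t)))) => [j|].
  by rewrite /leafvec coord_mkp /Psi /repl; case: (j == o1); [exact: D1|exact: h1].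
by rewrite /leafvec wcoord_mkp.
Qed.

Lemma dleafJ x d1 d2 : (forall k, d2 k = ci * d1 k) -> dleaf x d2 = ci * dleaf x d1.
Proof.
move=> h; rewrite /dleaf mulrN mulr_sumr; congr (- _); apply: eq_bigr => k _.
by rewrite h mulrA.
Qed.

Lemma leafvecJ x d1 d2 : (forall k, d2 k = ci * d1 k) ->
  leafvec x d2 = J (leafvec x d1).
Proof.
move=> h; apply: mkp_ext => [j|].
  by rewrite coordJ /leafvec !coord_mkp (dleafJ x h) h; case: ifP.
rewrite /wcoord coordJ -!/(wcoord _) /leafvec !wcoord_mkp (dleafJ x h) mulrDr mulrA.
by congr (_ + _); rewrite mulr_sumr; apply: eq_bigr => k _; rewrite h mulrA.
Qed.

Definition sx (x : dom) : C := Complex (x 0 (lshift _ ord0)) (x 0 (lshift _ ord_max)).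
Definition zx (x : dom) (j : 'I_n.-1) : C := coord (rsubmx x) j.
Definition Yc (x : dom) (l : 'I_n) : C := if unlift o1 l is Some j then zx x j else sx x.
(** The real point with label [sx x] and free coordinates [zx x]. *)
Definition Yx (x : dom) : V -> C := fun s =>
  match s with inl l => Yc x l | inr l => conjc (Yc x l) end.
(** The parametrization of [M], by the label of a leaf and the free coordinates
    on it. *)
Definition Fp (x : dom) : Cn1 := graph_pt (Psi (Yx x)).
(** The label of the leaf through [p]; its level sets are the plaques. *)
Definition tau (p : Cn1) : 'rV[R]_2 :=
  \row_i (if i == ord0 then complex.Re (Ts (Xp p)) else complex.Im (Ts (Xp p))).
Definition gm (p : Cn1) : dom :=
  row_mx (tau p) (mkrow (fun j => coord p (wid (lift o1 j)))).
Definition Up : set dom := [set x | (forall s, cmod (Yx x s) < rB s) /\ `|Fp x| < etaW].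

Lemma sw_Yx x : sw (Yx x) = Yx x.
Proof. by apply/funext => -[l|l] //; exact: conjcK. Qed.

Lemma dom_ext (x y : dom) : sx x = sx y -> (forall j, zx x j = zx y j) -> x = y.
Proof.
move=> hs hz; rewrite -[x]hsubmxK -[y]hsubmxK; congr row_mx; last exact: coord_ext.
apply/rowP => k; rewrite !mxE; move: hs => [h1 h2].
by case: k => -[|[|//]] hk; [rewrite (_ : Ordinal hk = ord0)|rewrite (_ : Ordinal hk = ord_max)];
  rewrite //; apply: val_inj.
Qed.

Lemma sx_row (t : 'rV[R]_2) (z : 'rV[R]_(n.-1 + n.-1)) :
  sx (row_mx t z) = Complex (t 0 ord0) (t 0 ord_max).
Proof. by rewrite /sx !row_mxEl. Qed.
Lemma zx_row (t : 'rV[R]_2) (z : 'rV[R]_(n.-1 + n.-1)) j :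
  zx (row_mx t z) j = coord z j.
Proof. by rewrite /zx row_mxKr. Qed.

Lemma sx_gm p : sx (gm p) = Ts (Xp p).
Proof. by rewrite /gm sx_row /tau !mxE /=; case: (Ts _). Qed.
Lemma zx_gm p j : zx (gm p) j = coord p (wid (lift o1 j)).
Proof. by rewrite /gm zx_row coord_mkrow. Qed.

Lemma Yx_gm p : Yx (gm p) = yp p.
Proof.
have h l : Yc (gm p) l = yp p (inl l).
  rewrite /Yc /yp /repl; case: (unliftP o1 l) => [j ->|->].
    by rewrite zx_gm eq_sym (negbTE (neq_lift _ _)).
  by rewrite eqxx sx_gm.
rewrite -sw_yp; apply/funext => -[l|l]; last by rewrite /Yx h.
by rewrite /Yx h -{1}sw_yp.
Qed.

Lemma Xp_Fp x : Xp (Fp x) = Psi (Yx x).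
Proof. by rewrite /Fp /graph_pt real_pt// sw_Psi sw_Yx. Qed.

Lemma Fp_gm p : M p -> Fp (gm p) = p.
Proof. by move=> Mp; rewrite /Fp Yx_gm (Psi_yp (MW Mp)) graph_pt_Xp. Qed.

Lemma yp_ltB (p : Cn1) s : `|p| < etaW -> cmod (yp p s) < rB s.
Proof.
move=> hp; have h1 := Ts_small hp.
by case: s => j; have := Xp_small (inl j) hp; have := Xp_small (inr j) hp;
  rewrite /yp /repl /rB; case: ifP => _ h2 h3; rewrite ?cmod_conj; dlra.
Qed.

Lemma gm_U p : M p -> Up (gm p).
Proof.
move=> Mp; split; last by rewrite Fp_gm//; exact: MW.
by move=> s; rewrite Yx_gm; exact: yp_ltB (MW Mp).
Qed.

Lemma Fp_M x : Up x -> M (Fp x).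
Proof. by move=> [_ h]; apply: M_graph_pt => //; rewrite sw_Psi sw_Yx. Qed.

Lemma Up_rB x : Up x -> polydisc rB (Yx x).
Proof. by move=> [h _] s; exact: ltW. Qed.

(** The label is recovered by the uniqueness of the Segre variety through a
    point. *)
Lemma gm_Fp x : Up x -> gm (Fp x) = x.
Proof.
move=> Ux; have hp := Ux.2; apply: dom_ext => [|j].
  rewrite sx_gm -(@Ts_Psi (Fp x) (Yx x))//.
  - by rewrite /Yx /Yc unlift_none.
  - exact: Up_rB.
  - exact: sw_Yx.
  - by rewrite Xp_Fp.
rewrite zx_gm -[LHS]/(Xp (Fp x) (inl (lift o1 j))) Xp_Fp /Psi /repl.
by rewrite eq_sym (negbTE (neq_lift _ _)) /Yx /Yc liftK.
Qed.

Lemma graph_ran m (phi : V -> 'rV[R]_m -> C) (x : 'rV[R]_m) :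
  (forall s, ran (phi s) x) -> (forall s, cmod (phi s x) < rB s) ->
  forall i, ran (fun y => coord (graph_pt (Psi (phi^~ y))) i) x.
Proof.
move=> hr hlt.
have hlS s : cmod (phi s x) < rS s by exact: lt_trans (hlt s) (rB_ltS s).
have hl : polydisc rS (phi^~ x) by move=> v; exact: ltW.
have hPsi s : ran (fun y => Psi (phi^~ y) s) x.
  have r1 : ran (fun y => star H (phi^~ y)) x.
    by apply: (@ran_hol _ _ _ rS (delta / 8)) => //; apply: hol_star hH => -[].
  have r2 : ran (fun y => H (phi^~ y)) x by exact: ran_hol hH _ _.
  by case: s => j; rewrite /Psi /repl; case: (j == o1).
apply: (@mkp_ran _ _ _ (fun j y => Psi (phi^~ y) (inl j)) (fun y => fC (Psi (phi^~ y)))) => [j|].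
  exact: hPsi.
apply: ranD; last first.
  apply: (@ran_hol _ _ _ (fun=> 10 * delta) (e * delta ^+ 2) E
    (fun s y => Psi (phi^~ y) s)); [exact: hE|exact: hPsi|move=> s].
  apply: le_lt_trans (Psi_polydisc d0 e0 e1 hH hl s) _; dlra.
apply: ranD; first by apply: ranM.
by apply: ranM; [exact: ran_cst|apply: ranM].
Qed.

Lemma Yx_ran x s : ran (Yx^~ s) x.
Proof.
have h l : ran (Yc^~ l) x.
  rewrite /Yc; case: (unlift o1 l) => [j|].
    apply: ran_ext (ranD (ran_entry (rshift 2 (lshift _ j)) x)
      (ranM (ran_cst ci x) (ran_entry (rshift 2 (rshift _ j)) x))) => y.
    apply: complex_ext; rewrite /zx /coord ?cReD ?cImD ?cReM ?cImM /= !mxE;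
      by rewrite ?(mul0r, mulr0, mul1r, mulr1, subr0, addr0, add0r).
  apply: ran_ext (ranD (ran_entry (lshift _ ord0) x)
      (ranM (ran_cst ci x) (ran_entry (lshift _ ord_max) x))) => y.
  apply: complex_ext; rewrite /sx ?cReD ?cImD ?cReM ?cImM /=;
      by rewrite ?(mul0r, mulr0, mul1r, mulr1, subr0, addr0, add0r).
by case: s => l; [exact: h|exact/ran_conj/h].
Qed.

Lemma Fp_ran x : (forall s, cmod (Yx x s) < rB s) -> entries_ran Fp x.
Proof.
move=> hx; apply: coords_ran => i.
exact: (@graph_ran _ (fun s y => Yx y s) x (Yx_ran x) hx i).
Qed.

Lemma open_Up : open Up.
Proof.
rewrite openE => x [hx1 hx2]; rewrite /interior /Up.
have n1 : \forall y \near x, `|Fp y| < etaW.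
  have c : Fp y @[y --> x] --> Fp x.
    exact: (differentiable_continuous (entries_ran_differentiable (Fp_ran hx1))).
  exact: c _ (near_norm_lt hx2).
have n2 : \forall y \near x, forall s, cmod (Yx y s) < rB s.
  apply: (@filter_forall dom V (fun s y => cmod (Yx y s) < rB s) (nbhs x)) => s.
  have e0' : 0 < (rB s - cmod (Yx x s)) / 2 by rewrite divr_gt0// subr_gt0.
  have /climP/(_ _ e0') := ran_clim (Yx_ran x s).
  apply: filterS => y hy; have := cmodD (Yx x s) (Yx y s - Yx x s).
  by rewrite subrKC; move: (hx1 s) hy; lra.
by apply: filterS2 n1 n2 => y h1 h2.
Qed.

Lemma tau_ran (p : Cn1) : `|p| < etaW -> entries_ran tau p.
Proof.
move=> hp; have hT : ran (fun q => Ts (Xp q)) p.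
  apply: (ran_hol hTs (fun s => Xp_ran s p)) => s.
  exact: lt_trans (Xp_small s hp) (rT_gt s).
move=> k; case: (altP (k =P ord0)) => k0.
  by exists (fun q => Ts (Xp q)) => // q; rewrite mxE k0.
exists (fun q => - ci * Ts (Xp q)); first by apply: ranM => //; exact: ran_cst.
move=> q; rewrite mxE (negbTE k0) cReM.
by rewrite [complex.Re (- ci)]/= [complex.Im (- ci)]/= oppr0 mul0r sub0r mulN1r opprK.
Qed.

Lemma gm_ran (p : Cn1) : `|p| < etaW -> entries_ran gm p.
Proof.
move=> hp k; rewrite -(fintype.splitK k); case: (fintype.split k) => l.
  have [psi h1 h2] := tau_ran hp l; exists psi => // q.
  by rewrite -h2 /gm [unsplit _]/= row_mxEl.
have hr j : ran (fun q => coord (mkrow (fun j => coord q (wid (lift o1 j))) : Cn R _) j) p.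
  by apply: ran_ext (ran_coord (wid (lift o1 j)) p) => q; rewrite coord_mkrow.
have [psi h1 h2] := coords_ran hr l; exists psi => // q.
by rewrite -h2 /gm [unsplit _]/= row_mxEr.
Qed.

Lemma param_diffeo : analytic_diffeo Up M Fp.
Proof.
split.
- split.
  + by move=> x; exact: Fp_M.
  + by move=> x y; rewrite !inE => hx hy h; rewrite -(gm_Fp hx) h gm_Fp.
  + by move=> p Mp; exists (gm p); [exact: gm_U|exact: Fp_gm].
- by move=> x [hx _]; apply: entries_ran_analytic; exact: Fp_ran.
exists gm; first exact: gm_Fp.
move=> p Mp; exists gm; first exact/entries_ran_analytic/gm_ran/MW.
by near=> q.
Unshelve. all: by end_near. Qed.

(** The label does not move. *)
Definition disp (w : 'rV[R]_(n.-1 + n.-1)) (l : 'I_n) : C :=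
  if unlift o1 l is Some j then coord w j else 0.

Lemma Fp_row_differentiable (t : 'rV[R]_2) (z : 'rV[R]_(n.-1 + n.-1)) :
  Up (row_mx t z) -> differentiable (fun z => Fp (row_mx t z)) z.
Proof.
move=> [hx _]; apply: entries_ran_differentiable; apply: coords_ran => l.
apply: (@graph_ran _ (fun s z => Yx (row_mx t z) s)) => // s.
have h k : ran (fun z => Yc (row_mx t z) k) z.
  rewrite /Yc; case: (unlift o1 k) => [j|].
    by apply: ran_ext (ran_coord j z) => y; rewrite zx_row.
  by apply: ran_ext (ran_cst (Complex (t 0 ord0) (t 0 ord_max)) z) => y; rewrite sx_row.
by case: s => k; [exact: h|exact/ran_conj/h].
Qed.

Lemma Fp_row_diff (t : 'rV[R]_2) (z w : 'rV[R]_(n.-1 + n.-1)) :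
  Up (row_mx t z) ->
  'd (fun z => Fp (row_mx t z)) z w = leafvec (Yx (row_mx t z)) (disp w).
Proof.
move=> Ux; have D := derive_line w (Fp_row_differentiable Ux).
pose g (s : V) (a : R) := Yx (row_mx t (z + a *: w)) s.
have g0 : g^~ 0 = Yx (row_mx t z) by rewrite /g scale0r addr0.
have gc (l : 'I_n) : cder (fun a => Yc (row_mx t (z + a *: w)) l) 0 (disp w l).
  rewrite /Yc /disp; case: (unlift o1 l) => [j|].
    apply: (@cder_eq _ (fun a : R => coord z j + real_complex R a * coord w j)) => [a|]; last exact: rc_lin_cder.
    by rewrite zx_row coordD coordZ.
  apply: (@cder_eq _ (fun=> sx (row_mx t z))) => [a|]; last exact: cder_cst.
  by rewrite !sx_row.
have go a l : l = o1 -> Yc (row_mx t (z + a *: w)) l = Yc (row_mx t z) l.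
  by move=> ->; rewrite /Yc unlift_none !sx_row.
rewrite -g0; apply: (is_derive_eq_val D).
apply: leaf_is_derive.
- exact: gc.
- by move=> j; exact: cder_conj (gc j).
- by rewrite g0; exact: Up_rB.
- by rewrite g0 sw_Yx.
- by move=> a; rewrite /g /= scale0r addr0; exact: go.
- by move=> a; rewrite /g /= scale0r addr0 go.
Qed.

(** The differential in [zeta] is [leafvec], which is complex linear in the
    displacement. *)
Lemma Fp_CR : CR_map Up Fp.
Proof.
move=> t z Ux; split; first exact: Fp_row_differentiable.
move=> w; rewrite !Fp_row_diff//; apply: leafvecJ => l.
by rewrite /disp; case: (unlift o1 l) => [j|]; rewrite ?coordJ ?mulr0.
Qed.

(** Move the label in the parametrization [Fp], where [tau] is a coordinate. *)
Lemma tau_submersion p : M p -> forall u, exists2 v, tangent M p v & 'd tau p v = u.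
Proof.
move=> Mp u; pose w : dom := row_mx u 0; pose x0 := gm p.
have Ux := gm_U Mp; have dF := entries_ran_differentiable (Fp_ran Ux.1).
have dt := entries_ran_differentiable (tau_ran (MW Mp)).
have D := derive_line w dF.
have xc : x0 + t *: w @[t --> (0 : R)] --> x0.
  have := is_derive_cvg (line_is_derive x0 w); by rewrite scale0r addr0.
have n1 : \forall t \near (0 : R), Up (x0 + t *: w).
  apply: xc; apply: open_nbhs_nbhs; split; [exact: open_Up|exact: Ux].
exists ('d Fp x0 w).
  exists (fun t => Fp (x0 + t *: w)); split=> //.
    by rewrite scale0r addr0 Fp_gm.
  by apply: filterS n1 => t; exact: Fp_M.
have dt' : differentiable tau (Fp x0) by rewrite Fp_gm.
have dc : differentiable (tau \o Fp) x0 by exact: differentiable_comp.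
have D2' := derive_line w dc.
rewrite (diff_comp_val w (Fp_gm Mp) dF dt).
apply: (is_derive_eq_val D2').
have D3 := line_is_derive (tau p) u.
apply: near_eq_is_derive D3.
apply: filterS n1 => t /gm_Fp h; rewrite /= -[tau (Fp _)](row_mxKl _ (mkrow (fun j => coord (Fp (x0 + t *: w)) (wid (lift o1 j))))).
rewrite -/(gm _) h linearD linearZ /= row_mxKl row_mxKl//.
Qed.

(** The motion [dleaf] of the first coordinate is chosen by the slopes, and the
    equation of [T^c] has the same slopes by [B_Xp]. *)
Lemma leafvec_Tc p d : M p -> Tc M p (leafvec (yp p) d).
Proof.
move=> Mp; have hp := MW Mp; apply/(Tc_graph gDf hM _ hp (Xp9 Mp) Mp).
rewrite /dbar /dlin /leafvec wcoord_mkp (Psi_yp hp); split.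
  rewrite (bigD1 o1)// coord_mkp eqxx.
  transitivity (A (Xp p) * (conjc (dleaf (yp p) d) +
      \sum_(k | k != o1) conjc (d k) * slope (yp p) k)).
    rewrite mulrDr mulr_sumr mulrC; congr (_ + _); apply: eq_bigr => k /negbTE k1.
    by rewrite coord_mkp k1 (B_Xp k hp); exact: mulrCA.
  rewrite /dleaf conjcN conjc_sum.
  rewrite (_ : \sum_(k < n | k != o1) conjc (d k * conjc (slope (yp p) k)) =
    \sum_(k | k != o1) conjc (d k) * slope (yp p) k); first by rewrite addNr mulr0.
  by apply: eq_bigr => k _; rewrite conjcM conjcK.
rewrite [RHS](bigD1 o1)// coord_mkp eqxx; congr (_ + _); apply: eq_bigr => k /negbTE k1.
by rewrite coord_mkp k1.
Qed.

Lemma Tc_leafvec p v : M p -> A (Xp p) != 0 -> Tc M p v ->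
  v = leafvec (yp p) (fun k => if k == o1 then 0 else coord v (wid k)).
Proof.
move=> Mp An; have hp := MW Mp; move/(Tc_graph gDf hM _ hp (Xp9 Mp) Mp).
set d := (fun k => _); move=> [h1 h2].
have v1 : coord v (wid o1) = dleaf (yp p) d.
  rewrite -[LHS]conjcK; apply/eqP; rewrite -subr_eq0; apply/eqP.
  apply: (mulfI An); rewrite mulr0.
  have -> : conjc (conjc (coord v (wid o1))) - dleaf (yp p) d =
    conjc (conjc (coord v (wid o1)) + \sum_(k | k != o1) conjc (d k) * slope (yp p) k).
    rewrite conjcD conjcK; congr (_ + _); rewrite /dleaf opprK conjc_sum.
    by apply: eq_bigr => k _; rewrite [RHS]conjcM conjcK.
  have -> : conjc (coord v (wid o1)) + \sum_(k | k != o1) conjc (d k) * slope (yp p) k = 0.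
    apply: (mulfI An); rewrite mulr0 -[RHS]h1 /dbar [RHS](bigD1 o1)// mulrDr mulrC.
    congr (_ + _); rewrite mulr_sumr; apply: eq_bigr => k /negbTE k1.
    by rewrite (B_Xp k hp) /d k1; exact: mulrCA.
  by rewrite conjc0 mulr0.
apply: mkp_ext => [j|].
  by rewrite coord_mkp; case: eqP => [->//|/eqP/negbTE j1]; rewrite /d j1.
rewrite wcoord_mkp (Psi_yp hp) h2 /dlin [LHS](bigD1 o1)// v1; congr (_ + _).
by apply: eq_bigr => k /negbTE k1; rewrite /d k1.
Qed.

Lemma tau_eq p q : tau p = tau q <-> Ts (Xp p) = Ts (Xp q).
Proof.
split=> [h|h]; last by apply/rowP => k; rewrite !mxE h.
have h0 := congr1 (fun r : 'rV[R]_2 => r 0 ord0) h.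
have h1 := congr1 (fun r : 'rV[R]_2 => r 0 ord_max) h.
by move: h0 h1; rewrite !mxE /= => h0 h1; exact: complex_ext.
Qed.

Local Notation ball_W := [set p : Cn1 | `|p| < etaW].
Local Notation chartW := (ball_W, tau).

(** A curve in a plaque lifts to a curve with constant label in the
    parametrization, so its velocity is a [leafvec]. Conversely, a vector of
    [T^c] is a [leafvec] as [A <> 0], and it is the velocity of such a curve. *)
Lemma plaque_tangent p : CR_part M p ->
  tangent (plaque (CR_part M) chartW p) p = Tc M p.
Proof.
move=> CRp; have Mp := CRp.1; have hp := MW Mp; have An := CR_A CRp.
apply/seteqP; split=> v.
- move=> [c [c0 cP cd]].
  pose d (k : 'I_n) : C := if k == o1 then 0 else coord v (wid k).
  pose g0 (l : 'I_n) (t : R) : C := if l == o1 then Ts (Xp p) else coord (c t) (wid l).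
  pose g (s : V) (t : R) : C := match s with inl l => g0 l t | inr l => conjc (g0 l t) end.
  have gc l : cder (g0 l) 0 (d l).
    rewrite /g0 /d; case: (l == o1); first exact: cder_cst.
    by move/cder_row: cd => /(_ (wid l)).
  have gE t : Ts (Xp (c t)) = Ts (Xp p) -> g^~ t = yp (c t).
    move=> h; apply/funext => -[l|l]; rewrite /g /g0 /yp /repl h; case: (l == o1) => //.
  have gy : g^~ 0 = yp p by rewrite gE c0.
  have D : is_derive (0 : R) (1 : R) (fun t => graph_pt (Psi (g^~ t))) (leafvec (yp p) d).
    rewrite -gy; apply: leaf_is_derive.
    + exact: gc.
    + by move=> j; exact: cder_conj (gc j).
    + by rewrite gy; exact: yp_rB.
    + by rewrite gy; exact: sw_yp.
    + by move=> t; rewrite /g /g0 eqxx.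
    + by move=> t; rewrite /g /g0 eqxx.
  have -> : v = leafvec (yp p) d; last exact: leafvec_Tc.
  apply: (is_derive_eq_val cd); apply: near_eq_is_derive D.
  apply: filterS cP => t [CRt /= hct /tau_eq ht].
  by rewrite (gE t ht) (Psi_yp hct) graph_pt_Xp//; exact: CRt.1.
- move=> /(Tc_leafvec Mp An); set d := (fun k => _) => vE.
  pose dd (s : V) : C := match s with inl l => d l | inr l => conjc (d l) end.
  pose g (s : V) (t : R) : C := yp p s + rc t * dd s.
  have gy : g^~ 0 = yp p by apply/funext => s; rewrite /g mul0r addr0.
  have gc s : cder (g s) 0 (dd s) by exact: rc_lin_cder.
  have d1 : d o1 = 0 by rewrite /d eqxx.
  have dl : dd (inl o1) = 0 by [].
  have dr : dd (inr o1) = 0 by rewrite /dd d1 conjc0.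
  have swg t : sw (g^~ t) = g^~ t.
    apply/funext => s; rewrite /sw /g conjcD conjcM conjc_rc -[conjc (yp _ _)]/(sw (yp p) s).
    by rewrite sw_yp; case: s => l //=; rewrite conjcK.
  have D : is_derive (0 : R) (1 : R) (fun t => graph_pt (Psi (g^~ t))) v.
    rewrite vE -gy; apply: leaf_is_derive.
    + by move=> j; exact: gc (inl j).
    + by move=> j; exact: gc (inr j).
    + by rewrite gy; exact: yp_rB.
    + by rewrite gy; exact: sw_yp.
    + by move=> t; rewrite /g dl !mulr0.
    + by move=> t; rewrite /g dr !mulr0.
  have E0 : graph_pt (Psi (g^~ 0)) = p by rewrite gy (Psi_yp hp) graph_pt_Xp.
  exists (fun t => graph_pt (Psi (g^~ t))); split=> //.
  have := is_derive_cvg D; rewrite E0 => gcv.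
  have n1 : \forall t \near (0 : R), `|graph_pt (Psi (g^~ t))| < etaW := gcv _ (near_norm_lt hp).
  have n2 : \forall t \near (0 : R), M (graph_pt (Psi (g^~ t))) -> CR_part M (graph_pt (Psi (g^~ t))) :=
    gcv _ (CR_part_open CRp).
  have n3 : \forall t \near (0 : R), forall s, cmod (g s t) < rB s.
    apply: (@filter_forall R V (fun s t => cmod (g s t) < rB s) (nbhs (0 : R))) => s.
    have e0' : 0 < (rB s - cmod (yp p s)) / 2 by rewrite divr_gt0// subr_gt0; exact: yp_ltB.
    have /climP/(_ _ e0') := cder_clim (gc s).
    have -> : g s 0 = yp p s by rewrite -gy.
    apply: filterS => t ht; have := cmodD (yp p s) (g s t - yp p s).
    by rewrite subrKC; move: (yp_ltB s hp) ht; lra.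
  near=> t.
  have h1 : `|graph_pt (Psi (g^~ t))| < etaW by near: t; exact: n1.
  have h2 : M (graph_pt (Psi (g^~ t))) -> CR_part M (graph_pt (Psi (g^~ t))) by near: t; exact: n2.
  have h3 : forall s, cmod (g s t) < rB s by near: t; exact: n3.
  have swP : sw (Psi (g^~ t)) = Psi (g^~ t) by rewrite sw_Psi swg.
  split=> //; first by apply/h2/M_graph_pt.
  apply/tau_eq; rewrite -(@Ts_Psi (graph_pt (Psi (g^~ t))) (g^~ t))//.
  + by rewrite /g dl mulr0 addr0 /yp /repl eqxx.
  + by move=> s; exact: ltW.
  + by rewrite /graph_pt real_pt.
Unshelve. all: by end_near. Qed.

Lemma same_germ_refl (p : Cn1) (S : set Cn1) : same_germ p S S.
Proof. by rewrite /same_germ; near=> q. Unshelve. all: by end_near. Qed.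

Lemma chartW_submersion_CR p : CR_part M p ->
  forall u, exists2 v, tangent (CR_part M) p v & 'd tau p v = u.
Proof.
move=> CRp u; have [v h1 h2] := tau_submersion CRp.1 u; exists v => //.
exact: tangent_germ (CR_part_open CRp) h1.
Qed.

Lemma open_ball_W : open ball_W.
Proof. by rewrite openE => p hp; exact: near_norm_lt. Qed.

Definition foliation_M : foliation 2 M.
Proof.
apply: (@Foliation _ _ 2 M [set chartW]).
- by move=> phi ->; exact: open_ball_W.
- by move=> p Mp; exists chartW => //; exact: MW.
- by move=> phi p -> hp; exact/entries_ran_analytic/tau_ran.
- by move=> phi p -> Mp _; exact: tau_submersion.
- by move=> phi psi p -> -> *; exact: same_germ_refl.
Defined.

Definition foliation_CR : foliation 2 (CR_part M).
Proof.
apply: (@Foliation _ _ 2 (CR_part M) [set chartW]).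
- by move=> phi ->; exact: open_ball_W.
- by move=> p CRp; exists chartW => //; exact: MW CRp.1.
- by move=> phi p -> hp; exact/entries_ran_analytic/tau_ran.
- by move=> phi p -> CRp _; exact: chartW_submersion_CR.
- by move=> phi psi p -> -> *; exact: same_germ_refl.
Defined.

Lemma chart_conclusion :
  (exists (F : foliation 2 M) (L : foliation 2 (CR_part M)),
      is_Levi_foliation L /\ extends_foliation F L) /\
  (exists (U : set dom) (F : dom -> Cn1),
      [/\ open U, CR_map U F & analytic_diffeo U M F]).
Proof.
split; last by exists Up, Fp; split; [exact: open_Up|exact: Fp_CR|exact: param_diffeo].
exists foliation_M, foliation_CR; split.
  by move=> phi p -> CRp _; exact: plaque_tangent.
move=> p CRp phi psi -> -> _ _.
apply: filterS (CR_part_open CRp) => q h; split=> -[h1 h2 h3]; split=> //.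
- exact: h.
- exact: h1.1.
Qed.

End Chart.

(** * Complexification of the defining function and choice of scale *)

Section Final.
Context {R : realType} {n : nat} (hn : (2 <= n)%N).
Local Notation C := R[i].
Local Notation V := ('I_n + 'I_n)%type.
Local Notation o1 := (Ordinal (ltnW hn) : 'I_n).
Local Notation o2 := (Ordinal hn : 'I_n).
Local Notation rc := (real_complex R).
Local Notation Cn1 := 'rV[R]_(n.+1 + n.+1).

(** Turns functions of the real coordinates into functions of [z] and [xi = conj
    z]. *)
Definition realcoord (i : 'I_(n + n)) (x : V -> C) : C :=
  match fintype.split i with
  | inl j => rc (1 / 2) * (x (inl j) + x (inr j))
  | inr j => Complex 0 (- (1 / 2)) * (x (inl j) - x (inr j))
  end.

Lemma realcoord_Xp (p : Cn1) : (fun i => realcoord i (Xp p)) = rpt (zpart p).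
Proof.
have XE1 j : Xp p (inl j) = coord p (wid j) by [].
have XE2 j : Xp p (inr j) = conjc (coord p (wid j)) by [].
apply/funext => i; rewrite /realcoord /rpt -{2}(fintype.splitK i).
case: (fintype.split i) => j.
  rewrite [unsplit _]/= -[zpart p 0 _]/(complex.Re (coord (zpart p) j)) zpart_coord.
  rewrite XE1 XE2.
  by move: (coord p (wid j)) => [a b]; apply: complex_ext;
    rewrite !(cReM, cImM, cReD, cImD, cReN, cImN) /=; lra.
rewrite [unsplit _]/= -[zpart p 0 _]/(complex.Im (coord (zpart p) j)) zpart_coord.
rewrite XE1 XE2.
by move: (coord p (wid j)) => [a b]; apply: complex_ext;
    rewrite !(cReM, cImM, cReD, cImD, cReN, cImN) /=; lra.
Qed.

Lemma realcoord_hol (t : R) i : 0 <= t -> hol (fun=> t) t (realcoord i).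
Proof.
move=> t0; have hv (s : V) : hol (fun=> t) t (@^~ s) by exact: (hol_var (fun=> t0)).
rewrite /realcoord; case: (fintype.split i) => j.
  apply: hol_leK (holZ (rc (1 / 2)) (holD (hv (inl j)) (hv (inr j)))).
  by rewrite cmodR ger0_norm; lra.
apply: hol_leK (holZ (Complex 0 (- (1 / 2))) (holB (hv (inl j)) (hv (inr j)))).
by rewrite /cmod /= normr0 normrN ger0_norm; lra.
Qed.

Lemma zpart_le (p : Cn1) i : `|zpart p 0 i| <= `|p|.
Proof.
rewrite -(fintype.splitK i); case: (fintype.split i) => j; rewrite /zpart [unsplit _]/=.
  by rewrite row_mxEl mxE; exact: mx_entry_le.
by rewrite row_mxEr mxE; exact: mx_entry_le.
Qed.

Lemma complexification (E : 'rV[R]_(n + n) -> C) k :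
  vanishing_analytic k (fun z => complex.Re (E z)) ->
  vanishing_analytic k (fun z => complex.Im (E z)) ->
  exists (r C0 : R) (F : (V -> C) -> C),
    [/\ 0 < r, 0 <= C0,
      forall t, 0 <= t -> t <= r -> hol (fun=> t) (C0 * t ^+ k) F
    & forall p : Cn1, `|p| <= r -> F (Xp p) = E (zpart p)].
Proof.
move=> /power_series_hol[r1 [C1 [F1 [r10 C10 h1 e1]]]].
move=> /power_series_hol[r2 [C2 [F2 [r20 C20 h2 e2]]]].
exists (Num.min r1 r2), (C1 + C2),
  (fun x => F1 (fun i => realcoord i x) + ci * F2 (fun i => realcoord i x)).
split; first by rewrite lt_min r10.
- exact: addr_ge0.
- move=> t t0; rewrite le_min => /andP[t1 t2].
  have hc (F : ('I_(n + n) -> C) -> C) K : hol (fun=> t) K F ->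
      hol (fun=> t) K (fun x : V -> C => F (fun i => realcoord i x)).
    by move=> hF; apply: hol_comp hF _ => // i; exact: realcoord_hol.
  rewrite mulrDl -[C2 * _]mul1r -(@cmod_i R); apply: holD; first exact: hc (h1 _ _ _).
  exact: holZ (hc _ _ (h2 _ _ _)).
- move=> p; rewrite le_min => /andP[p1 p2]; rewrite realcoord_Xp.
  rewrite e1 ?e2 => [|i|i]; last 2 first.
  + exact: le_trans (zpart_le p i) p2.
  + exact: le_trans (zpart_le p i) p1.
  apply: complex_ext; rewrite ?cReD ?cImD ?cReM ?cImM /=; ring.
Qed.

Variables (delta e : R) (eps : C) (E : (V -> C) -> C).
Hypothesis d0 : 0 < delta.
Hypothesis dle1 : delta <= 1.
Hypothesis e0 : 0 <= e.
Hypothesis e1 : e <= 1 / 1000.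
Hypothesis eps1 : cmod eps <= 1.
Hypothesis hE : hol (fun _ : V => 10 * delta) (e * delta ^+ 2) E.
Local Notation fC := (fC hn eps E).

Lemma cmod2 : cmod (2 : C) = 2.
Proof. by rewrite -(rmorph_nat rc) cmodR ger0_norm. Qed.

Lemma delta_ge0 (c : R) (v : V) : 0 <= c -> 0 <= c * delta.
Proof. by move=> c0; rewrite mulr_ge0// ltW. Qed.

(** The gradient of [E] is small by the Cauchy estimate, that of the quadratic
    part of [fC] is explicit. *)
Lemma gradients : exists (K : R) (Df : V -> (V -> C) -> C)
    (D2 : 'I_n -> V -> (V -> C) -> C),
  [/\ (forall v, hol (fun=> 9 * delta) K (Df v)) /\ isgrad (fun=> 9 * delta) fC Df,
      forall k v, hol (fun=> 8 * delta) K (D2 k v),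
      forall k, isgrad (fun=> 8 * delta) (Df (inr k)) (D2 k)
    & forall x, polydisc (fun=> 9 * delta) x ->
        cmod (Df (inr o1) x - (x (inl o2) + 2 * eps * x (inr o1))) <= 3 * e * delta].
Proof.
have hE9 : hol (fun _ : V => 9 * delta + delta) (e * delta ^+ 2) E.
  by rewrite (_ : 9 * delta + delta = 10 * delta)//; ring.
have [DE hDE gDE] := hol_grad d0 (fun v => delta_ge0 v (ler0n R 9)) hE9.
pose q (x : V -> C) := x (inl o2) + 2 * eps * x (inr o1).
pose Dq (v : V) (x : V -> C) : C :=
  if v == inl o2 then x (inr o1) else if v == inr o1 then q x else 0.
pose Df v (x : V -> C) := DE v x + Dq v x.
(* a bound for the gradient of the quadratic part, using that eps has modulus at
   most 1 *)
pose Kq := 9 * delta + 2 * (9 * delta).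
have hq v : hol (fun=> 9 * delta) Kq (Dq v).
  have Kq0 : 0 <= Kq by rewrite /Kq; have := d0; lra.
  rewrite /Dq; case: (v == inl o2).
    by apply: hol_leK (hol_var (fun v => delta_ge0 v (ler0n R 9)) (inr o1)); rewrite /Kq; have := d0; lra.
  case: (v == inr o1); last by apply: hol_leK (hol_cst (fun v => delta_ge0 v (ler0n R 9)) 0); rewrite cmod0.
  apply: hol_leK (holD (hol_var (fun v => delta_ge0 v (ler0n R 9)) (inl o2)) (holZ (2 * eps) (hol_var (fun v => delta_ge0 v (ler0n R 9)) (inr o1)))).
  rewrite /Kq lerD2l; apply: ler_wpM2r; first by have := d0; lra.
  rewrite (le_trans (cmodM _ _))// cmod2.
  by have := eps1; lra.
pose K1 := e * delta ^+ 2 / (delta / 3) + Kq.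
have hDf v : hol (fun=> 9 * delta) K1 (Df v) by exact: holD (hDE v) (hq v).
have hDf8 k : hol (fun _ : V => 8 * delta + delta) K1 (Df (inr k)).
  by rewrite (_ : 8 * delta + delta = 9 * delta)//; ring.
have /choice[D2 hD2] k : exists D, (forall v, hol (fun _ : V => 8 * delta) (K1 / (delta / 3)) (D v)) /\
    isgrad (fun _ : V => 8 * delta) (Df (inr k)) D.
  by have [D h1 h2] := hol_grad d0 (fun v => delta_ge0 v (ler0n R 8)) (hDf8 k); exists D.
exists (Num.max K1 (K1 / (delta / 3))), Df, D2; split.
- split=> [v|g t0 d gd hg]; first by apply: hol_leK (hDf v); rewrite le_max lexx.
  have D1 := gDE _ _ _ gd hg.
  have D3 := cderD (cderM (gd (inr o1)) (gd (inl o2)))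
    (cderZ eps (cderM (gd (inr o1)) (gd (inr o1)))).
  have D4 := cderD D3 D1.
  have -> : \sum_v d v * Df v (g^~ t0) =
     d (inr o1) * g (inl o2) t0 + g (inr o1) t0 * d (inl o2) +
     eps * (d (inr o1) * g (inr o1) t0 + g (inr o1) t0 * d (inr o1)) +
     \sum_v d v * DE v (g^~ t0).
    rewrite (eq_bigr (fun v => d v * DE v (g^~ t0) + d v * Dq v (g^~ t0))); last first.
      by move=> v _; rewrite /Df mulrDr.
    rewrite big_split [LHS]addrC; congr (_ + _).
    rewrite (bigD1 (inl o2 : V))//= (bigD1 (inr o1 : V))//= big1 => [|v /andP[v1 v2]].
      by rewrite /Dq !eqxx /q /=; ring.
    by rewrite /Dq (negbTE v1) (negbTE v2) mulr0.
  by apply: cder_eq D4 => t; rewrite /fC expr2.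
- by move=> k v; apply: hol_leK ((hD2 k).1 v); rewrite le_max lexx orbT.
- by move=> k; exact: (hD2 k).2.
move=> x hx; rewrite /Df /Dq eqxx /= /q addrK.
have -> : 3 * e * delta = e * delta ^+ 2 / (delta / 3).
  by field; rewrite gt_eqF.
exact: hol_bound (hDE _) hx.
Qed.

Variables (M : set Cn1) (eta0 : R).
Hypothesis eta0d : 201 * delta <= eta0.
Hypothesis hM : forall p : Cn1, `|p| < eta0 -> (M p <-> wcoord p = fC (Xp p)).
Hypothesis flat : Levi_flat M.

Lemma fC_le x : polydisc (fun=> 8 * delta) x -> cmod (fC x) <= 200 * delta.
Proof.
move=> hx; have h1 := hx (inr o1); have h2 := hx (inl o2).
have hEx : cmod (E x) <= e * delta ^+ 2.
  by apply: hol_bound hE _ => v; apply: le_trans (hx v) _; have := d0; lra.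
have dd : delta ^+ 2 <= delta by rewrite expr2 ler_piMr// ltW.
have dd0 : 0 <= delta ^+ 2 by exact: sqr_ge0.
have b1 : cmod (x (inr o1) * x (inl o2)) <= 8 * delta * (8 * delta).
  by rewrite (le_trans (cmodM _ _))// ler_pM ?cmod_ge0.
have b2 : cmod (x (inr o1) ^+ 2) <= 8 * delta * (8 * delta).
  by rewrite expr2 (le_trans (cmodM _ _))// ler_pM ?cmod_ge0.
have b3 : cmod (eps * x (inr o1) ^+ 2) <= 1 * (8 * delta * (8 * delta)).
  by rewrite (le_trans (cmodM _ _))// ler_pM ?cmod_ge0.
have b4 : e * delta ^+ 2 <= 1 / 1000 * delta ^+ 2 by rewrite ler_wpM2r.
have := cmodD (x (inr o1) * x (inl o2) + eps * x (inr o1) ^+ 2) (E x).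
have := cmodD (x (inr o1) * x (inl o2)) (eps * x (inr o1) ^+ 2).
rewrite /fC; move: dd dd0 b1 b3 b4; rewrite !expr2; have := d0; lra.
Qed.

Lemma local_foliation (etaW : R) : 2 * etaW <= delta / 200 ->
  let MW := M `&` [set p | `|p| < etaW] in
  (exists (F : foliation 2 MW) (L : foliation 2 (CR_part MW)),
      is_Levi_foliation L /\ extends_foliation F L) /\
  (exists (U : set 'rV[R]_(2 + (n.-1 + n.-1))) (F : 'rV[R]_(2 + (n.-1 + n.-1)) -> Cn1),
      [/\ open U, CR_map U F & analytic_diffeo U MW F]).
Proof.
move=> etaW1 MW.
have [K [Df [D2 [[hDf gDf] hD2 gD2 A_approx]]]] := gradients.
have [H hH eqH] := segre_solution hn d0 e0 e1 eps1 hE.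
have [Ts [Tsg [hTs hTsg eqT]]] := segre_inverse d0 e0 e1 eps1 hE eqH.
have r80 : 0 < 8 * delta by have := d0; lra.
have r89 : 8 * delta < 9 * delta by have := d0; lra.
have levi0 x : polydisc (fun=> 8 * delta) x -> sw x = x -> Df (inr o1) x != 0 ->
    forall j k, levi_form hn Df D2 j k x = 0.
  move=> hx swx An j k; pose p : Cn1 := mkp (fun j => x (inl j)) (fC x).
  have Xpx : Xp p = x by exact: real_pt.
  have hp : `|p| < eta0.
    apply: lt_le_trans eta0d.
    apply: norm_coord_lt; first by have := d0; lra.
    apply: ord_wid => [l|]; first by rewrite coord_mkp; have := hx (inl l); have := d0; lra.
    by rewrite -/(wcoord _) wcoord_mkp; have := fC_le hx; have := d0; lra.
  have Mp : M p by apply/hM => //; rewrite wcoord_mkp Xpx.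
  have := levi_real r80 r89 gDf hDf gD2 hM flat j k hp; rewrite Xpx; exact.
apply: (chart_conclusion d0 e0 e1 eps1 hE hH eqH hTs eqT hTsg hDf gDf hD2 gD2
  A_approx levi0 etaW1) => [p hp|p []//].
rewrite -hM; first by split=> [[]|] //; split.
apply: lt_trans hp _; have := d0; have := eta0d; lra.
Qed.
End Final.

Lemma exists_scale (R : realType) (r eta C0 : R) : 0 < r -> 0 < eta -> 0 <= C0 ->
  exists delta : R, [/\ 0 < delta, delta <= 1, 10 * delta <= r, 201 * delta <= eta
    & C0 * (10 * delta) ^+ 3 <= 1 / 1000 * delta ^+ 2].
Proof.
move=> r0 eta0 C00; have c0 : 0 < 1 + 10 ^+ 6 * C0 by rewrite ltr_wpDr// mulr_ge0.
exists (Num.min (Num.min (r / 10) (eta / 201)) (1 + 10 ^+ 6 * C0)^-1).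
set delta := Num.min _ _.
have h1 : delta <= r / 10 by rewrite !ge_min lexx.
have h2 : delta <= eta / 201 by rewrite !ge_min lexx orbT.
have h3 : delta <= (1 + 10 ^+ 6 * C0)^-1 by rewrite ge_min lexx orbT.
have d0 : 0 < delta by rewrite !lt_min !divr_gt0// invr_gt0.
have h4 : delta * (1 + 10 ^+ 6 * C0) <= 1 by rewrite -ler_pdivlMr// div1r.
have h5 : 0 <= delta * (10 ^+ 6 * C0) by rewrite !mulr_ge0// ltW.
split=> //; [|lra|lra|].
  by move: h4; rewrite mulrDr mulr1; lra.
rewrite [leLHS](_ : _ = 1 / 1000 * delta ^+ 2 * (delta * (10 ^+ 6 * C0))); last by field.
have q0 : 0 <= 1 / 1000 :> R by lra.
have s0 : 0 <= 1 / 1000 * delta ^+ 2 := mulr_ge0 q0 (sqr_ge0 delta).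
move: (1 / 1000 * delta ^+ 2) s0 => s s0; rewrite -[leRHS]mulr1; apply: ler_wpM2l => //.
by move: h4; rewrite mulrDr mulr1; have := d0; lra.
Qed.

(** The two types differ only in the coefficient of the square. *)
Lemma common_type (R : realType) (n : nat) (hn : (2 <= n)%N) (M : set (Cn R n.+1)) :
  type_C1 hn M \/ type_C0 hn M -> exists eps : R[i],
  cmod eps <= 1 /\
  germ_O3 (fun z => (z1 hn z)^* * z2 hn z + eps * (z1 hn z)^* ^+ 2)%C M.
Proof.
case=> [h|h]; [exists 1|exists 0]; split; rewrite ?cmod1 ?cmod0//.
- by case: h => E [h1 h2 h3]; exists E; split=> //; apply: filterS h3 => p; rewrite mul1r.
- by case: h => E [h1 h2 h3]; exists E; split=> //; apply: filterS h3 => p; rewrite mul0r addr0.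
Qed.

Theorem theorem1p2 (R : realType) (n : nat) (hn : (2 <= n)%N)
  (M : set (Cn R n.+1))
  (hM : analytic_submanifold 2 M)
  (hsing : CR_singular_at M 0)
  (hflat : Levi_flat M)
  (htype : type_C1 hn M \/ type_C0 hn M) :
  (exists W : set (Cn R n.+1), [/\ open W, W 0
     & exists (F : foliation 2 (M `&` W)) (L : foliation 2 (CR_part (M `&` W))),
         is_Levi_foliation L /\ extends_foliation F L])
  /\
  (exists (U : set 'rV[R]_(2 + (n.-1 + n.-1))) (U' : set (Cn R n.+1))
     (F : 'rV[R]_(2 + (n.-1 + n.-1)) -> Cn R n.+1),
     [/\ open U, open U' /\ U' 0, CR_map U F & analytic_diffeo U (M `&` U') F]).
Proof.
have [eps [eps1 [E' [hRe hIm hgerm]]]] := common_type htype.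
have [r [C0 [E [r0 C00 hE EE']]]] := complexification hRe hIm.
have [eta eta0 heta] : exists2 eta : R, 0 < eta & forall p : Cn R n.+1, `|p| < eta ->
    (M p <-> wcoord p =
      (z1 hn (zpart p))^*%C * z2 hn (zpart p) + eps * (z1 hn (zpart p))^*%C ^+ 2 + E' (zpart p)).
  have /nbhs_ballP[eta /= eta0 h] := hgerm; exists eta => // p hp; apply: h.
  by rewrite -ball_normE /= sub0r normrN.
have m0 : 0 < Num.min eta r by rewrite lt_min eta0.
have [delta [d0 d1 dr deta dC]] := exists_scale r0 m0 C00.
have e0 : 0 <= 1 / 1000 :> R by lra.
have hEd : hol (fun=> 10 * delta) (1 / 1000 * delta ^+ 2) E.
  by apply: hol_leK dC (hE _ _ dr); rewrite mulr_ge0// ltW.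
have hMf (p : Cn R n.+1) : `|p| < Num.min eta r ->
    (M p <-> wcoord p = fC hn eps E (Xp p)).
  rewrite lt_min => /andP[p1 p2]; rewrite (heta p p1) /fC EE'; last exact: ltW.
  by rewrite /z1 /z2 !zpart_coord.
have etaW1 : 2 * (delta / 400) <= delta / 200 by lra.
have [hfol hpar] := local_foliation d0 d1 e0 (lexx _) eps1 hEd deta hMf hflat etaW1.
set W := [set p | `|p| < delta / 400] in hfol hpar.
have oW : open W by rewrite openE => p hp; exact: near_norm_lt.
have W0 : W 0 by rewrite /W /= normr0 divr_gt0.
split; first by exists W.
by have [U [F [h1 h2 h3]]] := hpar; exists U, W, F.
Qed.
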